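(* Let $f(x)\in\mathbb{R}[x]$ be a homogeneous polynomial of degree $d$ in the $\sigma(n)$ variables $x=(x_{ij})_{1\le i\le j\le n}$. Then the Algorithm described in the context, applied to $f$, terminates in finitely many iterations. More specifically: (i) If $f$ is $\mathcal{S}^n_+$-copositive, then $f_{k,mom}\ge 0$ for all sufficiently large $k$; consequently, the Algorithm outputs that $f$ is $\mathcal{S}^n_+$-copositive. (ii) If $f$ is not $\mathcal{S}^n_+$-copositive, then the Algorithm returns a nonzero vector $u\in\mathbb{R}^{\sigma(n)}$ satisfying $X(u)\succeq 0$ and $f(u)<0$. Here the vector $\xi$ chosen in Step 0 is generic: there is a Lebesgue-null set $\Omega\subseteq\mathbb{R}^{\mathbb{N}^{\sigma(n)}_d}$ (depending on $f$) such that the assertions hold for every choice of $\xi\in\mathbb{R}^{\mathbb{N}^{\sigma(n)}_d}\setminus\Omega$.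
   Context: **Variables and copositivity.** $\sigma(n)=n(n+1)/2$; $x=(x_{11},x_{12},\dots,x_{1n},x_{22},\dots,x_{nn})$ is a vector of $\sigma(n)$ real variables, and $X(x)$ is the $n\times n$ symmetric matrix whose $(i,j)$ entry is $x_{ij}$ for $i\le j$. A homogeneous polynomial $f$ is $\mathcal{S}^n_+$-copositive if $f(x)\ge 0$ for all $x\in\mathbb{R}^{\sigma(n)}$ with $X(x)\succeq 0$ (positive semidefinite). $\|\cdot\|_F$ is the Frobenius norm, so $\|X(x)\|_F^2=\sum_i x_{ii}^2+2\sum_{i<j}x_{ij}^2$. **The matrix $\Theta$.** $\Theta(x)$ is the $n\times n$ symmetric polynomial matrix with entries $\Theta_{ii}=\partial_{x_{ii}}f-d\cdot f$ and $\Theta_{ij}=\tfrac12\partial_{x_{ij}}f$ for $i<j$. **Moment notation.** Let $N=\sigma(n)$ and $\mathbb{N}^N_{r}=\{\alpha\in\mathbb{N}^N:|\alpha|\le r\}$. $[x]_r$ is the column vector of all monomials in $x$ of degree at most $r$. For $z=(z_\alpha)_{\alpha\in\mathbb{N}^N_{2k}}\in\mathbb{R}^{\mathbb{N}^N_{2k}}$, let $\langle\sum_\alpha p_\alpha x^\alpha,z\rangle=\sum_\alpha p_\alpha z_\alpha$ for polynomials of degree at most $2k$. For a polynomial $q$ of degree at most $2k$, $L_q^{(k)}(z)=\langle q\,[x]_t[x]_t^T,z\rangle$ (applied entrywise) with $t=k-\lceil\deg(q)/2\rceil$. $M_k(z)=L_1^{(k)}(z)$. For a polynomial matrix $T=(T_{ij})$,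 $L_T^{(k)}(z)$ is the block matrix with blocks $\langle T_{ij}[x]_t[x]_t^T,z\rangle$, where $t=k-\lceil\deg(T)/2\rceil$ and $\deg(T)$ is the maximal degree of the entries. In a vector such as $w$, $w_{e_i}$ denotes the entry indexed by the $i$-th standard basis vector $e_i\in\mathbb{N}^N$. **Moment relaxation.** For $k\ge\lceil (d+1)/2\rceil$, $f_{k,mom}$ is the optimal value of $$\min\ \langle f,z\rangle\quad\text{s.t.}\quad L^{(k)}_{\operatorname{tr}(X)-1}(z)=0,\ L^{(k)}_{X\Theta}(z)=0,\ L^{(k)}_X(z)\succeq 0,\ L^{(k)}_\Theta(z)\succeq 0,$$ $$L^{(k)}_{1-\|X\|_F^2}(z)\succeq 0,\ L^{(k)}_{\|X\|_F^2-\frac1n}(z)\succeq 0,\ \langle 1,z\rangle=1,\ M_k(z)\succeq 0,\ z\in\mathbb{R}^{\mathbb{N}^{\sigma(n)}_{2k}}.$$ **The Algorithm** (all semidefinite programs are solved exactly). Input: a homogeneous polynomial $f$ of degree $d$. Step 0. Choose a generic vector $\xi\in\mathbb{R}^{\mathbb{N}^{\sigma(n)}_d}$. Let $k:=\lceil (d+1)/2\rceil$. Step 1. Compute $f_{k,mom}$. If $f_{k,mom}\ge 0$, output that $f$ is $\mathcal{S}^n_+$-copositive and stop; otherwise go to Step 2. Step 2. Solve the semidefinite program $$\min\ \langle\xi^T[x]_d,w\rangle\quad\text{s.t.}\quad L^{(k)}_{\operatorname{tr}(X)-1}(w)=0,\ L^{(k)}_X(w)\succeq 0,\ L^{(k)}_{f_{k,mom}-f}(w)\succeq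 0,$$ $$L^{(k)}_{1-\|X\|_F^2}(w)\succeq 0,\ L^{(k)}_{\|X\|_F^2-\frac1n}(w)\succeq 0,\ \langle 1,w\rangle=1,\ M_k(w)\succeq 0,\ w\in\mathbb{R}^{\mathbb{N}^{\sigma(n)}_{2k}}.$$ If it is feasible, compute an optimizer $w^*$ and go to Step 3; otherwise let $k:=k+1$ and go to Step 1. Step 3. Let $u=(w^*_{e_1},\dots,w^*_{e_{\sigma(n)}})$. If $f(u)<0$, output that $f$ is not $\mathcal{S}^n_+$-copositive, return $u$ and stop; otherwise let $k:=k+1$ and go to Step 1. *)

(* Defs.v *)
From HB Require Import structures.
From mathcomp Require Import all_boot all_order all_algebra.
(* mpoly has to be imported before the MathComp-Analysis files: in the other
   order their notations are incompatible. *)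
From mathcomp Require Import mpoly.
From mathcomp Require Import classical_sets reals constructive_ereal ereal.
From mathcomp Require Import sequences.

Set Implicit Arguments.
Unset Strict Implicit.
Unset Printing Implicit Defensive.

Import Order.TTheory GRing.Theory Num.Theory.

Local Open Scope ring_scope.

Definition sigma (n : nat) : nat := ((n * n.+1) %/ 2)%N.

Definition upair (n : nat) := {p : 'I_n * 'I_n | (p.1 <= p.2)%N}.

Lemma card_upair n : #|{: upair n}| = sigma n.
Proof.
rewrite card_sig -sum1_card.
rewrite (eq_bigl (fun p : 'I_n * 'I_n => true && (p.1 <= p.2)%N)) //.
rewrite -(pair_big_dep xpredT (fun i j : 'I_n => (i <= j)%N) (fun _ _ => 1%N)).
rewrite (exchange_big_dep xpredT) //=.
rewrite (eq_bigr (fun j : 'I_n => j.+1)); last first.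
  move=> j _; rewrite -(big_ord_widen n (fun=> 1%N) (ltn_ord j)).
  by rewrite sum1_card card_ord.
rewrite /sigma; elim: n => [|n IHn]; first by rewrite big_ord0.
rewrite big_ord_recr /= IHn.
have -> : (n.+1 * n.+2 = n * n.+1 + n.+1 * 2)%N.
  by rewrite mulnC -addn2 mulnDl [(2 * _)%N]mulnC.
by rewrite divnDMl.
Qed.

Lemma upair_subproof n (i j : 'I_n) :
  let p := if (i <= j)%N then (i, j) else (j, i) in (p.1 <= p.2)%N.
Proof. by case: leqP => //= /ltnW. Qed.

(* The position of x_ij in the vector x; [enum_rank] lists the pairs i <= j in
   the row-major order (1,1), (1,2), ..., (1,n), (2,2), ..., (n,n).  The pair is
   sorted first, so that [vidx j i = vidx i j]. *)
Definition vidx (n : nat) (i j : 'I_n) : 'I_(sigma n) :=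
  cast_ord (card_upair n)
    (enum_rank (exist _ (if (i <= j)%N then (i, j) else (j, i))
                        (upair_subproof i j) : upair n)).

Definition symX (T : Type) (n : nat) (x : 'I_(sigma n) -> T) : 'M[T]_n :=
  \matrix_(i, j) x (vidx i j).

Definition psd (R : realType) (m : nat) (A : 'M[R]_m) : Prop :=
  A^T = A /\ forall v : 'cV[R]_m, 0 <= (v^T *m A *m v) 0 0.

Definition pX (R : realType) (n : nat) : 'M[{mpoly R[sigma n]}]_n :=
  symX (fun a => 'X_a).

Definition evalp (R : realType) (N : nat) (f : {mpoly R[N]}) (u : 'rV[R]_N) : R :=
  f.@[fun a => u 0 a].

Definition copositive (R : realType) (n : nat) (f : {mpoly R[sigma n]}) : Prop :=
  forall u : 'rV[R]_(sigma n), psd (symX (u 0)) -> 0 <= evalp f u.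

Definition frob2 (R : realType) (n : nat) : {mpoly R[sigma n]} :=
  \sum_(i < n) \sum_(j < n) pX R n i j ^+ 2.

(* The matrix Lagrange multiplier of the minimization of f subject to
   tr X = 1 and X psd, for f homogeneous of degree d: by Euler's identity the
   multiplier of tr X = 1 is d * f.  The factor 1/2 is due to x_ij occurring
   twice in X. *)
Definition Theta (R : realType) (n d : nat) (f : {mpoly R[sigma n]}) :
    'M[{mpoly R[sigma n]}]_n :=
  \matrix_(i, j) if i == j then mderiv (vidx i i) f - d%:R *: f
                 else 2^-1 *: mderiv (vidx i j) f.

(* ['X_{1..N < r.+1}] is the finite type of the exponents of degree <= r. *)
Definition mvec (R : realType) (N r : nat) := {ffun 'X_{1..N < r.+1} -> R}.

(* Total access to the entries; the value 0 is used outside degree <= r. *)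
Definition mentry (R : realType) (N r : nat) (z : mvec R N r) (m : 'X_{1..N}) : R :=
  if insub m is Some b then z b else 0.

(* Meaningful for p of degree <= r; this holds wherever it is used below as soon
   as k >= ceil((d + 1) / 2). *)
Definition pairing (R : realType) (N r : nat) (p : {mpoly R[N]}) (z : mvec R N r) : R :=
  \sum_(m : 'X_{1..N < r.+1}) p@_m * z m.

Definition nmon (N r : nat) : nat := #|{: 'X_{1..N < r.+1}}|.

Definition monvec (R : realType) (N r : nat) : 'cV[{mpoly R[N]}]_(nmon N r) :=
  \col_a 'X_[enum_val a : 'X_{1..N < r.+1}].

(* [msize p] is deg p + 1 for p <> 0; here deg 0 = 0. *)
Definition deg (R : realType) (N : nat) (p : {mpoly R[N]}) : nat := (msize p).-1.

Definition degmx (R : realType) (N n : nat) (T : 'M[{mpoly R[N]}]_n) : nat :=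
  \max_(i < n) \max_(j < n) deg (T i j).

Definition momblock (R : realType) (N r t : nat) (q : {mpoly R[N]}) (z : mvec R N r) :
    'M[R]_(nmon N t) :=
  map_mx (fun p => pairing p z) (q *: (monvec R N t *m (monvec R N t)^T)).

Definition locmx (R : realType) (N k : nat) (q : {mpoly R[N]})
    (z : mvec R N (2 * k)) : 'M[R]_(nmon N (k - uphalf (deg q))) :=
  momblock (k - uphalf (deg q)) q z.

Definition locmxM (R : realType) (N k n : nat) (T : 'M[{mpoly R[N]}]_n)
    (z : mvec R N (2 * k)) :
    'M[R]_(\sum_(i < n) nmon N (k - uphalf (degmx T))) :=
  \mxblock_(i < n, j < n) momblock (k - uphalf (degmx T)) (T i j) z.

Definition mommx (R : realType) (N k : nat) (z : mvec R N (2 * k)) := locmx 1 z.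

Definition feas_mom (R : realType) (n d : nat) (f : {mpoly R[sigma n]}) (k : nat) :
    set (mvec R (sigma n) (2 * k)) :=
  [set z | [/\ locmx (\tr (pX R n) - 1) z = 0,
               locmxM (pX R n *m Theta d f) z = 0,
               psd (locmxM (pX R n) z) &
               psd (locmxM (Theta d f) z)] /\
           [/\ psd (locmx (1 - frob2 R n) z),
               psd (locmx (frob2 R n - (n%:R^-1)%:MP) z),
               pairing 1 z = 1 &
               psd (mommx z)] ]%classic.

Arguments feas_mom {R n} d f k _.

(* The optimal value, equal to +oo when the program is infeasible. *)
Definition f_mom (R : realType) (n d : nat) (f : {mpoly R[sigma n]}) (k : nat) :
    \bar R :=
  ereal_inf [set (pairing f z)%:E | z in feas_mom d f k]%classic.

(* v stands for the value of f_{k,mom}. *)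
Definition feas_step2 (R : realType) (n : nat) (f : {mpoly R[sigma n]}) (k : nat)
    (v : R) : set (mvec R (sigma n) (2 * k)) :=
  [set w | [/\ locmx (\tr (pX R n) - 1) w = 0,
               psd (locmxM (pX R n) w) &
               psd (locmx (v%:MP - f) w)] /\
           [/\ psd (locmx (1 - frob2 R n) w),
               psd (locmx (frob2 R n - (n%:R^-1)%:MP) w),
               pairing 1 w = 1 &
               psd (mommx w)] ]%classic.

Arguments feas_step2 {R n} f k v _.

Definition genpoly (R : realType) (N d : nat) (xi : mvec R N d) : {mpoly R[N]} :=
  \sum_(m : 'X_{1..N < d.+1}) xi m *: 'X_[m].

Definition optimizer_step2 (R : realType) (n d : nat) (f : {mpoly R[sigma n]})
    (xi : mvec R (sigma n) d) (k : nat) (v : R) (w : mvec R (sigma n) (2 * k)) : Prop :=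
  feas_step2 f k v w /\
  forall w', feas_step2 f k v w' ->
    pairing (genpoly xi) w <= pairing (genpoly xi) w'.

(* [NotCopositive u]: the output is "not copositive" and u is returned. *)
Inductive state (R : realType) (n : nat) : Type :=
  | Step1 (k : nat)
  | Step2 (k : nat)
  | Step3 (k : nat) (w : mvec R (sigma n) (2 * k))
  | Copositive
  | NotCopositive (u : 'rV[R]_(sigma n)).

Arguments Step1 {R n} k.
Arguments Step2 {R n} k.
Arguments Step3 {R n} k w.
Arguments Copositive {R n}.
Arguments NotCopositive {R n} u.

Definition first_moments (R : realType) (N r : nat) (w : mvec R N r) : 'rV[R]_N :=
  \row_a mentry w U_(a)%MM.

(* The relation is not functional: in Step 2 any optimizer may be chosen.
   An execution is blocked in Step 2 if f_{k,mom} = -oo, or if the program is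
   feasible without an optimizer; [always_reaches] below excludes both. *)
Inductive step (R : realType) (n d : nat) (f : {mpoly R[sigma n]})
    (xi : mvec R (sigma n) d) : state R n -> state R n -> Prop :=
  | Step1_stop k :
      (0 <= f_mom d f k)%E -> step f xi (Step1 k) Copositive
  | Step1_go k :
      (f_mom d f k < 0)%E -> step f xi (Step1 k) (Step2 k)
  | Step2_feasible k (v : R) w :
      f_mom d f k = v%:E -> optimizer_step2 f xi v w ->
      step f xi (Step2 k) (Step3 k w)
  | Step2_infeasible k (v : R) :
      f_mom d f k = v%:E -> feas_step2 f k v = set0 ->
      step f xi (Step2 k) (Step1 k.+1)
  | Step3_stop k w :
      evalp f (first_moments w) < 0 ->
      step f xi (Step3 k w) (NotCopositive (first_moments w))
  | Step3_go k w :
      0 <= evalp f (first_moments w) ->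
      step f xi (Step3 k w) (Step1 k.+1).

Definition init_state (R : realType) (n d : nat) : state R n := Step1 (uphalf d.+1).

Definition is_output (R : realType) (n : nat) (s : state R n) : Prop :=
  match s with Copositive | NotCopositive _ => True | _ => False end.

(* Every execution from s reaches, after finitely many transitions, a state
   satisfying P; in particular no execution is infinite or blocked before. *)
Inductive always_reaches (R : realType) (n d : nat) (f : {mpoly R[sigma n]})
    (xi : mvec R (sigma n) d) (P : state R n -> Prop) : state R n -> Prop :=
  | Reached s : P s -> always_reaches f xi P s
  | Reaches_later s :
      (exists s', step f xi s s') ->
      (forall s', step f xi s s' -> always_reaches f xi P s') ->
      always_reaches f xi P s.

Definition lebesgue_null (R : realType) (I : finType) (A : set {ffun I -> R}) : Prop :=
  forall eps : R, 0 < eps ->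
  exists a b : nat -> {ffun I -> R},
    [/\ forall m i, a m i <= b m i,
        forall x, A x -> exists m, forall i, a m i <= x i <= b m i &
        (\sum_(0 <= m <oo) (\prod_i (b m i - a m i))%:E <= eps%:E)%E].

(* Main.v *)
Require Import Defs.
From HB Require Import structures.
From mathcomp Require Import all_boot all_order all_algebra.
From mathcomp Require Import mpoly.
From mathcomp Require Import generic_quotient ring_quotient fraction.
From mathcomp Require Import boolp classical_sets reals.
From mathcomp Require Import constructive_ereal ereal topology normedtype sequences.
From mathcomp Require Import ring lra zify.

Set Implicit Arguments.
Unset Strict Implicit.
Unset Printing Implicit Defensive.

Import Order.TTheory GRing.Theory Num.Theory.
Import numFieldNormedType.Exports.

Local Open Scope ring_scope.

(** The relaxation is exact from some order on, and everything else follows from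
    that.  Let K be the set of positive semidefinite matrices of trace one and m
    the minimum of f on K.

    Critical values.  Let I be the ideal generated by tr X - 1 and the entries
    of X Theta.  Some nonzero univariate p has p(f) in I
    ([critical_values_finite]).  Otherwise a prime ideal above I would contain no
    such p(f), and the fraction field of its quotient would have a derivation D
    over the reals with D f = 1.  Put S = D X.  From X Theta = 0 one gets
    Theta S Theta = 0, so Theta S is nilpotent and its trace vanishes; but the
    chain rule says that this trace is D f.  So a moment vector satisfying the
    equality constraints to a high order annihilates p(f) h(f) for each h.

    Positivity.  A moment vector is a linear functional E on polynomials, and
    the semidefinite constraints say that E is nonnegative on the truncation of a
    quadratic module.  A polynomial positive on the feasible set has nonnegative
    value at each E that is feasible to a high enough order ([putinar]).  By
    ultralimits this reduces to functionals feasible at all orders; among these a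
    minimizer of E(p), chosen extreme, is the evaluation at a feasible point
    ([pseudo_moments_point]).

    Exactness.  Let t = f - m, which is nonnegative on K, and let p be the
    polynomial above, expressed in t.  Cauchy-Schwarz removes the multiplicity of
    the root 0 from p, so p = t q with q(0) <> 0.  With g = 1 - q / q(0) the
    values E(t) and E((t + q(t)^2) g(t)^2) agree, since the difference is a
    multiple of p; the last one is nonnegative, as t + q(t)^2 is positive on K
    ([finite_convergence]).  Hence the relaxation is bounded below by m for large
    orders.  It is bounded above by m for all orders, because minimizers of f on
    K satisfy the optimality conditions ([kkt_psd], [kkt_complementary]).

    The algorithm.  If f is copositive then m >= 0, and the first step stops it
    for large k; it cannot stop earlier with the other answer, since first
    moments of feasible vectors lie in K.  If f is not copositive then m < 0, and
    for large k the second program relaxes the minimization of the generic linear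
    form over the monomial vectors of the minimizers of f.  If the degree is
    positive and that problem has a unique solution u, the first moments of the
    optimizers converge to u ([step2_moments_close]), where f is negative; in
    degree 0 f is a negative constant.  The directions without a unique solution
    lie on countably many Lipschitz graphs ([nonunique_null]). *)

(** * Fields in which an ideal vanishes and a multiplicative set does not *)

Section PrimeQuotient.
Variables (A : comNzRingType) (J : A -> bool).
Hypothesis J_ideal : idealr_closed (J : {pred A}).
Hypothesis J_prime : prime_idealr_closed (J : {pred A}).

(** The instance through which the quotient gets its ring structure. *)
Definition ideal_pred : prime_idealr A :=
  HB.pack J (isIdealr.Build A J J_ideal) (isPrimeIdealrClosed.Build A J J_prime).
Local Notation pJ := ideal_pred.

Definition prime_quotient : Type := @Quotient.quot A pJ.
Local Notation Q := prime_quotient.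
HB.instance Definition _ := GRing.ComNzRing.on Q.

Let Qunit : {pred Q} := fun x => `[< exists y : Q, y * x = 1 >].
Let Qinv (x : Q) : Q :=
  if pselect (exists y : Q, y * x = 1) is left h then sval (cid h) else x.

Let Qmulinv : {in Qunit, left_inverse 1 Qinv *%R}.
Proof.
move=> x; rewrite unfold_in => /asboolP h; rewrite /Qinv.
by case: pselect => // h'; case: cid.
Qed.
Let QunitP (x y : Q) : y * x = 1 -> Qunit x.
Proof. by move=> h; apply/asboolP; exists y. Qed.
Let Qinvout : {in [predC Qunit], Qinv =1 id}.
Proof.
move=> x; rewrite !inE unfold_in => /asboolP h; rewrite /Qinv.
by case: pselect.
Qed.
HB.instance Definition _ :=
  GRing.ComNzRing_hasMulInverse.Build Q Qmulinv QunitP Qinvout.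
HB.instance Definition _ := GRing.ComUnitRing_isIntegral.Build Q
  (@Quotient.rquot_IdomainAxiom A pJ).

(** The field of fractions of the quotient by a prime ideal: its kernel on the
    ring is the ideal itself. *)
Lemma prime_ideal_fraction_field : exists (F : fieldType) (phi : {rmorphism A -> F}),
  forall x, (phi x == 0) = J x.
Proof.
exists {fraction Q}.
exists (@FracField.tofrac Q \o \pi_({ideal_quot pJ})%qT : {rmorphism A -> {fraction Q}}) => x /=.
rewrite tofrac_eq0.
have := Quotient.idealrBE pJ x 0; rewrite subr0 => JE.
rewrite -[RHS]/(x \in (pJ : {pred A})) JE.
by rewrite -[X in _ == X](rmorph0 (\pi_({ideal_quot pJ})%qT : {rmorphism A -> _})).
Qed.
End PrimeQuotient.

Definition is_ideal (A : comNzRingType) (I : set A) : Prop :=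
  I 0 /\ forall a u v, I u -> I v -> I (a * u + v).

(** Krull's argument: an ideal containing [I] and maximal among those that do not
    meet [M] is prime, because the product of two elements outside it would bring
    an element of [M] into it.  This plays the part of a generic point: the
    vanishing of [I] holds in [F], and every element of [M] becomes invertible. *)
Lemma ideal_avoid_field (A : comNzRingType) (I M : set A) :
  is_ideal I -> M 1 -> (forall x y, M x -> M y -> M (x * y)) ->
  (forall x, I x -> ~ M x) ->
  exists (F : fieldType) (phi : {rmorphism A -> F}),
    (forall x, I x -> phi x = 0) /\ forall x, M x -> phi x <> 0.
Proof.
move=> Iid M1 MM IM.
pose P (X : set A) := is_ideal (X `|` I)%classic /\
   forall x, (X `|` I)%classic x -> ~ M x.
have [X [[XI XM] Xmax]] : exists X, P X /\ forall Y, (X `<` Y)%classic -> ~ P Y.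
  apply: Zorn_bigcup => F FP Ftot; split; last first.
    move=> x [[Z FZ Zx]|]; last exact: IM.
    by apply: (FP Z FZ).2; left.
  split; first by right; exact: Iid.1.
  move=> a u v [[Y FY Yu]|Iu] [[Z FZ Zv]|Iv].
  - have [YZ|ZY] := Ftot Y Z FY FZ.
    + have [h|h] := (FP Z FZ).1.2 a u v (or_introl (YZ _ Yu)) (or_introl Zv).
        by left; exists Z.
      by right.
    + have [h|h] := (FP Y FY).1.2 a u v (or_introl Yu) (or_introl (ZY _ Zv)).
        by left; exists Y.
      by right.
  - have [h|h] := (FP Y FY).1.2 a u v (or_introl Yu) (or_intror Iv).
      by left; exists Y.
    by right.
  - have [h|h] := (FP Z FZ).1.2 a u v (or_intror Iu) (or_introl Zv).
      by left; exists Z.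
    by right.
  - by right; exact: Iid.2.
pose J := (X `|` I)%classic.
have Jmax (Y : set A) : is_ideal Y -> (J `<=` Y)%classic ->
    (forall x, Y x -> ~ M x) -> (Y `<=` J)%classic.
  move=> Yid JY YM; have [YX|/existsNP nYX] := pselect (Y `<=` X)%classic.
    by apply: subset_trans YX _ => x ?; left.
  have YI : (Y `|` I)%classic = Y.
    by apply/seteqP; split=> x; [case=> // Ix; apply: JY; right|left].
  case: (Xmax Y); last by rewrite /P YI.
  split; first by move=> x Xx; apply: JY; left.
  by move=> YX; case: nYX => x; apply; exact: YX.
have J0 : J 0 by exact: XI.1.
have JD u v : J u -> J v -> J (u + v).
  by move=> Ju Jv; rewrite -[u]mul1r; exact: XI.2.
have JMl a u : J u -> J (a * u).
  by move=> Ju; rewrite -[a * u]addr0; exact: XI.2.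
have Jprime u v : J (u * v) -> J u \/ J v.
  move=> Juv; apply: contrapT => /not_orP[nu nv].
  have ext w : ~ J w -> exists j c, J j /\ M (j + c * w).
    move=> nw; apply: contrapT => nex; apply: nw.
    apply: (Jmax [set x | exists j c, J j /\ x = j + c * w]%classic).
    - split; first by exists 0, 0; rewrite mul0r addr0.
      move=> a _ _ [j [c [Jj ->]]] [j' [c' [Jj' ->]]].
      exists (a * j + j'), (a * c + c'); split; last by ring.
      by apply: JD => //; exact: JMl.
    - by move=> x Jx; exists x, 0; rewrite mul0r addr0.
    - move=> _ [j [c [Jj ->]]] Mx; apply: nex; exists j, c; split=> //.
    - by exists 0, 1; rewrite add0r mul1r.
  have [j [c [Jj Mj]]] := ext _ nu.
  have [j' [c' [Jj' Mj']]] := ext _ nv.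
  apply: (XM ((j + c * u) * (j' + c' * v))); last exact: MM.
  have -> : (j + c * u) * (j' + c' * v) =
      (j' + c' * v) * j + ((c * u) * j' + (c * c') * (u * v)) by ring.
  by apply: (JD); [exact: JMl|apply: (JD); exact: JMl].
have Jid : idealr_closed ((fun x => `[< J x >]) : {pred A}).
  split.
  - by rewrite unfold_in; apply/asboolP.
  - by rewrite unfold_in; apply/asboolP => J1; exact: (XM 1).
  - move=> a u v; rewrite !unfold_in => /asboolP Ju /asboolP Jv.
    by apply/asboolP; exact: XI.2.
have Jpr : prime_idealr_closed ((fun x => `[< J x >]) : {pred A}).
  move=> u v; rewrite !unfold_in => /asboolP /Jprime [h|h]; apply/orP.
    by left; apply/asboolP.
  by right; apply/asboolP.
have [F [phi phiE]] := prime_ideal_fraction_field Jid Jpr.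
exists F, phi; split=> x.
  by move=> Ix; apply/eqP; rewrite phiE; apply/asboolP; right.
move=> Mx /eqP; rewrite phiE => /asboolP Jx; exact: (XM x).
Qed.

(** * Extending derivations of fields of characteristic zero *)

Section DerivationExtension.
Variable F : fieldType.
Hypothesis char0 : forall k, k.+1%:R != 0 :> F.

(** [del] is a derivation along [psi]; the last clause makes it factor through the
    image of [psi], so it is a derivation of the subring [psi B] of [F].  Working
    with a source ring [B] avoids subrings of [F] and makes adjoining an element
    the same as passing to polynomials. *)
Definition is_der (B : comNzRingType) (psi : {rmorphism B -> F}) (del : B -> F) :=
  [/\ forall a b, del (a + b) = del a + del b,
      forall a b, del (a * b) = del a * psi b + psi a * del b &
      forall a, psi a = 0 -> del a = 0].

Section Step.
Variables (B : comNzRingType) (psi : {rmorphism B -> F}) (del : B -> F) (x : F).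
Hypothesis del_der : is_der psi del.

Let del0 : del 0 = 0. Proof. by case: del_der => _ _; apply; rewrite rmorph0. Qed.
Let delD a b : del (a + b) = del a + del b. Proof. by case: del_der. Qed.
Let delM a b : del (a * b) = del a * psi b + psi a * del b.
Proof. by case: del_der. Qed.
Let del_ker a : psi a = 0 -> del a = 0. Proof. by case: del_der => _ _; apply. Qed.

Let psi' := (horner_eval x \o map_poly psi : {rmorphism {poly B} -> F}).
Let ext (c : F) (p : {poly B}) : F :=
  (map_poly del p).[x] + c * (map_poly psi p)^`().[x].

Let map_delD p q : map_poly del (p + q) = map_poly del p + map_poly del q.
Proof. by apply/polyP => i; rewrite coefD !coef_map_id0 // coefD delD. Qed.

Let map_delM p q : map_poly del (p * q) =
  map_poly del p * map_poly psi q + map_poly psi p * map_poly del q.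
Proof.
apply/polyP => i; rewrite coefD !coefM coef_map_id0 // coefM -big_split /=.
rewrite (big_morph del delD del0); apply: eq_bigr => j _.
by rewrite delM !coef_map !coef_map_id0.
Qed.

Let ext_add c p q : ext c (p + q) = ext c p + ext c q.
Proof. by rewrite /ext map_delD rmorphD derivD !hornerD; ring. Qed.

Let ext_mul c p q : ext c (p * q) = ext c p * psi' q + psi' p * ext c q.
Proof.
rewrite /ext /psi' /= /horner_eval map_delM rmorphM derivM !(hornerD, hornerM).
by ring.
Qed.

Let ext_C c b : ext c b%:P = del b.
Proof.
rewrite /ext map_polyC /= derivC horner0 mulr0 addr0.
have -> : map_poly del b%:P = (del b)%:P.
  by apply/polyP => -[|i]; rewrite coef_map_id0 // !coefC.
by rewrite hornerC.
Qed.

Let del1 : del 1 = 0.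
Proof.
have /eqP := delM 1 1; rewrite !mulr1 rmorph1 mulr1 mul1r.
by rewrite -subr_eq0 opprD addNKr oppr_eq0 => /eqP.
Qed.

Let ext_X c : ext c 'X = c.
Proof.
rewrite /ext map_polyX derivX hornerC mulr1.
have -> : map_poly del 'X = 0.
  by apply/polyP => i; rewrite coef_map_id0 // coefX coef0; case: (i == 1)%N.
by rewrite horner0 add0r.
Qed.

Let ext_triv c p : map_poly psi p = 0 -> ext c p = 0.
Proof.
move=> p0; rewrite /ext p0 deriv0 horner0 mulr0 addr0.
have -> : map_poly del p = 0; last by rewrite horner0.
apply/polyP => i; rewrite coef_map_id0 // coef0 del_ker //.
by rewrite -coef_map p0 coef0.
Qed.

Let ext_ker : exists c, (forall p, psi' p = 0 -> ext c p = 0) /\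
  ((forall p, psi' p = 0 -> map_poly psi p = 0) -> c = 1).
Proof.
have [h|/existsNP[q /not_implyP[qx q0]]] :=
  pselect (forall p, psi' p = 0 -> map_poly psi p = 0).
  by exists 1; split=> // p /h /ext_triv.
pose P k := `[< exists p, [/\ psi' p = 0, map_poly psi p != 0 &
                              size (map_poly psi p) = k] >].
have exP : exists k, P k.
  by exists (size (map_poly psi q)); apply/asboolP; exists q; split=> //; apply/eqP.
case: (ex_minnP exP) => m /asboolP[mu [mux mu0 szmu]] mmin.
have min_size p : psi' p = 0 -> map_poly psi p != 0 ->
    (m <= size (map_poly psi p))%N.
  by move=> px p0; apply: mmin; apply/asboolP; exists p.
have dmu : (map_poly psi mu)^`().[x] != 0.
  apply/negP => /eqP dmux.
  have d0 : (map_poly psi mu)^`() == 0.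
    apply/negPn/negP => d0.
    have := @min_size (mu^`()).
    rewrite /psi' /= /horner_eval deriv_map in dmux d0 *.
    move=> /(_ dmux d0); rewrite -szmu leqNgt => /negP; apply.
    by rewrite -deriv_map; exact: lt_size_deriv.
  have sz1 : (size (map_poly psi mu) <= 1)%N.
    rewrite leqNgt; apply/negP => sz.
    have := congr1 (fun r : {poly F} => r`_(m - 2)) (eqP d0).
    rewrite /= coef_deriv coef0.
    have -> : (m - 2).+1 = (size (map_poly psi mu)).-1 by lia.
    rewrite -/(lead_coef _) -mulr_natr => /eqP; rewrite mulf_eq0 lead_coef_eq0.
    rewrite (negPf mu0) /=.
    by case: (size _) sz => [|[|k]] //= _; rewrite (negPf (char0 _)).
  move: mux; rewrite /psi' /= /horner_eval.
  rewrite (size1_polyC sz1) hornerC => c0.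
  by move: mu0; rewrite (size1_polyC sz1) c0 polyC0 eqxx.
(* The value forced by [mu(x) = 0]. *)
pose c := - (map_poly del mu).[x] / (map_poly psi mu)^`().[x]; exists c.
have cmu : ext c mu = 0 by rewrite /ext /c divfK // addrN.
split; last by move=> /(_ mu mux) /eqP; rewrite (negPf mu0).
move=> p; have [k] := ubnP (size (map_poly psi p)).
elim: k p => // k IH p szp px.
have [/eqP p0|p0] := boolP (map_poly psi p == 0); first exact: ext_triv.
have mp := min_size _ px p0.
pose s := size (map_poly psi p).
pose b := mu`_m.-1; pose a := p`_s.-1.
have m_gt0 : (0 < m)%N by rewrite -szmu size_poly_gt0.
have b0 : psi b != 0.
  by rewrite /b -coef_map -szmu -/(lead_coef _) lead_coef_eq0.
(* One step of division by [mu]; the leading coefficient is not invertible in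
   [B], so [p] is multiplied by it first. *)
pose p2 := b%:P * p - (a%:P * 'X^(s - m)) * mu.
have p2x : psi' p2 = 0 by rewrite /p2 rmorphB !rmorphM px mux !mulr0 subr0.
have cE (r : {poly B}) u : (map_poly psi r)`_u = psi r`_u by exact: coef_map.
have szp2 : (size (map_poly psi p2) < k)%N.
  have s_gt0 : (0 < s)%N by apply: leq_trans mp.
  rewrite ltnS in szp; apply: leq_trans szp; rewrite -/s -(prednK s_gt0) ltnS.
  apply/leq_sizeP => j; rewrite -(prednK s_gt0) leq_eqVlt => /orP[/eqP <-|].
  - rewrite cE /p2 coefB -mulrA !coefCM coefXnM.
    have -> : (s.-1 < s - m)%N = false by apply/negbTE; rewrite -leqNgt; lia.
    have -> : (s.-1 - (s - m))%N = m.-1 by move: mp; rewrite -/s; lia.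
    have -> : b * p`_s.-1 - a * mu`_m.-1 = 0 by rewrite /a /b; ring.
    exact: rmorph0.
  - rewrite (prednK s_gt0) => sj.
    rewrite cE /p2 coefB -mulrA !coefCM coefXnM rmorphB !rmorphM.
    have -> : psi p`_j = 0 by rewrite -cE nth_default.
    rewrite mulr0 sub0r; case: ifP => _; first by rewrite rmorph0 mulr0 oppr0.
    have -> : psi mu`_(j - (s - m)) = 0; last by rewrite mulr0 oppr0.
    by rewrite -cE nth_default // szmu; move: mp; rewrite -/s; lia.
have := IH _ szp2 p2x.
have -> : p2 = b%:P * p + (- (a%:P * 'X^(s - m))) * mu by rewrite /p2 mulNr.
rewrite ext_add !ext_mul px mux cmu !mulr0 !addr0 add0r.
rewrite /psi' /= /horner_eval map_polyC /= hornerC => /eqP.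
by rewrite mulf_eq0 (negPf b0) /= => /eqP.
Qed.

(** A derivation of a subring extends to one more element [x].  If [x] is
    transcendental over the subring its derivative is free, and 1 is chosen;
    otherwise it is forced by a polynomial of least degree vanishing at [x], whose
    derivative does not vanish at [x] in characteristic zero. *)
Lemma derivation_ext_step : exists (psi1 : {rmorphism {poly B} -> F}) (del1 : {poly B} -> F),
  [/\ is_der psi1 del1, (forall b, psi1 b%:P = psi b /\ del1 b%:P = del b),
      psi1 'X = x &
      (forall p, (map_poly psi p).[x] = 0 -> map_poly psi p = 0) -> del1 'X = 1].
Proof.
have [c [ck c1]] := ext_ker.
exists psi', (ext c); split.
- by split; [exact: ext_add|exact: ext_mul|exact: ck].
- by move=> b; rewrite ext_C /psi' /= /horner_eval map_polyC hornerC.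
- by rewrite /psi' /= /horner_eval map_polyX hornerX.
- by move=> h; rewrite ext_X; exact: c1.
Qed.
End Step.

(** Finitely many elements are adjoined one after the other. *)
Lemma derivation_ext (xs : seq F) (B : comNzRingType) (psi : {rmorphism B -> F})
    (del : B -> F) : is_der psi del ->
  exists (B1 : comNzRingType) (psi1 : {rmorphism B1 -> F}) (del1 : B1 -> F)
         (iota : {rmorphism B -> B1}),
  [/\ is_der psi1 del1, forall b, psi1 (iota b) = psi b,
      forall b, del1 (iota b) = del b & forall x, x \in xs -> exists b, psi1 b = x].
Proof.
elim: xs B psi del => [|x xs IH] B psi del dd.
  by exists B, psi, del, idfun; split.
have [psi1 [del1 [dd1 h1 hX _]]] := derivation_ext_step x dd.
have [B2 [psi2 [del2 [io [dd2 p2 d2 xs2]]]]] := IH _ _ _ dd1.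
exists B2, psi2, del2, (io \o @polyC B : {rmorphism B -> B2}); split=> //.
- by move=> b; rewrite /= p2; case: (h1 b).
- by move=> b; rewrite /= d2; case: (h1 b).
- move=> y; rewrite inE => /orP[/eqP ->|]; last exact: xs2.
  by exists (io 'X); rewrite p2.
Qed.

End DerivationExtension.

(** * The symmetric matrix of the variables *)

Section Indices.
Variable n : nat.

(** The inverse of [vidx] on pairs [i <= j]. *)
Definition pidx (a : 'I_(sigma n)) : 'I_n * 'I_n :=
  val (enum_val (cast_ord (esym (card_upair n)) a)).

Lemma vidxC (i j : 'I_n) : vidx i j = vidx j i.
Proof.
rewrite /vidx; congr cast_ord; congr enum_rank; apply: val_inj => /=.
by case: (ltngtP i j) => // /val_inj ->.
Qed.

Lemma pidxK a : vidx (pidx a).1 (pidx a).2 = a.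
Proof.
rewrite /vidx; apply: (can_inj (cast_ordK (esym (card_upair n)))).
rewrite cast_ordK -[RHS]enum_valK; congr enum_rank; apply: val_inj => /=.
rewrite /pidx; case: (enum_val _) => -[i j] /= ij.
by rewrite ij.
Qed.

Lemma pidx_vidx (i j : 'I_n) : pidx (vidx i j) = if (i <= j)%N then (i, j) else (j, i).
Proof. by rewrite /pidx /vidx cast_ordK enum_rankK. Qed.

(** A sum over the entries on or above the diagonal is a sum over all entries in
    which the off-diagonal ones are halved: this is the origin of the factor 1/2
    in [Theta]. *)
Lemma sum_vidx (A : pzRingType) (h : A) (phi : 'I_(sigma n) -> A) : h *+ 2 = 1 ->
  \sum_a phi a =
  \sum_i \sum_j (if i == j then phi (vidx i j) else h * phi (vidx i j)).
Proof.
move=> h2.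
rewrite (reindex_onto (fun p : 'I_n * 'I_n => vidx p.1 p.2) pidx) /=; last first.
  by move=> a _; exact: pidxK.
rewrite (eq_bigl (fun p : 'I_n * 'I_n => (p.1 <= p.2)%N)); last first.
  move=> [i j] /=; rewrite pidx_vidx; case: leqP => [_|ji]; first by rewrite eqxx.
  by apply/negbTE; rewrite xpair_eqE negb_and -[_ == _ :> 'I_n]/(j == i :> nat) ltn_eqF.
pose g (p : 'I_n * 'I_n) := phi (vidx p.1 p.2).
rewrite pair_big /= (eq_bigr g) //.
rewrite [RHS](bigID (fun p : 'I_n * 'I_n => (p.1 <= p.2)%N)) /=.
have -> : \sum_(i : 'I_n * 'I_n | ~~ (i.1 <= i.2)%N)
      (if i.1 == i.2 then phi (vidx i.1 i.2) else h * phi (vidx i.1 i.2)) =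
    \sum_(i : 'I_n * 'I_n | (i.1 < i.2)%N) h * g i.
  rewrite (reindex_inj (h := fun p : 'I_n * 'I_n => (p.2, p.1))) /=; last first.
    by move=> [i j] [i' j'] /= [-> ->].
  apply: eq_big => [p|p]; rewrite -ltnNge // => pij.
  by rewrite -val_eqE /= gtn_eqF // /g vidxC.
rewrite [LHS](bigID (fun p : 'I_n * 'I_n => p.1 == p.2)) /=.
rewrite [X in _ = X + _](bigID (fun p : 'I_n * 'I_n => p.1 == p.2)) /=.
rewrite -addrA; congr (_ + _); first by apply: eq_bigr => p /andP[_ ->].
have E (p : 'I_n * 'I_n) : (p.1 <= p.2)%N && (p.1 != p.2) = (p.1 < p.2)%N.
  by rewrite ltn_neqAle andbC.
rewrite !(eq_bigl _ _ E) -big_split /=; apply: eq_bigr => p pij.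
by rewrite -val_eqE /= ltn_eqF // -mulrDl -mulr2n h2 mul1r.
Qed.
End Indices.

(** Factor [N] as a full column rank matrix times a full row rank one; the square
    being zero says that the product in the other order vanishes. *)
Lemma mxtrace_sqr0 (F : fieldType) (m : nat) (N : 'M[F]_m) : N *m N = 0 -> \tr N = 0.
Proof.
move=> N2; rewrite -(mulmx_base N) mxtrace_mulC.
suff -> : row_base N *m col_base N = 0 by rewrite mxtrace0.
apply: (row_full_inj (col_base_full N)); rewrite mulmx0.
apply: (row_free_inj (row_base_free N)); rewrite mul0mx.
by rewrite mulmxA mulmx_base -mulmxA mulmx_base.
Qed.

(** Induction along the presentation of the polynomial algebra by generators; it
    fits statements about ring morphisms and derivations. *)
Lemma mpoly_alg_ind (N : nat) (A : comNzRingType) (P : {mpoly A[N]} -> Prop) :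
  (forall c, P c%:MP) -> (forall a, P 'X_a) ->
  (forall p q, P p -> P q -> P (p + q)) -> (forall p q, P p -> P q -> P (p * q)) ->
  forall p, P p.
Proof.
move=> PC PX PD PM.
have PXm m : P 'X_[m].
  rewrite mpolyXE_id; apply: (big_ind P) => // [|i _]; first exact: (PC 1).
  by elim: (m i) => [|k IH]; rewrite ?exprS ?expr0; [exact: (PC 1)|exact: PM].
elim/mpolyind => [|c m p _ _ Pp]; first by rewrite -mpolyC0.
by apply: PD => //; rewrite -mul_mpolyC; exact: PM.
Qed.

(** Euler's identity. *)
Lemma euler_homog (N d : nat) (A : comNzRingType) (f : {mpoly A[N]}) :
  f \is d.-homog -> \sum_a 'X_a * mderiv a f = d%:R * f.
Proof.
move=> /dhomogP hf; rewrite {1}[f]mpolyE mulr_natl.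
under eq_bigr do rewrite raddf_sum mulr_sumr.
rewrite exchange_big /= [in RHS](mpolyE f) -[RHS]sumrMnl big_seq [RHS]big_seq.
apply: eq_bigr => m /hf /= <-.
under eq_bigr do rewrite mderivZ mderivX -!scalerAr.
rewrite -scaler_sumr scalerMnr; congr (_ *: _).
rewrite (eq_bigr (fun i => 'X_[m] *+ m i)).
  by rewrite sumrMnr mdegE.
move=> i _; have [->|mi] := eqVneq (m i) 0%N; first by rewrite scale0r mulr0n.
rewrite scaler_nat -mpolyXD addmC submK //.
by rewrite lep1mP.
Qed.

(** Chain rule for a derivation that kills the constants. *)
Lemma der_chain (N : nat) (A : comNzRingType) (B : comNzRingType)
   (phi : {rmorphism {mpoly A[N]} -> B}) (del : {mpoly A[N]} -> B) :
  (forall c, del c%:MP = 0) -> (forall p q, del (p + q) = del p + del q) ->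
  (forall p q, del (p * q) = del p * phi q + phi p * del q) ->
  forall f, del f = \sum_a phi (mderiv a f) * del 'X_a.
Proof.
move=> dC dD dM; elim/mpoly_alg_ind => [c|a|p q IHp IHq|p q IHp IHq].
- by rewrite dC big1 // => a _; rewrite mderivC rmorph0 mul0r.
- rewrite (bigD1 a) //= big1 => [|b ba].
    by rewrite mderivX mnm1E eqxx scale1r
      (_ : U_(a) - U_(a) = 0)%MM ?mpolyX0 ?rmorph1 ?mul1r ?addr0 //;
      apply/mnmP => i; rewrite mnmBE mnm0E subnn.
  by rewrite mderivX mnm1E eq_sym (negPf ba) scale0r rmorph0 mul0r.
- rewrite dD IHp IHq -big_split; apply: eq_bigr => a _ /=.
  by rewrite mderivD rmorphD mulrDl.
- rewrite dM IHp IHq mulr_suml mulr_sumr -big_split; apply: eq_bigr => a _ /=.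
  by rewrite mderivM rmorphD !rmorphM; ring.
Qed.

Section ThetaTrace.
Variables (R : realType) (n d : nat) (f : {mpoly R[sigma n]}).

(** Pairing [Theta] with a direction [S] gives the derivative of [f] along [S],
    corrected by the multiplier of the constraint on the trace. *)
Lemma tr_Theta (T : comNzRingType) (phi : {rmorphism {mpoly R[sigma n]} -> T})
    (s : 'I_(sigma n) -> T) :
  \tr (map_mx phi (Theta d f) *m symX s) =
  \sum_a phi (mderiv a f) * s a - phi (d%:R * f) * \tr (symX s).
Proof.
pose h : T := phi (2^-1)%:MP.
have h2 : h *+ 2 = 1.
  have e : (2^-1 : R) *+ 2 = 1 by rewrite -(mulr_natr (2^-1)) mulVf ?pnatr_eq0.
  by rewrite /h -rmorphMn -mpolyCMn e mpolyC1 rmorph1.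
rewrite (sum_vidx _ h2) /mxtrace mulr_sumr -sumrB; apply: eq_bigr => i _.
rewrite mxE (bigD1 i) //= [in RHS](bigD1 i) //= !mxE !eqxx rmorphB.
rewrite [RHS]addrAC -mul_mpolyC mpolyC_nat mulrBl; congr (_ + _).
apply: eq_bigr => j ji; rewrite !mxE eq_sym (negPf ji) -mul_mpolyC rmorphM -/h.
by rewrite vidxC mulrA.
Qed.
End ThetaTrace.

(** * Critical values satisfy a polynomial equation *)

Section CriticalValues.
Variables (R : realType) (n d : nat) (f : {mpoly R[sigma n]}).
Local Notation A := {mpoly R[sigma n]}.

Lemma symX_sym (T : Type) (s : 'I_(sigma n) -> T) : (symX s)^T = symX s.
Proof. by apply/matrixP => i j; rewrite !mxE vidxC. Qed.

Lemma Theta_sym : (Theta d f)^T = Theta d f.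
Proof.
apply/matrixP => i j; rewrite !mxE eq_sym; case: eqVneq => [->|_] //.
by rewrite vidxC.
Qed.

Lemma map_pX (T : nzRingType) (phi : {rmorphism A -> T}) :
  map_mx phi (pX R n) = symX (fun a => phi 'X_a).
Proof. by apply/matrixP => i j; rewrite !mxE. Qed.

(** The ideal of the complex critical variety: trace one and complementarity. *)
Definition kkt_ideal : set A := [set g | exists (a : A) (b : 'M[A]_n),
  g = a * (\tr (pX R n) - 1) + \sum_i \sum_j b i j * (pX R n *m Theta d f) i j]%classic.

Lemma kkt_ideal_ideal : is_ideal kkt_ideal.
Proof.
split.
  exists 0, 0; rewrite mul0r add0r big1 // => i _; rewrite big1 // => j _.
  by rewrite mxE mul0r.
move=> c _ _ [a [b ->]] [a' [b' ->]]; exists (c * a + a'), (c *: b + b').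
have -> : \sum_i \sum_j (c *: b + b') i j * (pX R n *m Theta d f) i j =
    c * (\sum_i \sum_j b i j * (pX R n *m Theta d f) i j) +
    \sum_i \sum_j b' i j * (pX R n *m Theta d f) i j.
  rewrite mulr_sumr -big_split; apply: eq_bigr => i _ /=.
  rewrite mulr_sumr -big_split; apply: eq_bigr => j _ /=.
  by rewrite mxE [(c *: b) i j]mxE mulrDl mulrA.
by ring.
Qed.

Lemma kkt_trace : kkt_ideal (\tr (pX R n) - 1).
Proof.
exists 1, 0; rewrite mul1r big1 ?addr0 // => i _; rewrite big1 // => j _.
by rewrite mxE mul0r.
Qed.

Lemma kkt_compl i j : kkt_ideal ((pX R n *m Theta d f) i j).
Proof.
exists 0, (delta_mx i j); rewrite mul0r add0r (bigD1 i) //= (bigD1 j) //=.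
rewrite [delta_mx _ _ _ _]mxE !eqxx mul1r !big1 ?addr0 // => [i' ne|j' ne].
  by rewrite big1 // => j' _; rewrite [delta_mx _ _ _ _]mxE (negPf ne) mul0r.
by rewrite [delta_mx _ _ _ _]mxE (negPf ne) andbF mul0r.
Qed.

(** If the value of [f] were transcendental, a derivation [D] over the reals with
    [D f = 1] would exist.  With [S = D X], differentiating [X Theta = 0] and
    multiplying by [Theta] on the left gives [Theta S Theta = 0].  Then [Theta S]
    has square zero, hence trace zero; but this trace is [D f], as [tr S = 0]. *)
Lemma no_transcendental_value (F : fieldType) (phi : {rmorphism A -> F}) :
  (forall g, kkt_ideal g -> phi g = 0) ->
  exists2 p : {poly R}, p != 0 & phi (horner_alg f p) = 0.
Proof.
move=> phi0; apply: contrapT => noalg.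
have alg (p : {poly R}) : phi (horner_alg f p) = 0 -> p = 0.
  by move=> h; apply/eqP; apply/negPn/negP => pn; apply: noalg; exists p.
pose psi0 := (phi \o @mpolyC (sigma n) R : {rmorphism R -> F}).
have char0 k : k.+1%:R != 0 :> F.
  by rewrite -(rmorph_nat psi0) fmorph_eq0 pnatr_eq0.
have der0 : is_der psi0 (fun=> 0).
  by split=> // a b; rewrite ?addr0 // mul0r mulr0 addr0.
have [psi1 [del1 [der1 C1 X1 D1]]] := derivation_ext_step char0 (phi f) der0.
have evE p : (map_poly psi0 p).[phi f] = phi (horner_alg f p).
  elim/poly_ind: p => [|p c IH]; first by rewrite !rmorph0 horner0.
  rewrite rmorphD rmorphM /= map_polyX map_polyC hornerMXaddC IH.
  have -> : horner_alg f (p * 'X + c%:P) = horner_alg f p * f + c%:MP.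
    by rewrite rmorphD rmorphM /= horner_algX horner_algC alg_mpolyC.
  by rewrite rmorphD rmorphM.
have {}D1 : del1 'X = 1.
  by apply: D1 => p; rewrite evE => /alg ->; rewrite rmorph0.
have [B [psi [del [io [derB psiE delE xsB]]]]] :=
  derivation_ext char0 [seq phi 'X_a | a <- enum 'I_(sigma n)] der1.
have bex (a : 'I_(sigma n)) : exists b, psi b = phi 'X_a.
  by apply: xsB; apply: map_f; rewrite mem_enum.
have [b bE] := boolp.choice bex.
pose ev := mmap (io \o @polyC R : {rmorphism R -> B}) b.
have evC c : ev c%:MP = io c%:P by rewrite /ev mmapC.
have evX a : ev 'X_a = b a by rewrite /ev mmapX mmap1U.
have evD p q : ev (p + q) = ev p + ev q by rewrite /ev rmorphD.
have evM p q : ev (p * q) = ev p * ev q by rewrite /ev rmorphM.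
have [delD delM delK] := derB.
have psiev g : psi (ev g) = phi g.
  elim/mpoly_alg_ind: g => [c|a|p q IHp IHq|p q IHp IHq].
  - by rewrite evC psiE; case: (C1 c).
  - by rewrite evX.
  - by rewrite evD !rmorphD IHp IHq.
  - by rewrite evM !rmorphM IHp IHq.
pose D g := del (ev g).
have DC c : D c%:MP = 0 by rewrite /D evC delE; case: (C1 c).
have DD p q : D (p + q) = D p + D q by rewrite /D evD delD.
have DM p q : D (p * q) = D p * phi q + phi p * D q.
  by rewrite /D evM delM !psiev.
have DI g : kkt_ideal g -> D g = 0 by move=> /phi0 h; rewrite /D delK // psiev.
(* The derivation was chosen to be 1 at the value of [f]. *)
have Df : D f = 1.
  rewrite -D1 -[RHS]delE; apply/eqP; rewrite -subr_eq0; apply/eqP.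
  have -> : D f = del (ev f - io 'X) + del (io 'X) by rewrite -delD subrK.
  by rewrite addrK delK // rmorphB psiev psiE X1 subrr.
have D0 : D 0 = 0 by rewrite -mpolyC0 DC.
have Dsum (I : finType) (g : I -> A) : D (\sum_i g i) = \sum_i D (g i).
  exact: (big_morph D DD D0).
pose S := symX (fun a => D 'X_a).
have trS : \tr S = 0.
  have := DI _ kkt_trace; rewrite DD -mpolyC1 -mpolyCN DC addr0 => <-.
  by rewrite /mxtrace Dsum; apply: eq_bigr => i _; rewrite !mxE.
pose Th := map_mx phi (Theta d f).
pose X := map_mx phi (pX R n).
have XTh : X *m Th = 0.
  rewrite -map_mxM; apply/matrixP => i j; rewrite [LHS]mxE [RHS]mxE.
  by apply: phi0; exact: kkt_compl.
have ThX : Th *m X = 0.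
  have := congr1 trmx XTh; rewrite trmx_mul trmx0 /Th /X !map_trmx.
  by rewrite Theta_sym symX_sym.
have SThX : S *m Th = - (X *m map_mx D (Theta d f)).
  apply/eqP; rewrite -addr_eq0; apply/eqP/matrixP => i j.
  have := DI _ (kkt_compl i j); rewrite [X in D X]mxE Dsum => E.
  rewrite [RHS]mxE -[RHS]E [LHS]mxE [X in X + _]mxE [X in _ + X]mxE -big_split /=.
  apply: eq_bigr => k _.
  by rewrite DM; congr (_ * _ + _ * _); rewrite [LHS]mxE // [pX R n i k]mxE.
have ThSTh : Th *m S *m Th = 0.
  by rewrite -mulmxA SThX mulmxN mulmxA ThX mul0mx oppr0.
have tr0 : \tr (Th *m S) = 0.
  by apply: mxtrace_sqr0; rewrite mulmxA ThSTh mul0mx.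
have := tr_Theta d f phi (fun a => D 'X_a).
rewrite -/Th -/S tr0 trS mulr0 subr0 -der_chain // Df => /eqP.
by rewrite eq_sym oner_eq0.
Qed.

(** The polynomials in [f] form a multiplicative set.  If it did not meet the
    ideal, [f] would take a transcendental value at some generic point. *)
Lemma critical_values_finite : exists2 p : {poly R}, p != 0 & kkt_ideal (horner_alg f p).
Proof.
apply: contrapT => no.
pose M : set A := [set g | exists2 p : {poly R}, p != 0 & g = horner_alg f p]%classic.
have [||||F [phi [phi0 phiM]]] := @ideal_avoid_field A kkt_ideal M.
- exact: kkt_ideal_ideal.
- by exists 1; rewrite ?oner_neq0 // rmorph1.
- move=> _ _ [p p0 ->] [q q0 ->]; exists (p * q); rewrite ?mulf_neq0 //.
  by rewrite rmorphM.
- by move=> g Ig [p p0 gE]; apply: no; exists p; rewrite // -gE.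
have [p p0 /phiM] := no_transcendental_value phi0; apply.
by exists p.
Qed.

End CriticalValues.

(** * Ultralimits of bounded real sequences *)

Section UltraLimits.
Local Open Scope classical_set_scope.

(** A free ultrafilter assigns a limit to every bounded sequence at once, which
    replaces compactness of products and extraction of subsequences. *)
Lemma free_ultrafilter_exists :
  exists U : set_system nat, UltraFilter U /\ (\oo `<=` U).
Proof. exact: ultraFilterLemma. Qed.

Definition omega : set_system nat := sval (cid free_ultrafilter_exists).

Global Instance omega_ultra : UltraFilter omega.
Proof. by rewrite /omega; case: cid => U []. Qed.

Lemma omega_oo : \oo `<=` omega.
Proof. by rewrite /omega; case: cid => U []. Qed.

Variable R : realType.
Implicit Types x y : nat -> R.

Lemma omega_cvg_ex (C : R) x : (forall i, `|x i| <= C) -> exists l : R, x @ omega --> l.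
Proof.
move=> xC.
have UC : (x @ omega) `[- C, C]%classic.
  apply: (@filterS _ omega _ setT) => [i _|]; last exact: filterT.
  by rewrite /= in_itv /= -ler_norml.
have [l [_ cl]] := @segment_compact R (- C) C (x @ omega) _ UC.
exists l => V lV.
have [//|nV] := in_ultra_setVsetC (x @^-1` V) omega_ultra.
by have [y [/= nVy Vy]] := cl (~` V) V nV lV.
Qed.

Definition ulim x : R := lim (x @ omega).

Lemma ulim_cvg (C : R) x : (forall i, `|x i| <= C) -> x @ omega --> ulim x.
Proof. by move=> /omega_cvg_ex[l xl]; rewrite /ulim (cvg_lim _ xl). Qed.

Lemma omega_ge (c l : R) x : x @ omega --> l -> \oo [set i | c <= x i] -> c <= l.
Proof.
move=> xl cx; apply: (closed_cvg (fun y : R => c <= y) (@closed_ge R c) _ _ xl).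
exact: omega_oo.
Qed.

Lemma omega_le (c l : R) x : x @ omega --> l -> \oo [set i | x i <= c] -> l <= c.
Proof.
move=> xl cx; apply: (closed_cvg (fun y : R => y <= c) (@closed_le R c) _ _ xl).
exact: omega_oo.
Qed.

Lemma omega_unique x (l l' : R) : x @ omega --> l -> x @ omega --> l' -> l = l'.
Proof. by move=> h h'; rewrite -(cvg_lim _ h) // -(cvg_lim _ h'). Qed.

Variable T : Type.

Definition ulimf (E : nat -> T -> R) : T -> R := fun t => ulim (fun i => E i t).

Definition bounded_by (B : R) (E : T -> R) := forall t, `|E t| <= B.

Lemma ulimf_cvg B (E : nat -> T -> R) : (forall i, bounded_by B (E i)) ->
  forall t, (fun i => E i t) @ omega --> ulimf E t.
Proof. by move=> EB t; apply: ulim_cvg => i; exact: EB. Qed.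

Definition uclosed (K : set (T -> R)) :=
  forall E : nat -> T -> R, (forall i, K (E i)) -> K (ulimf E).

Definition ucontinuous B (phi : (T -> R) -> R) :=
  forall E : nat -> T -> R, (forall i, bounded_by B (E i)) ->
    (fun i => phi (E i)) @ omega --> phi (ulimf E).

(** The ultralimit of a minimizing sequence is a minimizer. *)
Lemma min_attained B (K : set (T -> R)) (phi : (T -> R) -> R) :
  K !=set0 -> (forall E, K E -> bounded_by B E) -> uclosed K -> ucontinuous B phi ->
  exists E0, K E0 /\ forall E, K E -> phi E0 <= phi E.
Proof.
move=> [E1 KE1] KB Kcl phic.
have lb : has_lbound (phi @` K).
  apply: contrapT => nlb.
  have ex (i : nat) : exists E, K E /\ phi E < - i%:R.
    apply: contrapT => h; apply: nlb; exists (- i%:R) => _ [E KE <-].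
    by rewrite leNgt; apply/negP => lt; apply: h; exists E.
  have [E KE] := boolp.choice ex.
  have c := phic E (fun i => KB _ (KE i).1).
  pose l := phi (ulimf E).
  suff : l <= l - 1 by move=> ?; lra.
  apply: (omega_le c).
  exists (Num.truncn (`|l| + 1)).+1 => // i /= ni.
  apply: le_trans (ltW (KE i).2) _.
  have : `|l| + 1 < i%:R.
    by apply: lt_le_trans (truncnS_gt _) _; rewrite ler_nat.
  have := ler_norm (- l); rewrite normrN; lra.
have ne : (phi @` K) !=set0 by exists (phi E1), E1.
pose m := inf (phi @` K).
have ex (i : nat) : exists E, K E /\ phi E < m + i.+1%:R^-1.
  have i0 : 0 < i.+1%:R^-1 :> R by rewrite invr_gt0.
  have [_ [E KE <-] lt] := inf_adherent i0 (conj ne lb).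
  by exists E.
have [E KE] := boolp.choice ex.
have c := phic E (fun i => KB _ (KE i).1).
exists (ulimf E); split; first by apply: Kcl => i; case: (KE i).
move=> E' KE'; apply: (@le_trans _ _ m); last by apply: ge_inf => //; exists E'.
apply/ler_addgt0Pr => e e0; apply: (omega_le c).
have := near_infty_natSinv_lt (PosNum e0); apply: filterS => i /= lt.
by apply: le_trans (ltW (KE i).2) _; rewrite lerD2l ltW.
Qed.

Lemma ulimf_lincomb_cvg B (E : nat -> T -> R) (s : seq T) (c : T -> R) :
  (forall i, bounded_by B (E i)) ->
  (fun i => \sum_(t <- s) c t * E i t) @ omega --> \sum_(t <- s) c t * ulimf E t.
Proof.
move=> EB; elim: s => [|t s IH].
  under eq_fun do rewrite big_nil.
  by rewrite big_nil; exact: cvg_cst.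
under eq_fun do rewrite big_cons.
rewrite big_cons; apply: cvgD => //; apply: cvgM; first exact: cvg_cst.
by apply: ulim_cvg => i; exact: EB.
Qed.

End UltraLimits.
Arguments ulimf_cvg {R T B E} _ t.
Arguments ulimf_lincomb_cvg {R T B E} s c _.

(** * Linear functionals given by moments *)

Section Functionals.
Variables (R : realType) (N : nat).
Local Notation A := {mpoly R[N]}.
Local Notation mon := 'X_{1..N}.
Implicit Types (E : mon -> R) (p q : A).

(** The Riesz functional of the moment sequence [E]. *)
Definition riesz (E : mon -> R) (p : A) : R := \sum_(m <- msupp p) p@_m * E m.

Lemma rieszE k E p : (msize p <= k)%N -> riesz E p = \sum_(m : 'X_{1..N < k}) p@_m * E m.
Proof.
move=> le_pk; pose I : subFinType _ := 'X_{1..N < k}.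
rewrite /riesz (ssrcomplements.big_mksub I) ?msupp_uniq //=; first last.
  by move=> x /msize_mdeg_lt /leq_trans; apply.
by rewrite big_rmcond //= => j /memN_msupp_eq0 ->; rewrite mul0r.
Qed.

Lemma riesz_linear E : linear_for *%R (riesz E).
Proof.
move=> c p q; pose k := maxn (msize (c *: p + q)) (maxn (msize p) (msize q)).
rewrite !(@rieszE k) /k ?leq_max ?leqnn ?orbT //.
rewrite mulr_sumr -big_split; apply: eq_bigr => m _ /=.
by rewrite mcoeffD mcoeffZ mulrDl mulrA.
Qed.
HB.instance Definition _ E := GRing.isLinear.Build R A R *%R (riesz E) (riesz_linear E).

Lemma rieszX E m : riesz E 'X_[m] = E m.
Proof. by rewrite /riesz msuppX big_seq1 mcoeffX eqxx mul1r. Qed.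

Lemma rieszC E c : riesz E c%:MP = c * E 0%MM.
Proof. by rewrite -[c%:MP]mulr1 mul_mpolyC linearZ /= -mpolyX0 rieszX. Qed.

Lemma riesz1 E : riesz E 1 = E 0%MM.
Proof. by rewrite -mpolyX0 rieszX. Qed.

Lemma rieszZ E c p : riesz E (c *: p) = c * riesz E p. Proof. exact: linearZ. Qed.

Definition weighted E (g : A) : mon -> R := fun m => riesz E ('X_[m] * g).

Lemma riesz_weighted E g p : riesz (weighted E g) p = riesz E (p * g).
Proof.
rewrite [in RHS](mpolyE p) mulr_suml raddf_sum; apply: eq_bigr => m _ /=.
by rewrite -scalerAl rieszZ.
Qed.

Lemma weightedE E g m : weighted E g m = \sum_(m' <- msupp g) g@_m' * E (m + m')%MM.
Proof.
rewrite /weighted [in LHS](mpolyE g) mulr_sumr raddf_sum; apply: eq_bigr => m' _ /=.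
by rewrite -scalerAr rieszZ -mpolyXD rieszX.
Qed.

(** Nonpositive discriminant of a nonnegative quadratic polynomial in [c]. *)
Lemma quadratic_ge0 (a b d : R) : (forall c, 0 <= a + c * (b *+ 2) + c ^+ 2 * d) ->
  b ^+ 2 <= a * d.
Proof.
move=> h; have a0 := h 0; rewrite !mul0r expr0n mul0r !addr0 in a0.
have d0 : 0 <= d.
  rewrite leNgt; apply/negP => dlt.
  have {}h1 := h (1 + (a + `|b|) / - d); have h2 := h (- (1 + (a + `|b|) / - d)).
  set c := 1 + _ in h1 h2.
  have cd : c * d = d - (a + `|b|) by rewrite /c; field; rewrite lt_eqF.
  have c1 : 1 <= c by rewrite /c lerDl divr_ge0 ?addr_ge0 // oppr_ge0 ltW.
  have h3 : 0 <= a + c ^+ 2 * d by rewrite sqrrN in h2; lra.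
  have : c ^+ 2 * d <= c * d.
    by rewrite expr2 -mulrA ler_neMl // pmulr_rle0 ?(ltW dlt) //; apply: lt_le_trans c1.
  have := normr_ge0 b; lra.
have [d_eq|dn] := eqVneq d 0.
  suff -> : b = 0 by rewrite expr0n /= d_eq mulr0.
  apply/eqP/negPn/negP => bn.
  have := h (- (a + 1) / (b *+ 2)); rewrite d_eq mulr0 addr0 divfK ?mulrn_eq0 //.
  lra.
have := h (- b / d).
have -> : a + - b / d * (b *+ 2) + (- b / d) ^+ 2 * d = (a * d - b ^+ 2) / d by field.
by rewrite pmulr_lge0 ?invr_gt0 ?lt0r ?dn // subr_ge0.
Qed.

Lemma riesz_sqD E p q c :
  riesz E ((p + c *: q) ^+ 2) = riesz E (p ^+ 2) + c * (riesz E (p * q) *+ 2) + c ^+ 2 * riesz E (q ^+ 2).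
Proof.
have -> : (p + c *: q) ^+ 2 = p ^+ 2 + c *: (p * q *+ 2) + (c ^+ 2) *: q ^+ 2.
  by rewrite -!mul_mpolyC [c ^+ 2]expr2 mpolyCM; ring.
rewrite mulr2n scalerDr !raddfD /= !rieszZ; ring.
Qed.

Lemma riesz_CS E p q : (forall c, 0 <= riesz E ((p + c *: q) ^+ 2)) ->
  riesz E (p * q) ^+ 2 <= riesz E (p ^+ 2) * riesz E (q ^+ 2).
Proof. by move=> h; apply: quadratic_ge0 => c; rewrite -riesz_sqD. Qed.

(** If the quotient [r 0 / m0] exceeded 1 in absolute value, its iterated squares
    would be dominated by the quotients [r j / m0] and these would not stay
    bounded. *)
Lemma doubling_bound (m0 C : R) (r : nat -> R) : 0 <= m0 ->
  (forall j, r j ^+ 2 <= m0 * r j.+1) -> (forall j, `|r j| <= C) -> `|r 0%N| <= m0.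
Proof.
move=> m0_ge rS rC; rewrite leNgt; apply/negP => lt.
have m0_gt : 0 < m0.
  rewrite lt_neqAle m0_ge andbT eq_sym; apply/eqP => m00.
  have := rS 0%N; rewrite m00 mul0r => h.
  suff r0 : r 0%N = 0 by move: lt; rewrite r0 normr0 m00 ltxx.
  by apply/eqP; rewrite -sqrf_eq0 eq_le h sqr_ge0.
pose e := `|r 0%N| / m0 - 1.
have e0 : 0 < e by rewrite /e subr_gt0 ltr_pdivlMr // mul1r.
have grow j : 1 + (j.+1)%:R * e <= r j.+1 / m0.
  elim: j => [|j IH].
    have h : (1 + e) ^+ 2 <= r 1%N / m0.
      rewrite /e addrC subrK expr_div_n real_normK ?num_real //.
      rewrite ler_pdivrMr ?exprn_gt0 // [m0 ^+ 2]expr2 mulrA divfK ?gt_eqF //.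
      by rewrite [r 1%N * _]mulrC; exact: rS.
    apply: le_trans h; rewrite mul1r; nra.
  have h : (r j.+1 / m0) ^+ 2 <= r j.+2 / m0.
    rewrite expr_div_n ler_pdivrMr ?exprn_gt0 // [m0 ^+ 2]expr2 mulrA divfK ?gt_eqF //.
    by rewrite [r j.+2 * _]mulrC; exact: rS.
  apply: le_trans h.
  have je : 0 <= j.+1%:R * e by rewrite mulr_ge0 // ltW.
  have j1 : 1 <= j.+1%:R :> R by rewrite ler1n.
  rewrite -[j.+2]addn1 natrD mulrDl mul1r.
  have ej : e <= j.+1%:R * e by rewrite ler_peMl // ltW.
  nra.
have C0 : 0 <= C by apply: le_trans (rC 0%N).
pose k := Num.truncn (C / m0 / e).
have := grow k; have := rC k.+1; rewrite ler_norml => /andP[_ h1] h2.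
have h3 : C / m0 / e < k.+1%:R by exact: truncnS_gt.
rewrite ltr_pdivrMr // in h3.
have h4 : r k.+1 / m0 <= C / m0 by rewrite ler_pM2r ?invr_gt0.
lra.
Qed.

Definition sqpos E := forall p, 0 <= riesz E (p ^+ 2).

(** Boundedness of the moments already bounds them by the total mass: apply the
    doubling bound to the powers of a monomial of exponents 2^j.  Positivity is
    asked on squares alone because the lemma is applied to weighted functionals. *)
Lemma sqpos_bounded E C : sqpos E -> bounded_by C E -> bounded_by (E 0%MM) E.
Proof.
move=> Ep EC m.
have E0 : 0 <= E 0%MM by have := Ep 1; rewrite expr1n riesz1.
pose r j := E (m *+ 2 ^ j)%MM.
have -> : E m = r 0%N by rewrite /r expn0 mulm1n.
apply: (doubling_bound (C := C)) => // j; last exact: EC.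
have := @riesz_CS E 1 'X_[(m *+ 2 ^ j)%MM] (fun c => Ep _).
rewrite mul1r rieszX expr1n riesz1 mpolyXn rieszX.
have -> // : (m *+ 2 ^ j *+ 2 = m *+ 2 ^ j.+1)%MM.
by apply/mnmP => i; rewrite !mulmnE expnSr mulnA.
Qed.

Lemma sqpos_CS E p q : sqpos E -> riesz E (p * q) ^+ 2 <= riesz E (p ^+ 2) * riesz E (q ^+ 2).
Proof. by move=> Ep; apply: riesz_CS => c; exact: Ep. Qed.

Lemma riesz_cvg (E_ : nat -> mon -> R) B p : (forall i, bounded_by B (E_ i)) ->
  ((fun i => riesz (E_ i) p) @ omega --> riesz (ulimf E_) p)%classic.
Proof.
by move=> EB; exact: ulimf_lincomb_cvg.
Qed.

End Functionals.
Arguments riesz_cvg {R N E_ B} p _.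

(** * Extreme functionals on an Archimedean quadratic module *)

Section QuadraticModule.
Variables (R : realType) (N : nat).
Local Notation A := {mpoly R[N]}.
Local Notation mon := 'X_{1..N}.
Implicit Types (E : mon -> R) (p q : A).

(** A quadratic module whose elements [T D] are those that the program of a given
    order can test, [D] measuring the degree of the multipliers.  The last clause
    puts the variables in the unit ball, which makes the module Archimedean. *)
Record graded_qmodule (T : nat -> A -> Prop) : Prop := GradedQmodule {
  gqm_mono : forall D D' t, (D <= D')%N -> T D t -> T D' t;
  gqm_mul : forall D t h, T D t -> T (D + msize h)%N (t * h ^+ 2);
  gqm_one : T 0 1;
  gqm_ball : forall a, T 0 (1 - 'X_a ^+ 2) }.

Variable T : nat -> A -> Prop.
Hypothesis Tq : graded_qmodule T.

Definition pos_upto (D : nat) E := forall t, T D t -> 0 <= riesz E t.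
Definition feas_upto (D : nat) E := E 0%MM = 1 /\ pos_upto D E.
Definition posset : set ('I_N -> R) := [set u | forall D t, T D t -> 0 <= t.@[u]]%classic.

Lemma pos_sq D E h : pos_upto D E -> (msize h <= D)%N -> 0 <= riesz E (h ^+ 2).
Proof.
move=> EP hD; apply: EP; apply: (gqm_mono Tq hD).
by rewrite -[h ^+ 2]mul1r -[msize h]add0n; exact/(gqm_mul Tq)/(gqm_one Tq).
Qed.

(** Removing one variable from the monomial does not decrease the even moment, by
    positivity on [(1 - 'X_a ^+ 2) * h ^+ 2]. *)
Lemma pos_even_moment D E m : pos_upto D E -> (mdeg m <= D)%N ->
  E (m + m)%MM <= E 0%MM.
Proof.
move=> EP; have [k] := ubnP (mdeg m); elim: k m => // k IH m mk mD.
have [->|m0] := eqVneq m 0%MM; first by rewrite addm0.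
have /existsP[a ma] : [exists a, m a != 0%N].
  apply: contraT => /existsPn h; case/eqP: m0; apply/mnmP => a.
  by rewrite mnm0E; have := h a; rewrite negbK => /eqP.
have Ua : (U_(a) <= m)%MM by rewrite lep1mP.
pose m' := (m - U_(a))%MM.
have mE : m = (m' + U_(a))%MM by rewrite /m' submK.
have dm : mdeg m = (mdeg m').+1 by rewrite {1}mE mdegD mdeg1 addn1.
have m'k : (mdeg m' < k)%N by rewrite -dm -ltnS.
apply: le_trans (IH m' m'k _); last by apply: ltnW; rewrite -dm.
have : 0 <= riesz E ((1 - 'X_a ^+ 2) * 'X_[m'] ^+ 2).
  apply: EP; apply: (@gqm_mono _ Tq (0 + msize 'X_[R, m'])).
    by rewrite add0n msizeX -dm.
  exact/(gqm_mul Tq)/(gqm_ball Tq).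
have -> : (1 - 'X_a ^+ 2) * 'X_[m'] ^+ 2 = 'X_[m' + m'] - 'X_[m + m] :> A.
  by rewrite mE !mpolyXD; ring.
by rewrite raddfB /= !rieszX subr_ge0.
Qed.

Lemma pos_moment D E m : pos_upto D E -> (mdeg m < D)%N -> `|E m| <= E 0%MM.
Proof.
move=> EP mD; have e2 := pos_even_moment EP (ltnW mD).
have sq (c : R) : 0 <= E (m + m)%MM + c * (E m *+ 2) + c ^+ 2 * E 0%MM.
  have := @pos_sq D E ('X_[m] + c *: 1) EP; rewrite riesz_sqD mulr1 expr1n rieszX riesz1.
  rewrite expr2 -mpolyXD rieszX; apply.
  apply: leq_trans (mmeasureD_le _ _ _) _; rewrite geq_max msizeX mD /=.
  by apply: leq_trans (mmeasureZ_le _ _ _) _; rewrite mmeasure1; apply: leq_trans mD.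
have := sq 1; have := sq (-1); rewrite ler_norml; move=> h1 h2; apply/andP; split; lra.
Qed.

Definition allpos E := forall D, pos_upto D E.
Definition pseudo_moments : set (mon -> R) :=
  [set E | [/\ E 0%MM = 1, bounded_by 1 E & allpos E]]%classic.

Lemma allpos_sqpos E : allpos E -> sqpos E.
Proof. by move=> EP h; apply: (pos_sq (EP (msize h))). Qed.

Lemma weighted_bounded E g C : bounded_by C E ->
  bounded_by ((\sum_(m <- msupp g) `|g@_m|) * C) (weighted E g).
Proof.
move=> EC m; rewrite weightedE mulr_suml; apply: le_trans (ler_norm_sum _ _ _) _.
by apply: ler_sum => m' _; rewrite normrM ler_wpM2l.
Qed.

(** Multiplication by the bounded variable [c 'X_a] does not increase the mass of
    any functional obtained by localizing at an element of the module; hence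
    [1 + c 'X_a] is an admissible weight although it is not in the module. *)
Lemma weight_linear_pos E (c : R) a : pseudo_moments E -> `|c| <= 1 ->
  allpos (weighted E (1 + c *: 'X_a)).
Proof.
move=> [E0 E1 EP] c1 D t Tt.
have sq : sqpos (weighted E t).
  move=> h; rewrite riesz_weighted mulrC; apply: (EP (D + msize h)%N).
  exact: (gqm_mul Tq).
have := sqpos_bounded sq (weighted_bounded t E1) U_(a)%MM.
rewrite /weighted mpolyX0 mul1r => h.
rewrite riesz_weighted mulrDr mulr1 raddfD /= -scalerAr rieszZ [t * _]mulrC.
suff : `|c * riesz E ('X_a * t)| <= riesz E t by rewrite ler_norml => /andP[]; lra.
by rewrite normrM; apply: le_trans h; rewrite ler_piMl.
Qed.

Lemma pseudo_moments_closed : uclosed pseudo_moments.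
Proof.
move=> E EP.
have Eb i : bounded_by 1 (E i) by case: (EP i).
have c := ulimf_cvg Eb.
split.
- apply: (omega_unique (c 0%MM)).
  have -> : (fun i => E i 0%MM) = (fun=> 1) by apply/funext => i; case: (EP i).
  exact: cvg_cst.
- move=> m; rewrite ler_norml; apply/andP; split.
    by apply: (omega_ge (c m)); exists 0%N => // i _ /=; have := Eb i m; rewrite ler_norml => /andP[].
  by apply: (omega_le (c m)); exists 0%N => // i _ /=; have := Eb i m; rewrite ler_norml => /andP[].
- move=> D t Tt; apply: (omega_ge (riesz_cvg t Eb)); exists 0%N => // i _ /=.
  by case: (EP i) => _ _ h; exact: (h D).
Qed.

(** Reweighting by [1 + c 'X_a] and normalizing stays among the feasible
    functionals. *)
Lemma pseudo_moments_tilt E (c : R) a : pseudo_moments E -> `|c| <= 1 ->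
  0 < 1 + c * E U_(a)%MM ->
  pseudo_moments (fun m => (1 + c * E U_(a)%MM)^-1 * weighted E (1 + c *: 'X_a) m).
Proof.
move=> EP c1 s0; have wp := @weight_linear_pos E c a EP c1.
have [E0 E1 _] := EP.
have w0 : weighted E (1 + c *: 'X_a) 0%MM = 1 + c * E U_(a)%MM.
  by rewrite /weighted mpolyX0 mul1r raddfD /= rieszZ riesz1 rieszX E0.
have LfE' p s (W : mon -> R) : riesz (fun m => s * W m) p = s * riesz W p.
  by rewrite /riesz mulr_sumr; apply: eq_bigr => m _; rewrite mulrCA.
split.
- by rewrite w0 mulVf ?gt_eqF.
- move=> m; rewrite normrM gtr0_norm ?invr_gt0 // mulrC ler_pdivrMr // mul1r -w0.
  exact: sqpos_bounded (allpos_sqpos wp) (weighted_bounded _ E1) m.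
- move=> D t Tt; rewrite LfE' mulr_ge0 ?invr_ge0 ?(ltW s0) //.
  exact: (wp D).
Qed.

(** When the variables have variance zero, the Cauchy-Schwarz inequality makes the
    functional multiplicative. *)
Lemma pseudo_moments_eval E : pseudo_moments E ->
  (forall a, E (U_(a) + U_(a))%MM <= E U_(a)%MM ^+ 2) ->
  forall p, riesz E p = p.@[fun a => E U_(a)%MM].
Proof.
move=> [E0 E1 EP] var.
have var0 a q : riesz E ('X_a * q) = E U_(a)%MM * riesz E q.
  have Ep := allpos_sqpos EP.
  have := @sqpos_CS _ _ E ('X_a + (- E U_(a)%MM) *: 1) q Ep.
  have -> : riesz E (('X_a + (- E U_(a)%MM) *: 1) ^+ 2) = 0.
    have := var a; have := Ep ('X_a + (- E U_(a)%MM) *: 1).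
    rewrite riesz_sqD mulr1 expr1n riesz1 E0 expr2 -mpolyXD !rieszX => h1 h2.
    apply/eqP; rewrite eq_le; apply/andP; split => //; nra.
  rewrite mul0r => h; apply/eqP; rewrite -subr_eq0 -sqrf_eq0 eq_le sqr_ge0 andbT.
  apply: le_trans h; rewrite mulrDl -scalerAl mul1r raddfD /= rieszZ mulNr.
  exact: lexx.
suff mul p : forall q, riesz E (p * q) = p.@[fun a => E U_(a)%MM] * riesz E q.
  by move=> p; rewrite -[p in LHS]mulr1 mul riesz1 E0 mulr1.
elim/mpoly_alg_ind: p => [c|a|p p' IH IH'|p p' IH IH'] q.
- by rewrite mul_mpolyC rieszZ mevalC.
- by rewrite var0 mevalXU.
- by rewrite mulrDl raddfD /= IH IH' mevalD mulrDl.
- by rewrite -mulrA IH IH' mevalM mulrA.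
Qed.

(** An extreme minimizer of [p] is a point.  Among the minimizers of [p], one that
    maximizes the strictly convex function [sum_a E('X_a)^2] is a mixture of its
    two tilts by [1 + 'X_a] and [1 - 'X_a], which are minimizers of [p] as well;
    strict convexity forces them to have the same first moments, and this says
    that ['X_a] has variance zero. *)
Lemma pseudo_moments_point E p : pseudo_moments E ->
  exists2 u, posset u & p.@[u] <= riesz E p.
Proof.
move=> EP.
have bnd E' : pseudo_moments E' -> bounded_by 1 E' by case.
have [E0 [E0P E0min]] := @min_attained R mon 1 pseudo_moments (fun E => riesz E p)
  (ex_intro _ E EP) bnd (@pseudo_moments_closed) (fun E_ : nat -> mon -> R => @riesz_cvg R N E_ 1 p).
pose face : set (mon -> R) := [set E | pseudo_moments E /\ riesz E p = riesz E0 p]%classic.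
have face_cl : uclosed face.
  move=> E_ Ef; split; first by apply: pseudo_moments_closed => i; case: (Ef i).
  have h1 := riesz_cvg p (fun i => bnd _ (Ef i).1); apply: (omega_unique h1).
  have -> : (fun i => riesz (E_ i) p) = (fun=> riesz E0 p).
    by apply/funext => i; case: (Ef i).
  exact: cvg_cst.
have sq_cont : ucontinuous 1 (fun E : mon -> R => - \sum_a E U_(a)%MM ^+ 2).
  move=> E_ Eb; apply: cvgN.
  elim: (index_enum _) => [|a s IH].
    by under eq_fun do rewrite big_nil; rewrite big_nil; exact: cvg_cst.
  under eq_fun do rewrite big_cons.
  rewrite big_cons; apply: cvgD => //.
  by under eq_fun do rewrite expr2; rewrite expr2; apply: cvgM; exact: ulimf_cvg Eb _.
have [E1 [[E1P E1p] E1max]] := @min_attained R mon 1 face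
  (fun E => - \sum_a E U_(a)%MM ^+ 2) (ex_intro _ E0 (conj E0P erefl))
  (fun E h => bnd _ h.1) face_cl sq_cont.
have E1b := bnd _ E1P.
have [E10 _ E1pos] := E1P.
have var a : E1 (U_(a) + U_(a))%MM <= E1 U_(a)%MM ^+ 2.
  set x := E1 U_(a)%MM.
  have x1 : `|x| <= 1 by exact: E1b.
  have e2 : E1 (U_(a) + U_(a))%MM <= 1.
    by have := E1b (U_(a) + U_(a))%MM; rewrite ler_norml => /andP[].
  (* If [x ^+ 2 = 1] the variance is zero because the second moment is at most
     1, and one of the tilts would have no mass. *)
  have [xlt|] := ltP (x ^+ 2) 1; last by apply: le_trans.
  have [xp xm] : 0 < 1 + 1 * x /\ 0 < 1 + (-1) * x by split; nra.
  have c1 : `|1 : R| <= 1 by rewrite normr1.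
  have c2 : `|-1 : R| <= 1 by rewrite normrN normr1.
  have Pp := pseudo_moments_tilt E1P c1 xp.
  have Pm := pseudo_moments_tilt E1P c2 xm.
  set Ep := (fun m => _) in Pp; set Em := (fun m => _) in Pm.
  have LE s c q : riesz (fun m => s * weighted E1 (1 + c *: 'X_a) m) q =
      s * (riesz E1 q + c * riesz E1 ('X_a * q)).
    transitivity (s * riesz (weighted E1 (1 + c *: 'X_a)) q).
      by rewrite /riesz mulr_sumr; apply: eq_bigr => m _; rewrite mulrCA.
    by rewrite riesz_weighted mulrDr mulr1 -scalerAr raddfD /= rieszZ ['X_a * q]mulrC.
  have mixL q : riesz E1 q = ((1 + x) / 2) * riesz Ep q + ((1 - x) / 2) * riesz Em q.
    rewrite /Ep /Em !LE -/x; field; apply/andP; split; apply: lt0r_neq0; lra.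
  have ep := E0min _ Pp; have em := E0min _ Pm.
  have := mixL p; rewrite E1p => mixp.
  have epE : riesz Ep p = riesz E0 p by nra.
  have emE : riesz Em p = riesz E0 p by nra.
  have fp := E1max _ (conj Pp epE); have fm := E1max _ (conj Pm emE).
  have mixU b : E1 U_(b)%MM = ((1 + x) / 2) * Ep U_(b)%MM + ((1 - x) / 2) * Em U_(b)%MM.
    by have := mixL 'X_b; rewrite !rieszX.
  (* The defect of convexity of the sum of squares for the mixture. *)
  have key : ((1 + x) / 2) * ((1 - x) / 2) * \sum_b (Ep U_(b)%MM - Em U_(b)%MM) ^+ 2 <= 0.
    have -> : ((1 + x) / 2) * ((1 - x) / 2) * \sum_b (Ep U_(b)%MM - Em U_(b)%MM) ^+ 2 =
      ((1 + x) / 2) * \sum_b Ep U_(b)%MM ^+ 2 + ((1 - x) / 2) * \sum_b Em U_(b)%MM ^+ 2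
      - \sum_b E1 U_(b)%MM ^+ 2.
      rewrite !mulr_sumr -big_split -sumrB /=; apply: eq_bigr => b _.
      by rewrite mixU; field.
    move: fp fm; rewrite !lerN2; nra.
  have sq0 : (Ep U_(a)%MM - Em U_(a)%MM) ^+ 2 <= 0.
    apply: (@le_trans _ _ (\sum_b (Ep U_(b)%MM - Em U_(b)%MM) ^+ 2)).
      by rewrite (bigD1 a) //= lerDl sumr_ge0 // => b _; rewrite sqr_ge0.
    by move: key; rewrite pmulr_rle0 // mulr_gt0 //; lra.
  have {sq0} EE : Ep U_(a)%MM = Em U_(a)%MM.
    by apply/eqP; rewrite -subr_eq0 -sqrf_eq0 eq_le sq0 sqr_ge0.
  have := mixU a; rewrite -EE -mulrDl -/x.
  have -> : (1 + x) / 2 + (1 - x) / 2 = 1 by field.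
  rewrite mul1r => xE.
  have : riesz Ep 'X_a = x by rewrite rieszX.
  rewrite /Ep LE -mpolyXD !rieszX -/x => /(canRL (mulVKf (lt0r_neq0 xp))) h.
  have -> : E1 (U_(a) + U_(a))%MM = x ^+ 2 by lra.
  exact: lexx.
have ev := pseudo_moments_eval E1P var.
exists (fun a => E1 U_(a)%MM); first by move=> D t Tt; rewrite -ev; exact: (E1pos D).
by rewrite -ev E1p; exact: E0min.
Qed.

End QuadraticModule.

(** * Positivity of truncated functionals *)

Section Certificates.
Variables (R : realType) (N : nat).
Local Notation A := {mpoly R[N]}.
Local Notation mon := 'X_{1..N}.
Implicit Types (p q : A).
Variable T : nat -> A -> Prop.
Hypothesis Tq : graded_qmodule T.

Lemma pos_upto_le D D' (E : mon -> R) : (D <= D')%N -> pos_upto T D' E -> pos_upto T D E.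
Proof. by move=> DD EP t Tt; apply: EP; exact: gqm_mono Tt. Qed.

Lemma feas_upto_le D D' (E : mon -> R) : (D <= D')%N -> feas_upto T D' E -> feas_upto T D E.
Proof. by move=> DD [E0 EP]; split=> //; exact: pos_upto_le EP. Qed.

(** Dual form of Putinar's theorem with a degree bound: otherwise functionals
    feasible to higher and higher orders would be negative at [G], and their
    ultralimit, which is feasible at every order, would be nonpositive there. *)
Lemma putinar (G : A) (eta : R) : 0 < eta ->
  (forall u, posset T u -> eta <= G.@[u]) ->
  exists D, forall E, feas_upto T D E -> 0 <= riesz E G.
Proof.
move=> eta0 Geta; apply: contrapT => no.
have ex D : exists E, feas_upto T D E /\ riesz E G < 0.
  apply: contrapT => h; apply: no; exists D => E EF.
  by rewrite leNgt; apply/negP => lt; apply: h; exists E.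
have [E_ EP] := boolp.choice ex.
(* Only the moments of low degree are known to be bounded. *)
pose E' D (m : mon) : R := if (mdeg m < D)%N then E_ D m else 0.
have E'b D : bounded_by 1 (E' D).
  move=> m; rewrite /E'; case: ifP => mD; last by rewrite normr0.
  by have [[<- EPD] _] := EP D; exact: (pos_moment Tq EPD).
have E'L D p : (msize p <= D)%N -> riesz (E' D) p = riesz (E_ D) p.
  move=> pD; rewrite !(rieszE _ (leqnn _)); apply: eq_bigr => m _.
  by rewrite /E' (leq_trans (bmdeg m) pD).
have Epm : pseudo_moments T (ulimf E').
  split.
  - have E'1 i : (1 <= i)%N -> E' i 0%MM = 1.
      by move=> i1; rewrite /E' mdeg0 i1; case: (EP i) => -[->].
    apply/eqP; rewrite eq_le; apply/andP; split.
      by apply: (omega_le (ulimf_cvg E'b 0%MM)); exists 1%N => // i /E'1 /= ->.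
    by apply: (omega_ge (ulimf_cvg E'b 0%MM)); exists 1%N => // i /E'1 /= ->.
  - move=> m; rewrite ler_norml; apply/andP; split.
      apply: (omega_ge (ulimf_cvg E'b m)); exists 0%N => // i _ /=.
      by have := E'b i m; rewrite ler_norml => /andP[].
    apply: (omega_le (ulimf_cvg E'b m)); exists 0%N => // i _ /=.
    by have := E'b i m; rewrite ler_norml => /andP[].
  - move=> D t Tt; apply: (omega_ge (riesz_cvg t E'b)).
    exists (maxn D (msize t)) => // i /=; rewrite geq_max => /andP[Di ti].
    rewrite E'L //; have [[_ EPi] _] := EP i.
    by apply: EPi; exact: gqm_mono Tt.
have [u uS Gu] := pseudo_moments_point Tq G Epm.
have L0 : riesz (ulimf E') G <= 0.
  apply: (omega_le (riesz_cvg G E'b)); exists (msize G) => // i /= Gi.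
  by rewrite E'L //; apply: ltW; have [] := EP i.
by have := le_trans (le_trans (Geta _ uS) Gu) L0; rewrite leNgt eta0.
Qed.

Lemma feas_sq D (E : mon -> R) h : feas_upto T D E -> (msize h <= D)%N -> 0 <= riesz E (h ^+ 2).
Proof. by move=> [_ EP]; exact: (pos_sq Tq EP). Qed.

Lemma feas_CS D (E : mon -> R) p q : feas_upto T D E -> (msize p <= D)%N -> (msize q <= D)%N ->
  riesz E (p * q) ^+ 2 <= riesz E (p ^+ 2) * riesz E (q ^+ 2).
Proof.
move=> EF pD qD; apply: riesz_CS => c; apply: feas_sq EF _.
apply: leq_trans (mmeasureD_le _ _ _) _; rewrite geq_max pD /=.
by apply: leq_trans (mmeasureZ_le _ _ _) _.
Qed.

(** The functional weighted by [h ^+ 2] is feasible to a slightly lower order once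
    it is normalized; if its mass is zero, it vanishes on low degrees. *)
Lemma putinar_weighted (G h : A) (eta : R) : 0 < eta ->
  (forall u, posset T u -> eta <= G.@[u]) ->
  exists D, forall E, feas_upto T D E -> 0 <= riesz E (G * h ^+ 2).
Proof.
move=> eta0 /(putinar eta0)[D HD]; pose D' := maxn D (msize G).
exists (D' + msize h)%N => E EF; pose W := weighted E (h ^+ 2).
have WP : pos_upto T D' W.
  move=> t Tt; rewrite riesz_weighted; apply: EF.2; exact: (gqm_mul Tq).
have W0 : W 0%MM = riesz E (h ^+ 2) by rewrite /W /weighted mpolyX0 mul1r.
have W0_ge : 0 <= W 0%MM by rewrite W0; apply: feas_sq EF _; rewrite leq_addl.
rewrite -riesz_weighted -/W.
have [W00|Wn0] := eqVneq (W 0%MM) 0.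
  rewrite (rieszE _ (leqnn _)) big1 // => m _.
  have mD : (mdeg m < D')%N by rewrite (leq_trans (bmdeg m)) // leq_maxr.
  have := pos_moment Tq WP mD; rewrite W00 normr_le0 => /eqP ->.
  by rewrite mulr0.
have LZ c p : riesz (fun m => c * W m) p = c * riesz W p.
  by rewrite /riesz mulr_sumr; apply: eq_bigr => m _; rewrite mulrCA.
have WF : feas_upto T D (fun m => (W 0%MM)^-1 * W m).
  split; first by rewrite mulVf.
  move=> t Tt; rewrite LZ mulr_ge0 ?invr_ge0 //; apply: WP.
  by apply: (gqm_mono Tq) Tt; rewrite leq_maxl.
by have := HD _ WF; rewrite LZ pmulr_rge0 // invr_gt0 lt0r Wn0.
Qed.

Lemma meval_horner_alg (f : A) (p : {poly R}) u : (horner_alg f p).@[u] = p.[f.@[u]].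
Proof.
elim/poly_ind: p => [|p c IH]; first by rewrite rmorph0 meval0 horner0.
have -> : horner_alg f (p * 'X + c%:P) = horner_alg f p * f + c%:MP.
  by rewrite rmorphD rmorphM /= horner_algX horner_algC alg_mpolyC.
by rewrite mevalD mevalM mevalC IH hornerMXaddC.
Qed.

Lemma horner_unit_bound (q : {poly R}) (y : R) : `|y| <= 1 ->
  `|q.[y]| <= \sum_(i < size q) `|q`_i|.
Proof.
move=> y1; rewrite horner_coef; apply: le_trans (ler_norm_sum _ _ _) _.
apply: ler_sum => i _; rewrite normrM ler_piMr // normrX.
by apply: exprn_ile1.
Qed.

(** Near zero the square is bounded below, away from zero the first term is. *)
Lemma separate_nonneg (q : {poly R}) : q.[0] != 0 ->
  exists2 eta, 0 < eta & forall y, 0 <= y -> eta <= y + q.[y] ^+ 2.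
Proof.
move=> q0; have [r qE] : exists r, q = r * 'X + (q.[0])%:P.
  have /factor_theorem[r rE] : root (q - (q.[0])%:P) 0.
    by rewrite rootE !hornerE subrr.
  by exists r; rewrite subr0 in rE; rewrite -rE subrK.
pose M := \sum_(i < size r) `|r`_i|; pose c := `|q.[0]|.
have c0 : 0 < c by rewrite normr_gt0.
have M0 : 0 <= M by apply: sumr_ge0.
(* On [0, dl] the polynomial [q] keeps half of its value at 0. *)
pose dl := Num.min 1 (c / 2 / (M + 1)).
have dl0 : 0 < dl by rewrite lt_min ltr01 /= !divr_gt0 // ltr_wpDl.
exists (Num.min dl ((c / 2) ^+ 2)).
  by rewrite lt_min dl0 exprn_gt0 // divr_gt0.
move=> y y0; have [yd|yd] := leP dl y.
  rewrite ge_min; apply/orP; left.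
  by apply: le_trans yd _; rewrite lerDl sqr_ge0.
rewrite ge_min; apply/orP; right.
have y1 : `|y| <= 1.
  by rewrite ger0_norm // ltW // (lt_le_trans yd) // ge_min lexx.
have yM : y * M <= c / 2.
  have : y <= c / 2 / (M + 1) by rewrite ltW // (lt_le_trans yd) // ge_min lexx orbT.
  by rewrite ler_pdivlMr ?ltr_wpDl // mulrDr mulr1; lra.
have ry := horner_unit_bound r y1.
have qy : c / 2 <= `|q.[y]|.
  rewrite qE !hornerE [_ + q.[0]]addrC.
  apply: le_trans _ (lerB_normD _ _); rewrite -/c normrM [`|y|]ger0_norm //.
  have : `|r.[y]| * y <= M * y by rewrite ler_wpM2r.
  rewrite mulrC in yM; lra.
apply: (@le_trans _ _ (q.[y] ^+ 2)); last by rewrite lerDr.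
rewrite -[q.[y] ^+ 2]real_normK ?num_real //.
by rewrite lerXn2r ?nnegrE // divr_ge0 // ltW.
Qed.

(** The order needed may depend on the multiplier [h]. *)
Definition annihilates (f : A) (r : {poly R}) := forall h : {poly R},
  exists D, forall E, feas_upto T D E -> riesz E (horner_alg f (r * h)) = 0.

Lemma annihilates_mul f r s : annihilates f r -> annihilates f (r * s).
Proof. by move=> fr h; have [D HD] := fr (s * h); exists D; rewrite -mulrA. Qed.

(** Cauchy-Schwarz with [r * s * h] and 1. *)
Lemma annihilates_sqrt f r s : annihilates f (r ^+ 2 * s) -> annihilates f (r * s).
Proof.
move=> fr h; have [D HD] := fr (s * h ^+ 2).
pose P := horner_alg f (r * s * h).
exists (maxn D (maxn (msize P) 1)) => E EF.
have DP : (msize P <= maxn D (maxn (msize P) 1))%N by rewrite !leq_max leqnn orbT.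
have D1 : (msize (1 : A) <= maxn D (maxn (msize P) 1))%N.
  by rewrite mmeasure1 !leq_max leqnn !orbT.
have := feas_CS EF DP D1; rewrite mulr1.
have -> : riesz E (P ^+ 2) = 0.
  rewrite -(HD E (feas_upto_le (leq_maxl _ _) EF)) /P -rmorphXn.
  by congr (riesz E (horner_alg f _)); ring.
rewrite mul0r => h0; apply/eqP.
by rewrite -sqrf_eq0 eq_le h0 sqr_ge0.
Qed.

Lemma annihilates_radical f e (q : {poly R}) : annihilates f ('X ^+ e * q) -> annihilates f ('X * q).
Proof.
have step s : annihilates f ('X ^+ (2 ^ s) * q) -> annihilates f ('X * q).
  elim: s => [|s IH]; first by rewrite expn0 expr1.
  by rewrite expnSr exprM => /annihilates_sqrt.
move=> fe; apply: (step e).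
have le : (e <= 2 ^ e)%N by apply: ltnW; exact: ltn_expl.
have -> : 'X ^+ (2 ^ e) * q = ('X ^+ e * q) * 'X ^+ (2 ^ e - e).
  by rewrite -[in LHS](subnKC le) exprD mulrAC.
exact: annihilates_mul.
Qed.

(** Write [p = X^e q] with [q(0) <> 0]; radicality reduces to [e = 1].  Modulo
    [X q] the polynomial [g = 1 - q / q(0)] is an idempotent, equal to 0 at the
    root 0 and to 1 at the others, so that [f] and [f g(f)^2] have the same value,
    and so has [(f + q(f)^2) g(f)^2] since [q g] is a multiple of [X q].  But
    [f + q(f)^2] is bounded below by a positive constant, even where [f = 0]. *)
Lemma finite_convergence (f : A) (p : {poly R}) : p != 0 -> annihilates f p ->
  (forall u, posset T u -> 0 <= f.@[u]) ->
  exists D, forall E, feas_upto T D E -> 0 <= riesz E f.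
Proof.
move=> p0 fp f_ge0.
have [q q0 pE] : exists2 q : {poly R}, q.[0] != 0 & exists e, p = 'X ^+ e * q.
  have [e [q]] := multiplicity_XsubC p 0; rewrite p0 /= => q0 ->.
  by exists q => //; exists e; rewrite subr0 mulrC.
case: pE => e pE; rewrite pE in fp; have {}fp := annihilates_radical fp.
pose c := q.[0]; pose g : {poly R} := 1 - c^-1 *: q.
have [r gE] : exists r, g = 'X * r.
  have /factor_theorem[r rE] : root g 0.
    by rewrite rootE /g !hornerE mulVf // subrr.
  by exists r; rewrite subr0 mulrC in rE.
have [eta eta0 Heta] := separate_nonneg q0.
pose G := horner_alg f ('X + q ^+ 2).
have GS u : posset T u -> eta <= G.@[u].
  by move=> /f_ge0 h; rewrite meval_horner_alg !hornerE; exact: Heta.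
have [D1 H1] := putinar_weighted (horner_alg f g) eta0 GS.
have [D2 H2] := fp (c^-1 *: (1 + g)).
have [D3 H3] := fp (q * 'X * r ^+ 2).
exists (maxn D1 (maxn D2 D3)) => E EF.
have {}H1 := H1 E (feas_upto_le (leq_maxl _ _) EF).
have {}H2 : riesz E _ = 0 := H2 E (feas_upto_le _ EF).
have {}H3 : riesz E _ = 0 := H3 E (feas_upto_le _ EF).
have -> : riesz E f = riesz E (G * horner_alg f g ^+ 2) +
    riesz E (horner_alg f ('X * q * (c^-1 *: (1 + g)))) -
    riesz E (horner_alg f ('X * q * (q * 'X * r ^+ 2))).
  rewrite -raddfD -raddfB /G -rmorphXn -rmorphM -rmorphD -rmorphB /=.
  rewrite -[in LHS](horner_algX f); congr (riesz E (horner_alg f _)).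
  have -> : 'X * q * (q * 'X * r ^+ 2) = q ^+ 2 * g ^+ 2 by rewrite gE; ring.
  have -> : 'X * q * (c^-1 *: (1 + g)) = 'X * (c^-1 *: q) * (1 + g).
    by rewrite -!mul_polyC; ring.
  have -> : c^-1 *: q = 1 - g by rewrite /g; ring.
  ring.
rewrite H2 ?H3 ?addr0 ?subr0 //; rewrite ?leq_max ?leqnn ?orbT //.
Qed.

End Certificates.

(** * Positive semidefinite matrices and the spectraplex *)

Section PSD.
Variable R : realType.

Definition bform m (A : 'M[R]_m) (v w : 'cV[R]_m) : R := (v^T *m A *m w) 0 0.

Lemma bformE m (A : 'M[R]_m) v w : bform A v w = \sum_i \sum_j v i 0 * w j 0 * A i j.
Proof.
rewrite /bform -mulmxA mxE; apply: eq_bigr => i _.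
rewrite !mxE mulr_sumr; apply: eq_bigr => j _; ring.
Qed.

Lemma bformC m (A : 'M[R]_m) v w : A^T = A -> bform A w v = bform A v w.
Proof.
move=> As; rewrite /bform.
have -> : w^T *m A *m v = (v^T *m A *m w)^T by rewrite !trmx_mul trmxK As mulmxA.
by rewrite mxE.
Qed.

Lemma bformDl m (A : 'M[R]_m) v w x c :
  bform A (v + c *: w) x = bform A v x + c * bform A w x.
Proof.
rewrite !bformE mulr_sumr -big_split; apply: eq_bigr => i _ /=.
rewrite mulr_sumr -big_split; apply: eq_bigr => j _ /=.
by rewrite !mxE; ring.
Qed.

Lemma bformDr m (A : 'M[R]_m) v w x c :
  bform A x (v + c *: w) = bform A x v + c * bform A x w.
Proof.
rewrite !bformE mulr_sumr -big_split; apply: eq_bigr => i _ /=.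
rewrite mulr_sumr -big_split; apply: eq_bigr => j _ /=.
by rewrite !mxE; ring.
Qed.

Lemma bform_mxD m (A B : 'M[R]_m) v w a b :
  bform (a *: A + b *: B) v w = a * bform A v w + b * bform B v w.
Proof.
rewrite !bformE !mulr_sumr -big_split; apply: eq_bigr => i _ /=.
rewrite !mulr_sumr -big_split; apply: eq_bigr => j _ /=.
by rewrite !mxE; ring.
Qed.

Lemma bform_delta m (A : 'M[R]_m) i w : bform A (delta_mx i 0) w = (A *m w) i 0.
Proof. by rewrite /bform trmx_delta -mulmxA -rowE mxE. Qed.

Lemma bform_deltas m (A : 'M[R]_m) i j : bform A (delta_mx i 0) (delta_mx j 0) = A i j.
Proof. by rewrite bform_delta -colE mxE. Qed.

Lemma psd_CS m (A : 'M[R]_m) v w : psd A -> bform A v w ^+ 2 <= bform A v v * bform A w w.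
Proof.
move=> [As Ap]; apply: quadratic_ge0 => c.
have : 0 <= bform A (v + c *: w) (v + c *: w) by exact: Ap.
rewrite !(bformDl, bformDr) (bformC _ _ As) => h.
by apply: le_trans h _; rewrite le_eqVlt; apply/orP; left; apply/eqP; ring.
Qed.

Lemma psd_diag m (A : 'M[R]_m) i : psd A -> 0 <= A i i.
Proof. by move=> [_ Ap]; rewrite -bform_deltas; exact: Ap. Qed.

Lemma psd_entry m (A : 'M[R]_m) i j : psd A -> A i j ^+ 2 <= A i i * A j j.
Proof.
by move=> Ap; have := psd_CS (delta_mx i 0) (delta_mx j 0) Ap; rewrite !bform_deltas.
Qed.

Lemma psd_ker m (A : 'M[R]_m) w : psd A -> bform A w w = 0 -> A *m w = 0.
Proof.
move=> Ap w0; apply/matrixP => i j; rewrite ord1 -bform_delta [RHS]mxE.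
have := psd_CS (delta_mx i 0) w Ap; rewrite w0 mulr0 => h.
by apply/eqP; rewrite -sqrf_eq0 eq_le h sqr_ge0.
Qed.

Lemma psd_tr0 m (A : 'M[R]_m) : psd A -> \tr A = 0 -> A = 0.
Proof.
move=> Ap /eqP; rewrite psumr_eq0 => [/allP d0|i _]; last exact: psd_diag.
have {}d0 i : A i i = 0 by apply/eqP; have := d0 i; rewrite mem_index_enum; apply.
apply/matrixP => i j; rewrite [RHS]mxE; have := psd_entry i j Ap.
by rewrite d0 mul0r => h; apply/eqP; rewrite -sqrf_eq0 eq_le h sqr_ge0.
Qed.

Lemma psd_rank1 m (v : 'cV[R]_m) : psd (v *m v^T).
Proof.
split; first by rewrite trmx_mul trmxK.
move=> w; have -> : w^T *m (v *m v^T) *m w = (v^T *m w)^T *m (v^T *m w).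
  by rewrite trmx_mul trmxK !mulmxA.
by rewrite mxE sumr_ge0 // => i _; rewrite !mxE; rewrite -expr2 sqr_ge0.
Qed.

Lemma psd_comb m (A B : 'M[R]_m) (a b : R) : 0 <= a -> 0 <= b -> psd A -> psd B ->
  psd (a *: A + b *: B).
Proof.
move=> a0 b0 [As Ap] [Bs Bp]; split; first by rewrite linearD /= !linearZ /= As Bs.
move=> v; rewrite -/(bform _ _ _) bform_mxD.
by rewrite addr_ge0 // mulr_ge0 //; [exact: Ap|exact: Bp].
Qed.

(** Schur complement: the rank one part carried by a column can be subtracted. *)
Lemma psd_deflate m (A : 'M[R]_m) j : psd A -> A j j != 0 ->
  psd (A - (A j j)^-1 *: (col j A *m (col j A)^T)).
Proof.
move=> Ap d0; have [As App] := Ap; have dp : 0 < A j j by rewrite lt0r d0 psd_diag.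
split; first by rewrite linearB /= linearZ /= trmx_mul trmxK As.
move=> v; rewrite -/(bform _ _ _) -[X in X - _]scale1r -scaleNr bform_mxD mul1r.
rewrite [X in _ + _ * X]/bform.
have cE : (v^T *m (col j A *m (col j A)^T) *m v) = ((v^T *m col j A) *m (v^T *m col j A)^T).
  by rewrite trmx_mul trmxK !mulmxA.
rewrite cE mxE big_ord1 [(_^T) _ _]mxE.
have -> : (v^T *m col j A) 0 0 = bform A v (delta_mx j 0) by rewrite /bform colE mulmxA.
rewrite mulNr subr_ge0 -expr2 ler_pdivrMl // mulrC -[X in _ * X]bform_deltas.
exact: psd_CS.
Qed.

End PSD.

Lemma meval_cvg (R : realType) (T : nat) (u_ : nat -> 'I_T -> R) B (p : {mpoly R[T]}) :
  (forall i, bounded_by B (u_ i)) ->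
  ((fun i => p.@[u_ i]) @ omega --> p.@[ulimf u_])%classic.
Proof.
move=> ub; elim/mpoly_alg_ind: p => [c|a|p q IHp IHq|p q IHp IHq].
- under eq_fun do rewrite mevalC.
  by rewrite mevalC; exact: cvg_cst.
- under eq_fun do rewrite mevalXU.
  by rewrite mevalXU; exact: (ulimf_cvg ub a).
- under eq_fun do rewrite mevalD.
  by rewrite mevalD; apply: cvgD.
- under eq_fun do rewrite mevalM.
  by rewrite mevalM; apply: cvgM.
Qed.

Arguments meval_cvg {R T u_ B} p _.

Section Spectraplex.
Variables (R : realType) (n : nat).
Hypothesis n_gt0 : (0 < n)%N.
Local Notation N := (sigma n).
Implicit Types u : 'I_N -> R.

Definition spectraplex : set ('I_N -> R) :=
  [set u | psd (symX u) /\ \tr (symX u) = 1]%classic.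

Lemma symX_surj (Y : 'M[R]_n) : Y^T = Y -> exists u, symX u = Y.
Proof.
move=> Ys; exists (fun a => Y (pidx a).1 (pidx a).2).
apply/matrixP => i j; rewrite mxE pidx_vidx; case: leqP => //= _.
by rewrite -[in RHS]Ys mxE.
Qed.

Lemma spectraplex_diag u i : spectraplex u -> 0 <= symX u i i <= 1.
Proof.
move=> [up ut]; rewrite psd_diag //= -ut /mxtrace (bigD1 i) //= lerDl.
by apply: sumr_ge0 => j _; exact: psd_diag.
Qed.

Lemma spectraplex_bounded u : spectraplex u -> bounded_by 1 u.
Proof.
move=> uK a; rewrite -[a]pidxK; set i := (pidx a).1; set j := (pidx a).2.
have -> : u (vidx i j) = symX u i j by rewrite mxE.
have [up _] := uK; have /andP[i0 i1] := spectraplex_diag i uK.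
have /andP[j0 j1] := spectraplex_diag j uK.
have h := psd_entry i j up.
rewrite -(@ler_pXn2r _ 2) ?nnegrE // real_normK ?num_real // expr1n.
apply: le_trans h _; nra.
Qed.

Lemma meval_tr_pX u : (\tr (pX R n)).@[u] = \tr (symX u).
Proof. by rewrite /mxtrace raddf_sum; apply: eq_bigr => i _; rewrite /= !mxE mevalXU. Qed.

Lemma meval_frob2 u : (frob2 R n).@[u] = \sum_i \sum_j symX u i j ^+ 2.
Proof.
rewrite /frob2 raddf_sum; apply: eq_bigr => i _; rewrite raddf_sum.
by apply: eq_bigr => j _ /=; rewrite rmorphXn /= !mxE mevalXU.
Qed.

Lemma spectraplex_frob u : spectraplex u -> n%:R^-1 <= (frob2 R n).@[u] <= 1.
Proof.
move=> uK; have [up ut] := uK; rewrite meval_frob2; apply/andP; split.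
  have nn : n%:R != 0 :> R by rewrite pnatr_eq0 -lt0n.
  apply: (@le_trans _ _ (\sum_i symX u i i ^+ 2)); last first.
    apply: ler_sum => i _; rewrite (bigD1 i) //= lerDl.
    by apply: sumr_ge0 => j _; exact: sqr_ge0.
  have : 0 <= \sum_i (symX u i i - n%:R^-1) ^+ 2.
    by apply: sumr_ge0 => j _; exact: sqr_ge0.
  have -> : \sum_i (symX u i i - n%:R^-1) ^+ 2 = \sum_i symX u i i ^+ 2 -
      (n%:R^-1 *+ 2) * \tr (symX u) + \sum_(i < n) n%:R^-2.
    rewrite /mxtrace mulr_sumr -sumrB -big_split; apply: eq_bigr => i _ /=.
    by field.
  rewrite ut mulr1 sumr_const card_ord -[n%:R^-2 *+ n]mulr_natr.
  have -> : n%:R^-2 * n%:R = n%:R^-1 :> R by field.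
  lra.
apply: (@le_trans _ _ (\sum_i \sum_j symX u i i * symX u j j)).
  by apply: ler_sum => i _; apply: ler_sum => j _; exact: psd_entry.
under eq_bigr do rewrite -mulr_sumr.
rewrite -mulr_suml; change (\tr (symX u) * \tr (symX u) <= 1).
by rewrite ut mulr1.
Qed.

Lemma spectraplex_normalize (Y : 'M[R]_n) : psd Y -> 0 < \tr Y ->
  exists2 u, spectraplex u & symX u = (\tr Y)^-1 *: Y.
Proof.
move=> Yp t0; have Zp : psd ((\tr Y)^-1 *: Y).
  have := psd_comb (a := (\tr Y)^-1) (b := 0) _ (lexx 0) Yp Yp.
  by rewrite scale0r addr0; apply; rewrite invr_ge0 ltW.
have [u uE] := symX_surj Zp.1.
exists u => //; rewrite /spectraplex /= uE; split=> //.
by rewrite mxtraceZ mulVf ?gt_eqF.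
Qed.

Lemma spectraplex_ne : (spectraplex !=set0)%classic.
Proof.
pose v : 'cV[R]_n := const_mx 1.
have vt : 0 < \tr (v *m v^T).
  rewrite /mxtrace (eq_bigr (fun=> 1)).
    by rewrite sumr_const card_ord ltr0n.
  by move=> i _; rewrite mxE big_ord1 !mxE mul1r.
by have [u uK _] := spectraplex_normalize (psd_rank1 v) vt; exists u.
Qed.

Lemma spectraplex_segment u w (s : R) : spectraplex u -> spectraplex w -> 0 <= s <= 1 ->
  spectraplex (fun a => u a + s * (w a - u a)).
Proof.
move=> [up ut] [wp wt] /andP[s0 s1].
have E : symX (fun a => u a + s * (w a - u a)) = (1 - s) *: symX u + s *: symX w.
  by apply/matrixP => i j; rewrite !mxE; ring.
split; rewrite E; first by apply: psd_comb => //; rewrite subr_ge0.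
by rewrite mxtraceD !mxtraceZ ut wt; ring.
Qed.

Lemma psd_symXP u : psd (symX u) <->
  forall v : 'I_n -> R, 0 <= (\sum_i \sum_j ((v i * v j)%:MP * pX R n i j)).@[u].
Proof.
have E v : (\sum_i \sum_j ((v i * v j)%:MP * pX R n i j)).@[u] =
    bform (symX u) (\col_i v i) (\col_i v i).
  rewrite bformE raddf_sum; apply: eq_bigr => i _; rewrite raddf_sum.
  by apply: eq_bigr => j _ /=; rewrite mevalM mevalC !mxE mevalXU.
split=> [[_ up] v|h]; first by rewrite E; exact: up.
split; first exact: symX_sym.
move=> v; have := h (fun i => v i 0); rewrite E.
suff -> : \col_i v i 0 = v by [].
by apply/matrixP => i j; rewrite mxE ord1.
Qed.

Lemma spectraplex_closed : uclosed spectraplex.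
Proof.
move=> u_ uK; have ub i := spectraplex_bounded (uK i).
split.
  apply/psd_symXP => v; apply: (omega_ge (meval_cvg _ ub)); exists 0%N => // i _ /=.
  by have [/psd_symXP h _] := uK i.
have c := meval_cvg (\tr (pX R n)) ub.
rewrite -meval_tr_pX; apply: (omega_unique c).
have -> : (fun i => (\tr (pX R n)).@[u_ i]) = (fun=> 1).
  by apply/funext => i; rewrite meval_tr_pX; case: (uK i).
exact: cvg_cst.
Qed.

Lemma spectraplex_min (gs : {mpoly R[N]} -> Prop) (p : {mpoly R[N]}) :
  (exists2 u, spectraplex u & forall g, gs g -> 0 <= g.@[u]) ->
  exists u, [/\ spectraplex u, forall g, gs g -> 0 <= g.@[u] &
    forall w, spectraplex w -> (forall g, gs g -> 0 <= g.@[w]) -> p.@[u] <= p.@[w]].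
Proof.
move=> [u0 u0K u0g].
have [u [[uK ug] umin]] := @min_attained R 'I_N 1
  [set u | spectraplex u /\ forall g, gs g -> 0 <= g.@[u]]%classic
  (fun u => p.@[u]) (ex_intro _ u0 (conj u0K u0g))
  (fun u h => spectraplex_bounded h.1)
  (fun (u_ : nat -> 'I_N -> R) h => conj (spectraplex_closed (fun i => (h i).1))
     (fun g gg => @omega_ge R 0 _ _ (meval_cvg g (fun i => spectraplex_bounded (h i).1))
         (ex_intro2 _ _ 0%N I (fun i _ => (h i).2 g gg))))
  (fun (u_ : nat -> 'I_N -> R) ub => meval_cvg p ub).
by exists u; split=> // w wK wg; apply: umin.
Qed.

End Spectraplex.

(** * Optimality conditions on the spectraplex *)

Section LineRestriction.
Variables (R : realType) (N : nat).
Local Notation A := {mpoly R[N]}.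

Definition line_poly (u h : 'I_N -> R) : {rmorphism A -> {poly R}} :=
  mmap (@polyC R) (fun a => (u a)%:P + h a *: 'X).

Lemma horner_line_poly u h f s : (line_poly u h f).[s] = f.@[fun a => u a + s * h a].
Proof.
elim/mpoly_alg_ind: f => [c|a|p q IHp IHq|p q IHp IHq].
- by rewrite /line_poly /= mmapC hornerC mevalC.
- by rewrite /line_poly /= mmapX mmap1U mevalXU !hornerE mulrC.
- by rewrite rmorphD hornerD IHp IHq mevalD.
- by rewrite rmorphM hornerM IHp IHq mevalM.
Qed.

Lemma deriv_line_poly u h f :
  (line_poly u h f)^`().[0] = \sum_a (mderiv a f).@[u] * h a.
Proof.
have at0 p : (line_poly u h p).[0] = p.@[u].
  by rewrite horner_line_poly; apply: meval_eq => a; rewrite mul0r addr0.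
rewrite (@der_chain N R R (meval u) (fun g => (line_poly u h g)^`().[0])).
- apply: eq_bigr => a _; congr (_ * _).
  by rewrite /line_poly /= mmapX mmap1U !derivE !hornerE.
- by move=> c; rewrite /line_poly /= mmapC derivC horner0.
- by move=> p q; rewrite rmorphD derivD hornerD.
- by move=> p q; rewrite rmorphM derivM hornerD !hornerM !at0.
Qed.

Lemma deriv_ge0_min (F : {poly R}) : (forall s, 0 < s <= 1 -> F.[0] <= F.[s]) ->
  0 <= F^`().[0].
Proof.
move=> Fmin.
have [G GE] : exists G, F = F.[0]%:P + 'X * (F^`().[0]%:P + 'X * G).
  have div (P : {poly R}) : exists Q, P = P.[0]%:P + 'X * Q.
    have /factor_theorem[Q QE] : root (P - P.[0]%:P) 0.
      by rewrite rootE !hornerE subrr.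
    by exists Q; rewrite subr0 in QE; rewrite mulrC -QE addrC subrK.
  have [Q QE] := div F; have [G GE] := div Q; exists G.
  have -> : F^`().[0] = Q.[0].
    by rewrite QE !derivE !hornerE.
  by rewrite -GE -QE.
rewrite leNgt; apply/negP => d0; set d1 := F^`().[0] in GE d0.
pose M := \sum_(i < size G) `|G`_i|.
have M0 : 0 <= M by apply: sumr_ge0.
(* A step so small that the quadratic remainder is beaten by the slope. *)
pose s := Num.min 1 (- d1 / 2 / (M + 1)).
have M1 : 0 < M + 1 by rewrite ltr_wpDl.
have s0 : 0 < s by rewrite lt_min ltr01 /= !divr_gt0 // oppr_gt0.
have s1 : s <= 1 by rewrite ge_min lexx.
have sM : s * M <= - d1 / 2.
  have : s <= - d1 / 2 / (M + 1) by rewrite ge_min lexx orbT.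
  by rewrite ler_pdivlMr // mulrDr mulr1; lra.
have := Fmin s; rewrite s0 s1 => /(_ isT).
rewrite [X in _ <= X.[s]]GE !hornerE lerDl pmulr_rge0 //.
have Gs : `|G.[s]| <= M by apply: horner_unit_bound; rewrite ger0_norm // ltW.
have : s * G.[s] <= s * M.
  by rewrite ler_wpM2l ?(ltW s0) //; apply: le_trans Gs; exact: ler_norm.
lra.
Qed.
End LineRestriction.

Section KKT.
Variables (R : realType) (n d : nat) (f : {mpoly R[sigma n]}).
Hypothesis f_homog : f \is d.-homog.
Variable u : 'I_(sigma n) -> R.
Hypothesis uK : spectraplex u.
Hypothesis u_min : forall w, spectraplex w -> f.@[u] <= f.@[w].

Let Th := map_mx (meval u) (Theta d f).

Let tr_ThE s : \tr (Th *m symX s) =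
  \sum_a (mderiv a f).@[u] * s a - (d%:R * f).@[u] * \tr (symX s).
Proof. exact: (tr_Theta d f (meval u)). Qed.

Let euler : \sum_a (mderiv a f).@[u] * u a = (d%:R * f).@[u].
Proof.
rewrite -(euler_homog f_homog) raddf_sum; apply: eq_bigr => a _ /=.
by rewrite mevalM mevalXU mulrC.
Qed.

Let tr_Th_ge0 w : spectraplex w -> 0 <= \tr (Th *m symX w).
Proof.
move=> wK; have [_ wt] := wK; rewrite tr_ThE wt mulr1 -euler -sumrB.
have := @deriv_ge0_min _ (line_poly u (fun a => w a - u a) f) _.
rewrite deriv_line_poly; under eq_bigr do rewrite mulrBr.
apply=> s /andP[s0 s1]; rewrite !horner_line_poly.
have -> : f.@[fun a => u a + 0 * (w a - u a)] = f.@[u].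
  by apply: meval_eq => a; rewrite mul0r addr0.
by apply: u_min; apply: spectraplex_segment => //; rewrite (ltW s0).
Qed.

Let tr_Th_psd Y : psd Y -> 0 <= \tr (Th *m Y).
Proof.
move=> Yp; have [t0|t0] := eqVneq (\tr Y) 0.
  by rewrite (psd_tr0 Yp t0) mulmx0 mxtrace0.
have tp : 0 < \tr Y.
  by rewrite lt0r t0 /=; apply: sumr_ge0 => i _; exact: psd_diag.
have [w wK wE] := spectraplex_normalize Yp tp.
have := tr_Th_ge0 wK; rewrite wE -scalemxAr mxtraceZ pmulr_rge0 //.
by rewrite invr_gt0.
Qed.

Lemma tr_rank1 m (A : 'M[R]_m) v : \tr (A *m (v *m v^T)) = bform A v v.
Proof.
by rewrite mulmxA mxtrace_mulC mulmxA /mxtrace big_ord1 /bform.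
Qed.

(** The derivative of [f] at [u] towards any point of the spectraplex is
    nonnegative, so [Theta] has nonnegative pairing with every positive
    semidefinite matrix, in particular with rank one matrices. *)
Lemma kkt_psd : psd Th.
Proof.
split; first by rewrite /Th map_trmx Theta_sym.
by move=> v; rewrite -/(bform _ _ _) -tr_rank1; apply/tr_Th_psd/psd_rank1.
Qed.

(** By Euler's identity [Theta] and [X] have pairing zero.  Subtracting from [X]
    the rank one part of a column leaves a positive semidefinite matrix, whose
    pairing with [Theta] is nonnegative; so [Theta] kills each column. *)
Lemma kkt_complementary : symX u *m Th = 0.
Proof.
have [up ut] := uK.
have trX : \tr (Th *m symX u) = 0 by rewrite tr_ThE euler ut mulr1 subrr.
suff ThX : Th *m symX u = 0.
  have := congr1 trmx ThX; rewrite trmx_mul trmx0 symX_sym.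
  by have [-> _] := kkt_psd.
apply/matrixP => i j.
have -> : (Th *m symX u) i j = (Th *m col j (symX u)) i 0.
  by rewrite !mxE; apply: eq_bigr => k _; rewrite !mxE.
suff -> : Th *m col j (symX u) = 0 by rewrite !mxE.
have [X0|X0] := eqVneq (symX u j j) 0.
  suff -> : col j (symX u) = 0 by rewrite mulmx0.
  apply/matrixP => k k'; rewrite [RHS]mxE [LHS]mxE.
  have := psd_entry k j up; rewrite X0 mulr0 => h.
  by apply/eqP; rewrite -sqrf_eq0 eq_le h sqr_ge0.
apply: (psd_ker kkt_psd); apply/eqP; rewrite eq_le.
have -> /= : 0 <= bform Th (col j (symX u)) (col j (symX u)) by exact: kkt_psd.2.
rewrite andbT; have := tr_Th_psd (psd_deflate up X0).
rewrite mulmxBr mxtraceD -scaleN1r mxtraceZ trX -scalemxAr mxtraceZ tr_rank1.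
rewrite add0r mulN1r oppr_ge0 pmulr_rle0 // invr_gt0 lt0r X0 /=.
exact: psd_diag.
Qed.

End KKT.

(** * Moment and localizing matrices as families of inequalities *)

Section MomentMatrices.
Variables (R : realType) (N : nat).
Local Notation A := {mpoly R[N]}.

Lemma mentryE r (z : mvec R N r) (m : 'X_{1..N < r.+1}) : mentry z m = z m.
Proof. by rewrite /mentry valK. Qed.

Lemma mentry_out r (z : mvec R N r) m : (r < mdeg m)%N -> mentry z m = 0.
Proof. by move=> h; rewrite /mentry insubF // ltnS leqNgt h. Qed.

(** The entries outside the truncation being 0, both sides agree even for
    polynomials of higher degree. *)
Lemma pairingE r (p : A) (z : mvec R N r) : pairing p z = riesz (mentry z) p.
Proof.
have lin : linear_for *%R (fun p : A => pairing p z).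
  move=> c p' q; rewrite /pairing mulr_sumr -big_split; apply: eq_bigr => m _ /=.
  by rewrite mcoeffD mcoeffZ mulrDl mulrA.
have pX m : pairing 'X_[m] z = mentry z m.
  rewrite /pairing; have [mr|mr] := leqP (mdeg m) r; last first.
    rewrite mentry_out // big1 // => m' _; rewrite mcoeffX.
    have [mm|_] := eqVneq m m'; last by rewrite mul0r.
    by have := bmdeg m'; rewrite -mm ltnS leqNgt mr.
  pose b := BMultinom (mr : (mdeg m < r.+1)%N).
  rewrite (bigD1 b) //= big1 => [|m' mm'].
    by rewrite mcoeffX eqxx mul1r addr0 -mentryE.
  rewrite mcoeffX; have [mE|_] := eqVneq m m'; last by rewrite mul0r.
  by case/eqP: mm'; apply: val_inj; rewrite /= -mE.
elim/mpolyind: p => [|c m p _ _ IH].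
  by rewrite raddf0 /pairing big1 // => m _; rewrite mcoeff0 mul0r.
by rewrite lin linearP /= IH pX rieszX.
Qed.

(** Vectors indexed by monomials are polynomials; a quadratic form in a localizing
    matrix is the value of the functional at a square. *)
Definition polyof t (v : 'cV[R]_(nmon N t)) : A :=
  \sum_a v a 0 *: 'X_[(enum_val a : 'X_{1..N < t.+1})].

Lemma polyof_size t (v : 'cV[R]_(nmon N t)) : (msize (polyof v) <= t.+1)%N.
Proof.
apply: leq_trans (mmeasure_sum _ _ _ _) _; apply/bigmax_leqP => a _.
apply: leq_trans (mmeasureZ_le _ _ _) _; rewrite mmeasureX.
exact: bmdeg.
Qed.

Lemma polyof_surj t (g : A) : (msize g <= t.+1)%N -> exists v : 'cV[R]_(nmon N t), polyof v = g.
Proof.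
move=> gt; exists (\col_a g@_(enum_val a : 'X_{1..N < t.+1})).
rewrite [RHS](mpolywE gt) /polyof.
rewrite [RHS](reindex (fun a : 'I_(nmon N t) => enum_val a : 'X_{1..N < t.+1})) /=.
  by apply: eq_bigr => a _; rewrite mxE.
by exists enum_rank => m _; [exact: enum_valK|exact: enum_rankK].
Qed.

Lemma momblockE r t (q : A) (z : mvec R N r) a b :
  momblock t q z a b = riesz (mentry z)
    (q * ('X_[(enum_val a : 'X_{1..N < t.+1})] * 'X_[(enum_val b : 'X_{1..N < t.+1})])).
Proof. by rewrite /momblock !mxE pairingE big_ord1 !mxE. Qed.

Lemma momblock_form r t (q : A) (z : mvec R N r) (v w : 'cV[R]_(nmon N t)) :
  bform (momblock t q z) v w = riesz (mentry z) (q * (polyof v * polyof w)).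
Proof.
rewrite bformE /polyof mulr_suml mulr_sumr raddf_sum; apply: eq_bigr => a _.
rewrite mulr_sumr mulr_sumr raddf_sum; apply: eq_bigr => b _ /=.
rewrite momblockE -rieszZ; congr (riesz _ _).
by rewrite -!mul_mpolyC mpolyCM; ring.
Qed.

Lemma momblock_sym r t (q : A) (z : mvec R N r) : (momblock t q z)^T = momblock t q z.
Proof. by apply/matrixP => a b; rewrite mxE !momblockE ['X_[enum_val b] * _]mulrC. Qed.

Lemma momblock_psdP r t (q : A) (z : mvec R N r) : psd (momblock t q z) <->
  forall g, (msize g <= t.+1)%N -> 0 <= riesz (mentry z) (q * g ^+ 2).
Proof.
split=> [[_ h] g /polyof_surj[v <-]|h].
  by have := h v; rewrite -/(bform _ _ _) momblock_form expr2.
split; first exact: momblock_sym.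
by move=> v; rewrite -/(bform _ _ _) momblock_form -expr2; apply: h; exact: polyof_size.
Qed.

Lemma momblock_eq0P r t (q : A) (z : mvec R N r) : momblock t q z = 0 <->
  forall g g', (msize g <= t.+1)%N -> (msize g' <= t.+1)%N ->
    riesz (mentry z) (q * (g * g')) = 0.
Proof.
split=> [h g g' /polyof_surj[v <-] /polyof_surj[w <-]|h].
  rewrite -momblock_form h bformE big1 // => i _; rewrite big1 // => j _.
  by rewrite mxE mulr0.
apply/matrixP => a b; rewrite momblockE [RHS]mxE; apply: h; rewrite msizeX; exact: bmdeg.
Qed.

Section Blocks.
Variables (n r t : nat) (T : 'M[A]_n) (z : mvec R N r).
Let M := \mxblock_(i < n, j < n) momblock t (T i j) z.

Lemma mxblock_form (v w : forall i : 'I_n, 'cV[R]_(nmon N t)) :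
  bform M (\mxcol_i v i) (\mxcol_i w i) =
  riesz (mentry z) (\sum_i \sum_j T i j * (polyof (v i) * polyof (w j))).
Proof.
rewrite /bform tr_mxcol /M mul_mxrow_mxblock mul_mxrow_mxcol.
under eq_bigr do rewrite mulmx_suml.
rewrite exchange_big summxE raddf_sum; apply: eq_bigr => i _ /=.
rewrite summxE raddf_sum; apply: eq_bigr => j _ /=.
by rewrite -/(bform _ _ _) momblock_form.
Qed.

Lemma mxblock_psdP : T^T = T -> psd M <->
  forall g : 'I_n -> A, (forall i, (msize (g i) <= t.+1)%N) ->
    0 <= riesz (mentry z) (\sum_i \sum_j T i j * (g i * g j)).
Proof.
move=> Ts; split=> [[_ h] g gt|h].
  have [v vE] := boolp.choice (fun i => polyof_surj (gt i)).
  have := h (\mxcol_i v i); rewrite -/(bform _ _ _) mxblock_form.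
  by under eq_bigr do under eq_bigr do rewrite !vE.
split.
  rewrite /M tr_mxblock; apply: eq_mxblock => i j.
  by rewrite momblock_sym -[in LHS]Ts mxE.
move=> v; rewrite -/(bform _ _ _) -(submxcolK v) mxblock_form.
by apply: h => i; exact: polyof_size.
Qed.

Lemma mxblock_eq0P : M = 0 <-> forall i j g g', (msize g <= t.+1)%N -> (msize g' <= t.+1)%N ->
    riesz (mentry z) (T i j * (g * g')) = 0.
Proof.
split=> [h i j|h].
  apply/momblock_eq0P; have := congr1 (fun B => submxblock B i j) h.
  by rewrite /M mxblockK submxblock0.
rewrite /M -mxblock0; apply: eq_mxblock => i j.
by apply/momblock_eq0P; exact: h.
Qed.
End Blocks.

End MomentMatrices.

(** * Degrees and the quadratic modules of the two programs *)

Section DegreeBounds.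
Variables (R : realType) (N : nat).
Local Notation A := {mpoly R[N]}.
Implicit Types p q g h : A.

Definition deg_le D p := (msize p <= D.+1)%N.

Lemma deg_leE p D : deg_le D p = (deg p <= D)%N.
Proof. by rewrite /deg_le /deg; case: (msize p). Qed.

Lemma deg_le_mono D D' p : (D <= D')%N -> deg_le D p -> deg_le D' p.
Proof. by move=> DD h; apply: leq_trans h _. Qed.

Lemma deg_leM D D' p q : deg_le D p -> deg_le D' q -> deg_le (D + D') (p * q).
Proof.
rewrite /deg_le => pD qD.
have [->|p0] := eqVneq p 0; first by rewrite mul0r mmeasure0.
have [->|q0] := eqVneq q 0; first by rewrite mulr0 mmeasure0.
rewrite msizeM // -subn1 leq_subLR; apply: leq_trans (leq_add pD qD) _.
by rewrite addSn addnS add1n.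
Qed.

Lemma deg_leD D p q : deg_le D p -> deg_le D q -> deg_le D (p + q).
Proof. by move=> pD qD; apply: leq_trans (mmeasureD_le _ _ _) _; rewrite geq_max; apply/andP. Qed.

Lemma deg_leN D p : deg_le D p -> deg_le D (- p).
Proof. by rewrite /deg_le mmeasureN. Qed.

Lemma deg_leC D c : deg_le D c%:MP.
Proof. by rewrite /deg_le mmeasureC; case: eqP. Qed.

Lemma deg_le1 D : deg_le D 1. Proof. by rewrite -mpolyC1; exact: deg_leC. Qed.

Lemma deg_leX D m : (mdeg m <= D)%N -> deg_le D 'X_[m].
Proof. by rewrite /deg_le msizeX. Qed.

Lemma deg_leZ D c p : deg_le D p -> deg_le D (c *: p).
Proof. by rewrite -mul_mpolyC; exact: deg_leM (deg_leC 0 c). Qed.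

Lemma deg_le_sum D (I : Type) (r : seq I) (P : pred I) (F : I -> A) :
  (forall i, P i -> deg_le D (F i)) -> deg_le D (\sum_(i <- r | P i) F i).
Proof.
move=> h; apply: (big_ind (fun p => deg_le D p)) => //.
  by rewrite -mpolyC0; exact: deg_leC.
by move=> p q; exact: deg_leD.
Qed.

Lemma deg_le_sqr D h : deg_le D h -> deg_le (2 * D) (h ^+ 2).
Proof. by move=> hD; rewrite expr2 mul2n -addnn; exact: deg_leM. Qed.

Lemma degmx_le n (T : 'M[A]_n) D : (forall i j, deg_le D (T i j)) -> (degmx T <= D)%N.
Proof.
by move=> h; apply/bigmax_leqP => i _; apply/bigmax_leqP => j _; rewrite -deg_leE.
Qed.

Lemma deg_le_degmx n (T : 'M[A]_n) i j : deg_le (degmx T) (T i j).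
Proof.
rewrite deg_leE /degmx; apply: leq_trans (leq_bigmax i).
exact: (leq_bigmax j).
Qed.

End DegreeBounds.

Section GeneratedModule.
Variables (R : realType) (N n : nat).
Local Notation A := {mpoly R[N]}.
Variables (Cs : 'M[A]_n -> Prop) (Es : A -> Prop).

(** In [gen_ball] the factor has degree less than [D], two degrees being taken by
    the ball; constants are admitted for [D = 0], as a graded module asks. *)
Inductive gen_qmodule (D : nat) : A -> Prop :=
  | gen_sq h : deg_le D h -> gen_qmodule D (h ^+ 2)
  | gen_ball a h : (msize h <= maxn D 1)%N -> gen_qmodule D ((1 - 'X_a ^+ 2) * h ^+ 2)
  | gen_mx M (g : 'I_n -> A) : Cs M -> (forall i, deg_le D (g i)) ->
      gen_qmodule D (\sum_i \sum_j M i j * (g i * g j))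
  | gen_eq p g g' : Es p -> deg_le D g -> deg_le D g' -> gen_qmodule D (p * (g * g')).

Lemma deg_leM_size D (g h : A) : deg_le D g -> deg_le (D + msize h) (g * h).
Proof. by move=> gD; apply: deg_leM => //; rewrite /deg_le. Qed.

Lemma gen_qmodule_graded : graded_qmodule gen_qmodule.
Proof.
split.
- move=> D D' t DD [h hD|a h hD|M g CM gD|p g g' Ep gD gD'].
  + by apply: gen_sq; exact: deg_le_mono hD.
  + by apply: gen_ball; apply: leq_trans hD _; rewrite geq_max !leq_max DD leqnn orbT.
  + by apply: gen_mx => // i; exact: deg_le_mono (gD i).
  + by apply: gen_eq => //; [exact: deg_le_mono gD|exact: deg_le_mono gD'].
- move=> D t h' [h hD|a h hD|M g CM gD|p g g' Ep gD gD'].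
  + by rewrite -exprMn; apply: gen_sq; exact: deg_leM_size.
  + rewrite -mulrA -exprMn; apply: gen_ball.
    have [->|h0] := eqVneq h 0; first by rewrite mul0r mmeasure0.
    have [->|h'0] := eqVneq h' 0; first by rewrite mulr0 mmeasure0.
    rewrite msizeM // -subn1 leq_subLR add1n; apply: (leq_trans (leq_add hD (leqnn _))).
    by set s := msize h'; lia.
  + rewrite mulr_suml.
    rewrite (eq_bigr (fun i => \sum_j M i j * ((g i * h') * (g j * h')))).
      by apply: gen_mx => // i; exact: deg_leM_size.
    move=> i _; rewrite mulr_suml; apply: eq_bigr => j _; ring.
  + have -> : p * (g * g') * h' ^+ 2 = p * ((g * h') * (g' * h')) by ring.
    by apply: gen_eq => //; exact: deg_leM_size.
- by rewrite -[1](expr1n _ 2); apply: gen_sq; exact: deg_le1.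
- move=> a; rewrite -[X in gen_qmodule _ X]mulr1 -[X in _ * X](expr1n _ 2).
  by apply: gen_ball; rewrite mmeasure1.
Qed.

Lemma gen_posset_mx u M : posset gen_qmodule u -> Cs M ->
  forall v : 'I_n -> R, 0 <= \sum_i \sum_j v i * v j * (M i j).@[u].
Proof.
move=> uP CM v; have := uP 0 _ (gen_mx (g := fun i => (v i)%:MP) CM (fun i => deg_leC _ 0 (v i))).
rewrite raddf_sum; under eq_bigr do rewrite raddf_sum /=.
by under eq_bigr do under eq_bigr do rewrite !mevalM !mevalC mulrC.
Qed.

Lemma gen_posset_eq u p : posset gen_qmodule u -> Es p -> p.@[u] = 0.
Proof.
move=> uP Ep; apply/eqP; rewrite eq_le; apply/andP; split.
  have := uP 0 _ (gen_eq Ep (deg_leC _ 0 (-1)) (deg_le1 _ _ 0)).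
  by rewrite mulr1 mevalM mevalC mulrN1 oppr_ge0.
have := uP 0 _ (gen_eq Ep (deg_le1 _ _ 0) (deg_le1 _ _ 0)).
by rewrite !mulr1.
Qed.

Lemma gen_feas_eq D E p g : feas_upto gen_qmodule D E -> Es p -> deg_le D g ->
  riesz E (p * g) = 0.
Proof.
move=> [_ EP] Ep gD; apply/eqP; rewrite eq_le; apply/andP; split.
  have := EP _ (gen_eq Ep (deg_leN gD) (deg_le1 _ _ D)).
  by rewrite mulr1 mulrN raddfN /= oppr_ge0.
by have := EP _ (gen_eq Ep gD (deg_le1 _ _ D)); rewrite mulr1.
Qed.

End GeneratedModule.

Section Degrees.
Variables (R : realType) (n d : nat) (f : {mpoly R[sigma n]}).
Hypothesis f_homog : f \is d.-homog.
Local Notation N := (sigma n).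
Local Notation A := {mpoly R[N]}.

Lemma deg_le_homog : deg_le d f.
Proof.
rewrite /deg_le msizeE; apply/bigmax_leqP_seq => m mf _.
by move/dhomogP: f_homog => ->.
Qed.

Lemma deg_le_deriv a : deg_le d (mderiv a f).
Proof.
rewrite /deg_le msizeE; apply/bigmax_leqP_seq => m; rewrite mcoeff_msupp mcoeff_deriv => m0 _.
have mf : (m + U_(a))%MM \in msupp f.
  by rewrite mcoeff_msupp; apply: contraNneq m0 => ->; rewrite mul0rn.
move/dhomogP: f_homog => /(_ _ mf); rewrite /= mdegD mdeg1 => <-.
by rewrite addn1 ltnW.
Qed.

Lemma deg_le_pX i j : deg_le 1 (pX R n i j).
Proof. by rewrite mxE; apply: deg_leX; rewrite mdeg1. Qed.

Lemma deg_le_tr : deg_le 1 (\tr (pX R n) - 1).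
Proof.
apply: deg_leD; last by apply: deg_leN; exact: deg_le1.
by apply: deg_le_sum => i _; exact: deg_le_pX.
Qed.

Lemma deg_le_frob2 : deg_le 2 (frob2 R n).
Proof.
apply: deg_le_sum => i _; apply: deg_le_sum => j _.
by apply: (@deg_le_sqr _ _ 1); exact: deg_le_pX.
Qed.

Lemma deg_le_Theta i j : deg_le d (Theta d f i j).
Proof.
rewrite mxE; case: ifP => _; last by apply: deg_leZ; exact: deg_le_deriv.
apply: deg_leD; first exact: deg_le_deriv.
by apply: deg_leN; apply: deg_leZ; exact: deg_le_homog.
Qed.

Lemma deg_le_XTheta i j : deg_le d.+1 ((pX R n *m Theta d f) i j).
Proof.
rewrite mxE; apply: deg_le_sum => k _; rewrite -add1n.
by apply: deg_leM; [exact: deg_le_pX|exact: deg_le_Theta].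
Qed.

Lemma deg_le_genpoly (xi : mvec R N d) : deg_le d (genpoly xi).
Proof.
by apply: deg_le_sum => m _; apply: deg_leZ; apply: deg_leX; rewrite -ltnS bmdeg.
Qed.

End Degrees.

(** * Moments of points, and bounds for feasible moments *)

Section PointMoments.
Variables (R : realType) (N : nat).
Local Notation A := {mpoly R[N]}.

Definition point_moments r (u : 'I_N -> R) : mvec R N r := [ffun b : 'X_{1..N < r.+1} => ('X_[b] : A).@[u]].

Lemma riesz_point r u (p : A) : deg_le r p -> riesz (mentry (point_moments r u)) p = p.@[u].
Proof.
move=> pr; rewrite (rieszE _ pr) [in RHS](mpolywE pr) raddf_sum; apply: eq_bigr => m _ /=.
by rewrite mevalZ mentryE ffunE.
Qed.

Lemma deg_le_locmx q t k (g g' : A) : (uphalf (deg q) <= k)%N -> t = (k - uphalf (deg q))%N ->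
  deg_le t g -> deg_le t g' -> deg_le (2 * k) (q * (g * g')).
Proof.
move=> qk -> gt gt'; apply: (@deg_le_mono _ _ (deg q + ((k - uphalf (deg q)) + (k - uphalf (deg q))))).
  have : (deg q <= uphalf (deg q) + uphalf (deg q))%N.
    by rewrite addnn uphalfE -{1}[deg q]odd_double_half; lia.
  lia.
by apply: deg_leM; [rewrite deg_leE|exact: deg_leM].
Qed.

Lemma point_locmx_psd k q u : (uphalf (deg q) <= k)%N -> 0 <= q.@[u] ->
  psd (locmx (k := k) q (point_moments (2 * k) u)).
Proof.
move=> qk q0; apply/momblock_psdP => g gt; rewrite riesz_point.
  by rewrite mevalM rmorphXn /= mulr_ge0 // sqr_ge0.
by rewrite expr2; exact: (deg_le_locmx qk erefl gt gt).
Qed.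

Lemma point_locmx_eq0 k q u : (uphalf (deg q) <= k)%N -> q.@[u] = 0 ->
  locmx (k := k) q (point_moments (2 * k) u) = 0.
Proof.
move=> qk q0; apply/momblock_eq0P => g g' gt gt'; rewrite riesz_point.
  by rewrite mevalM q0 mul0r.
exact: (deg_le_locmx qk erefl gt gt').
Qed.

Lemma deg_le_locmxM n (T : 'M[A]_n) k i j (g g' : A) : (uphalf (degmx T) <= k)%N ->
  deg_le (k - uphalf (degmx T)) g -> deg_le (k - uphalf (degmx T)) g' ->
  deg_le (2 * k) (T i j * (g * g')).
Proof.
move=> qk gt gt'.
apply: (@deg_le_mono _ _ (degmx T + ((k - uphalf (degmx T)) + (k - uphalf (degmx T))))).
  have : (degmx T <= uphalf (degmx T) + uphalf (degmx T))%N.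
    by rewrite addnn uphalfE -{1}[degmx T]odd_double_half; lia.
  lia.
by apply: deg_leM; [exact: deg_le_degmx|exact: deg_leM].
Qed.

Lemma point_locmxM_psd n k (T : 'M[A]_n) u : (uphalf (degmx T) <= k)%N -> T^T = T ->
  psd (map_mx (meval u) T) -> psd (locmxM (k := k) T (point_moments (2 * k) u)).
Proof.
move=> qk Ts [_ Tp]; apply/mxblock_psdP => // g gt.
have -> : riesz (mentry (point_moments (2 * k) u)) (\sum_i \sum_j T i j * (g i * g j)) =
    bform (map_mx (meval u) T) (\col_i (g i).@[u]) (\col_i (g i).@[u]).
  rewrite raddf_sum bformE; apply: eq_bigr => i _; rewrite raddf_sum; apply: eq_bigr => j _ /=.
  rewrite riesz_point; first by rewrite !mevalM !mxE mulrC.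
  exact: (deg_le_locmxM i j qk (gt i) (gt j)).
exact: Tp.
Qed.

Lemma point_locmxM_eq0 n k (T : 'M[A]_n) u : (uphalf (degmx T) <= k)%N ->
  map_mx (meval u) T = 0 -> locmxM (k := k) T (point_moments (2 * k) u) = 0.
Proof.
move=> qk T0; apply/mxblock_eq0P => i j g g' gt gt'; rewrite riesz_point.
  by have := congr1 (fun M : 'M_n => M i j) T0; rewrite !mxE mevalM => ->; rewrite mul0r.
exact: (deg_le_locmxM i j qk gt gt').
Qed.

End PointMoments.

Section MomentBounds.
Variables (R : realType) (n k : nat).
Local Notation N := (sigma n).
Local Notation A := {mpoly R[N]}.
Hypothesis k_gt0 : (0 < k)%N.

Lemma deg_ball : deg_le 2 (1 - frob2 R n).
Proof. by apply: deg_leD; [exact: deg_le1|apply: deg_leN; exact: deg_le_frob2]. Qed.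

Lemma deg_outer : deg_le 2 (frob2 R n - (n%:R^-1)%:MP).
Proof. by apply: deg_leD; [exact: deg_le_frob2|apply: deg_leN; exact: deg_leC]. Qed.

(** Used to write a monomial of degree at most [2 k] as a product of two monomials
    of degree at most [k], to which positivity of squares applies. *)
Lemma split_monomial (m : 'X_{1..N}) j : (j <= mdeg m)%N ->
  exists m1 m2, m = (m1 + m2)%MM /\ mdeg m1 = j.
Proof.
elim: j => [|j IH] jm; first by exists 0%MM, m; rewrite add0m mdeg0.
have [m1 [m2 [mE m1j]]] := IH (ltnW jm).
have m20 : m2 != 0%MM.
  by rewrite -mdeg_eq0 -lt0n; move: jm; rewrite mE mdegD m1j; lia.
have /existsP[a ma] : [exists a, m2 a != 0%N].
  apply: contraT => /existsPn h; case/eqP: m20; apply/mnmP => a.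
  by rewrite mnm0E; have := h a; rewrite negbK => /eqP.
exists (m1 + U_(a))%MM, (m2 - U_(a))%MM; rewrite mdegD mdeg1 m1j addn1; split=> //.
by rewrite mE -addmA [(U_(a) + _)%MM]addmC submK // lep1mP.
Qed.

Definition ball_module := @gen_qmodule R N n (fun=> False) (fun=> False).

(** The Frobenius norm is ['X_a ^+ 2] plus squares, so positivity on the ball in
    this norm gives positivity for each single variable. *)
Lemma ball_module_feas (z : mvec R N (2 * k)) : psd (locmx (1 - frob2 R n) z) ->
  pairing 1 z = 1 -> psd (mommx z) -> feas_upto ball_module k (mentry z).
Proof.
move=> /momblock_psdP zb z1 /momblock_psdP zm.
have zm' h : deg_le k h -> 0 <= riesz (mentry z) (h ^+ 2).
  move=> hk; rewrite -[h ^+ 2]mul1r; apply: zm.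
  have -> : deg (1 : A) = 0%N by rewrite /deg mmeasure1.
  by rewrite uphalfE subn0.
have kb : (k.-1 <= k - uphalf (deg (1 - frob2 R n)))%N.
  by have := deg_ball; rewrite deg_leE !uphalfE; lia.
split; first by rewrite -riesz1 -pairingE.
move=> t [h hk|a h hk|//|//]; first exact: zm'.
have hk' : deg_le k.-1 h.
  by rewrite /deg_le prednK //; apply: leq_trans hk _; rewrite geq_max leqnn k_gt0.
have frE : frob2 R n = 'X_a ^+ 2 + (\sum_(p : 'I_n * 'I_n | p != pidx a) pX R n p.1 p.2 ^+ 2).
  rewrite /frob2 pair_big /= (bigD1 (pidx a)) //=.
  by congr (_ ^+ 2 + _); rewrite mxE pidxK.
have -> : (1 - 'X_a ^+ 2) * h ^+ 2 = (1 - frob2 R n) * h ^+ 2 +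
    \sum_(p : 'I_n * 'I_n | p != pidx a) (pX R n p.1 p.2 * h) ^+ 2.
  have -> : \sum_(p : 'I_n * 'I_n | p != pidx a) (pX R n p.1 p.2 * h) ^+ 2 =
    (\sum_(p : 'I_n * 'I_n | p != pidx a) pX R n p.1 p.2 ^+ 2) * h ^+ 2.
    by rewrite mulr_suml; apply: eq_bigr => p _; rewrite exprMn.
  rewrite frE; ring.
rewrite raddfD /=; apply: addr_ge0.
  by apply: zb; apply: deg_le_mono hk'.
rewrite raddf_sum; apply: sumr_ge0 => p _; apply: zm'.
by rewrite -(prednK k_gt0) -add1n; apply: deg_leM => //; exact: deg_le_pX.
Qed.

Lemma moments_bounded (z : mvec R N (2 * k)) : psd (locmx (1 - frob2 R n) z) ->
  pairing 1 z = 1 -> psd (mommx z) -> bounded_by 1 (mentry z).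
Proof.
move=> z1 z2 z3; have zF := ball_module_feas z1 z2 z3; have [z0 zP] := zF.
have Tq : graded_qmodule ball_module by exact: gen_qmodule_graded.
move=> m; have [mk|mk] := leqP (mdeg m) (2 * k); last by rewrite mentry_out // normr0.
have [m1 [m2 [-> [m1k m2k]]]] : exists m1 m2, m = (m1 + m2)%MM /\ (mdeg m1 <= k /\ mdeg m2 <= k)%N.
  have [m1 [m2 [mE m1k]]] := split_monomial (geq_minr k (mdeg m)).
  exists m1, m2; split=> //; move: mk m1k; rewrite mE mdegD; lia.
have e1 := pos_even_moment Tq zP m1k; have e2 := pos_even_moment Tq zP m2k.
have sq c : 0 <= riesz (mentry z) (('X_[m1] + c *: 'X_[m2]) ^+ 2).
  by apply: zP; apply: gen_sq; apply: deg_leD; [|apply: deg_leZ]; exact: deg_leX.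
have := sq 1; have := sq (-1).
rewrite !riesz_sqD !mpolyXn -!mpolyXD !rieszX.
have ee (m' : 'X_{1..N}) : (m' *+ 2 = m' + m')%MM by rewrite mulmS mulm1n.
rewrite !ee; rewrite z0 in e1 e2 => h1 h2.
by rewrite ler_norml; apply/andP; split; lra.
Qed.

End MomentBounds.

Section Relaxation.
Variables (R : realType) (n d : nat) (f : {mpoly R[sigma n]}).
Hypothesis n_gt0 : (0 < n)%N.
Hypothesis f_homog : f \is d.-homog.
Local Notation N := (sigma n).
Local Notation A := {mpoly R[N]}.
Local Notation k0 := (uphalf d.+1).

Lemma pX_sym : (pX R n)^T = pX R n. Proof. exact: symX_sym. Qed.

Lemma leq_uphalf_trans (e D k : nat) : (e <= D)%N -> (uphalf D <= k)%N -> (uphalf e <= k)%N.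
Proof. by rewrite !uphalfE; lia. Qed.

Lemma map_pX_meval u : map_mx (meval u) (pX R n) = symX u.
Proof.
rewrite (map_pX (meval u)); apply/matrixP => i j.
by rewrite mxE [RHS]mxE; exact: mevalXU.
Qed.

Section Order.
Variable k : nat.
Hypothesis k_ge : (k0 <= k)%N.

Let k_gt0 : (0 < k)%N. Proof. by move: k_ge; rewrite uphalfE; lia. Qed.
Let up2 (e : nat) : (e <= 2)%N -> (uphalf e <= k)%N.
Proof. by move=> h; apply: leq_uphalf_trans h _. Qed.
Let upd (e : nat) : (e <= d.+1)%N -> (uphalf e <= k)%N.
Proof. by move=> h; apply: leq_uphalf_trans h _. Qed.

Lemma point_common u : spectraplex u -> let z := point_moments (2 * k) u in
  [/\ locmx (\tr (pX R n) - 1) z = 0, psd (locmxM (pX R n) z) &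
   [/\ psd (locmx (1 - frob2 R n) z), psd (locmx (frob2 R n - (n%:R^-1)%:MP) z),
       pairing 1 z = 1 & psd (mommx z)]].
Proof.
move=> uK z; have [up ut] := uK; have /andP[fr1 fr2] := spectraplex_frob n_gt0 uK.
split; [| |split].
- apply: point_locmx_eq0.
    by apply: up2; rewrite -deg_leE; apply: deg_le_mono (deg_le_tr _ _).
  by rewrite mevalB meval_tr_pX meval1 ut subrr.
- apply: point_locmxM_psd.
  + by apply: up2; apply: leq_trans (degmx_le (@deg_le_pX R n)) _.
  + exact: pX_sym.
  + by rewrite map_pX_meval.
- apply: point_locmx_psd; first by apply: up2; rewrite -deg_leE; exact: deg_ball.
  by rewrite mevalB meval1 subr_ge0.
- apply: point_locmx_psd; first by apply: up2; rewrite -deg_leE; exact: deg_outer.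
  by rewrite mevalB mevalC subr_ge0.
- by rewrite pairingE riesz_point ?meval1 //; exact: deg_le1.
- apply: point_locmx_psd; first by apply: up2; rewrite -deg_leE; exact: deg_le1.
  by rewrite meval1.
Qed.

(** The optimality conditions make the moments of a minimizer feasible. *)
Lemma point_feas_mom u : spectraplex u -> (forall w, spectraplex w -> f.@[u] <= f.@[w]) ->
  feas_mom d f k (point_moments (2 * k) u).
Proof.
move=> uK umin; have [h1 h2 [h3 h4 h5 h6]] := point_common uK.
split; split=> //.
- apply: point_locmxM_eq0.
    by apply: upd; apply: degmx_le; exact: deg_le_XTheta.
  by rewrite map_mxM map_pX_meval (kkt_complementary f_homog uK umin).
- apply: point_locmxM_psd.
  + by apply: upd; apply: leqW; apply: degmx_le; exact: deg_le_Theta.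
  + exact: Theta_sym.
  + exact: (kkt_psd f_homog uK umin).
Qed.

Lemma point_feas_step2 v u : spectraplex u -> f.@[u] <= v ->
  feas_step2 f k v (point_moments (2 * k) u).
Proof.
move=> uK uv; have [h1 h2 [h3 h4 h5 h6]] := point_common uK.
split; split=> //; apply: point_locmx_psd; last by rewrite mevalB mevalC subr_ge0.
apply: upd; apply: leqW; rewrite -deg_leE; apply: deg_leD; first exact: deg_leC.
by apply: deg_leN; exact: deg_le_homog.
Qed.

End Order.
End Relaxation.

(** * Exactness of the moment relaxation *)

Section Convergence.
Variables (R : realType) (n d : nat) (f : {mpoly R[sigma n]}).
Hypothesis f_homog : f \is d.-homog.
Local Notation N := (sigma n).
Local Notation A := {mpoly R[N]}.
Local Notation k0 := (uphalf d.+1).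

Definition moment_module := @gen_qmodule R N n (fun M => M = pX R n)
  (fun p => p = \tr (pX R n) - 1 \/ exists i j, p = (pX R n *m Theta d f) i j).

Definition step2_module (v : R) := @gen_qmodule R N n
  (fun M => M = pX R n \/ M = (v%:MP - f)%:M) (fun p => p = \tr (pX R n) - 1).

Lemma uphalf_sub (e D k : nat) : (e <= d.+1)%N -> (k0 + D <= k)%N -> (D <= k - uphalf e)%N.
Proof. by rewrite !uphalfE; lia. Qed.

Section AtOrder.
Variables (k D : nat).
Hypothesis kD : (k0 + D <= k)%N.

Let k_ge : (k0 <= k)%N. Proof. by move: kD; lia. Qed.
Let k_gt0 : (0 < k)%N. Proof. by move: k_ge; rewrite uphalfE; lia. Qed.
Let Dk : (D <= k)%N. Proof. by move: kD; lia. Qed.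
Let sub1 (e : nat) : (e <= d.+1)%N -> (D <= k - uphalf e)%N.
Proof. by move=> h; exact: uphalf_sub. Qed.

Lemma moment_module_feas (z : mvec R N (2 * k)) :
  feas_mom d f k z -> feas_upto moment_module D (mentry z).
Proof.
move=> [[ztr zXT zX _] [zb _ z1 zm]].
have [z0 zP] := ball_module_feas k_gt0 zb z1 zm.
split=> // t [h hD|a h hD|M g -> gD|p g g' Ep gD gD'].
- by apply: zP; apply: gen_sq; exact: deg_le_mono hD.
- by apply: zP; apply: gen_ball; apply: leq_trans hD _; move: Dk; lia.
- move/(mxblock_psdP _ _ (pX_sym R n)): zX; apply=> i; apply: deg_le_mono (gD i).
  by apply: sub1; apply: leq_trans (degmx_le (@deg_le_pX R n)) _.
- case: Ep => [->|[i [j ->]]].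
    move/momblock_eq0P: ztr => -> //.
      apply: deg_le_mono gD; apply: sub1; rewrite -deg_leE.
      by apply: deg_le_mono (deg_le_tr _ _).
    apply: deg_le_mono gD'; apply: sub1; rewrite -deg_leE.
    by apply: deg_le_mono (deg_le_tr _ _).
  have XT : (D <= k - uphalf (degmx (pX R n *m Theta d f)))%N.
    by apply: sub1; apply: degmx_le; exact: deg_le_XTheta.
  by move/mxblock_eq0P: zXT => ->  //; [exact: deg_le_mono gD|exact: deg_le_mono gD'].
Qed.

Lemma step2_module_feas v (z : mvec R N (2 * k)) :
  feas_step2 f k v z -> feas_upto (step2_module v) D (mentry z).
Proof.
move=> [[ztr zX zv] [zb _ z1 zm]].
have [z0 zP] := ball_module_feas k_gt0 zb z1 zm.
split=> // t [h hD|a h hD|M g CM gD|p g g' -> gD gD'].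
- by apply: zP; apply: gen_sq; exact: deg_le_mono hD.
- by apply: zP; apply: gen_ball; apply: leq_trans hD _; move: Dk; lia.
- case: CM => ->.
    move/(mxblock_psdP _ _ (pX_sym R n)): zX; apply=> i; apply: deg_le_mono (gD i).
    by apply: sub1; apply: leq_trans (degmx_le (@deg_le_pX R n)) _.
  have -> : \sum_i \sum_j (v%:MP - f)%:M i j * (g i * g j) =
            \sum_i (v%:MP - f) * (g i) ^+ 2.
    apply: eq_bigr => i _; rewrite (bigD1 i) //= big1 => [|j ji].
      by rewrite mxE eqxx mulr1n addr0 expr2.
    by rewrite mxE eq_sym (negPf ji) mulr0n mul0r.
  rewrite raddf_sum; apply: sumr_ge0 => i _.
  move/momblock_psdP: zv; apply; apply: deg_le_mono (gD i); apply: sub1; apply: leqW.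
  rewrite -deg_leE; apply: deg_leD; first exact: deg_leC.
  by apply: deg_leN; exact: deg_le_homog.
- move/momblock_eq0P: ztr => -> //.
    apply: deg_le_mono gD; apply: sub1; rewrite -deg_leE.
    by apply: deg_le_mono (deg_le_tr _ _).
  apply: deg_le_mono gD'; apply: sub1; rewrite -deg_leE.
  by apply: deg_le_mono (deg_le_tr _ _).
Qed.
End AtOrder.

Lemma posset_spectraplex (Cs : 'M[A]_n -> Prop) (Es : A -> Prop) u :
  Cs (pX R n) -> Es (\tr (pX R n) - 1) -> posset (gen_qmodule Cs Es) u -> spectraplex u.
Proof.
move=> CX Etr uS; split.
  apply/psd_symXP => v; have := gen_posset_mx uS CX v.
  rewrite raddf_sum; under [in X in _ -> X]eq_bigr do rewrite raddf_sum /=.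
  by under [in X in _ -> X]eq_bigr do under eq_bigr do rewrite mevalM mevalC.
have := gen_posset_eq uS Etr.
by rewrite mevalB meval_tr_pX meval1 => /eqP; rewrite subr_eq0 => /eqP.
Qed.

Lemma horner_alg_shift c (p : {poly R}) : horner_alg (f - c%:MP) (p \Po ('X + c%:P)) = horner_alg f p.
Proof.
elim/poly_ind: p => [|p b IH]; first by rewrite comp_poly0 !rmorph0.
rewrite comp_poly_MXaddC !rmorphD !rmorphM /= IH; congr (_ * _ + _).
  by rewrite rmorphD /= !horner_algX horner_algC alg_mpolyC subrK.
by rewrite !horner_algC.
Qed.

Variable fmin : R.
Hypothesis fmin_le : forall u, spectraplex u -> fmin <= f.@[u].

(** Functionals that satisfy the equality constraints vanish on the multiples of
    the polynomial of [critical_values_finite], rewritten in terms of [f - fmin]. *)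
Lemma moment_module_lower :
  exists D, forall E, feas_upto moment_module D E -> fmin <= riesz E f.
Proof.
have [p p0 [a [b pE]]] := critical_values_finite d f.
have Tq : graded_qmodule moment_module by exact: gen_qmodule_graded.
pose q := p \Po ('X + fmin%:P).
have q0 : q != 0.
  by rewrite /q comp_poly2_eq0 // size_XaddC.
have ann : annihilates moment_module (f - fmin%:MP) q.
  move=> h; pose H := horner_alg (f - fmin%:MP) h.
  pose D := (msize (a * H) + \sum_i \sum_j msize (b i j * H))%N.
  exists D => E EF; rewrite rmorphM /= horner_alg_shift pE -/H mulrDl raddfD /=.
  have -> : a * (\tr (pX R n) - 1) * H = (\tr (pX R n) - 1) * (a * H) by ring.
  rewrite (gen_feas_eq EF); [|by left|by apply: leq_trans (leqnSn _); exact: leq_addr].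
  rewrite add0r mulr_suml raddf_sum big1 // => i _.
  rewrite mulr_suml raddf_sum big1 // => j _ /=.
  rewrite [X in riesz E X](_ : _ = (pX R n *m Theta d f) i j * (b i j * H)); last by ring.
  rewrite (gen_feas_eq EF) //; first by right; exists i, j.
  rewrite /deg_le /D (bigD1 i) //= (bigD1 j) //=; lia.
have nonneg u : posset moment_module u -> 0 <= (f - fmin%:MP).@[u].
  move=> uS; rewrite mevalB mevalC subr_ge0; apply: fmin_le.
  by apply: posset_spectraplex uS; [|left].
have [D HD] := finite_convergence Tq q0 ann nonneg.
exists D => E EF; have := HD E EF.
by rewrite raddfB /= rieszC EF.1 mulr1 subr_ge0.
Qed.

Lemma feas_mom_lower : exists K, forall k, (K <= k)%N -> (k0 <= k)%N /\
  forall z, feas_mom d f k z -> fmin <= pairing f z.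
Proof.
have [D HD] := moment_module_lower; exists (k0 + D)%N => k kK; split; first by move: kK; lia.
by move=> z zF; rewrite pairingE; apply: HD; exact: moment_module_feas zF.
Qed.

Lemma f_mom_lower : exists2 K, (k0 <= K)%N & forall k, (K <= k)%N -> (fmin%:E <= f_mom d f k)%E.
Proof.
have [K HK] := feas_mom_lower; exists (maxn k0 K); first by rewrite leq_maxl.
move=> k; rewrite geq_max => /andP[_ /HK[_ h]].
by apply: le_ereal_inf_tmp => _ [z zF <-]; rewrite lee_fin; exact: h.
Qed.

Hypothesis n_gt0 : (0 < n)%N.

Lemma f_mom_upper k u : (k0 <= k)%N -> spectraplex u ->
  (forall w, spectraplex w -> f.@[u] <= f.@[w]) -> (f_mom d f k <= (f.@[u])%:E)%E.
Proof.
move=> kk uK umin; apply: ereal_inf_lbound.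
exists (point_moments (2 * k) u); first exact: point_feas_mom.
rewrite pairingE riesz_point //; apply: deg_le_mono (deg_le_homog f_homog).
by move: kk; rewrite uphalfE; lia.
Qed.

Lemma f_mom_fin k u : (k0 <= k)%N -> spectraplex u ->
  (forall w, spectraplex w -> f.@[u] <= f.@[w]) -> exists v : R, f_mom d f k = v%:E.
Proof.
move=> kk uK umin; have up := f_mom_upper kk uK umin.
have lo : ((- \sum_(m <- msupp f) `|f@_m|)%:E <= f_mom d f k)%E.
  apply: le_ereal_inf_tmp => _ [z [_ [zb _ z1 zm]] <-]; rewrite lee_fin pairingE.
  have k1 : (0 < k)%N by move: kk; rewrite uphalfE; lia.
  have bd := moments_bounded k1 zb z1 zm.
  rewrite /riesz lerNl -sumrN; apply: ler_sum => m _.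
  rewrite -mulrN; apply: le_trans (ler_norm _) _; rewrite normrM normrN ler_piMr //.
case: (f_mom d f k) up lo => [v|//|//] _ _.
by exists v.
Qed.

End Convergence.

(** * The second program and its limit *)

Section StepTwo.
Variables (R : realType) (n d : nat) (f : {mpoly R[sigma n]}).
Local Notation N := (sigma n).
Local Notation A := {mpoly R[N]}.
Local Notation k0 := (uphalf d.+1).

Lemma feas_step2_bounded k v (z : mvec R N (2 * k)) : (0 < k)%N ->
  feas_step2 f k v z -> bounded_by 1 (mentry z).
Proof. by move=> kp [_ [zb _ z1 zm]]; exact: moments_bounded. Qed.

Section Limit.
Variables (k : nat) (v : R) (E_ : nat -> 'X_{1..N < (2 * k).+1} -> R).
Hypothesis k_gt0 : (0 < k)%N.
Hypothesis EF : forall i, feas_step2 f k v (finfun (E_ i)).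
Let z_ i : mvec R N (2 * k) := finfun (E_ i).
Let z : mvec R N (2 * k) := finfun (ulimf E_).

Lemma feas_step2_fun_bounded i : bounded_by 1 (E_ i).
Proof.
move=> b; have := feas_step2_bounded k_gt0 (EF i) b.
by rewrite mentryE ffunE.
Qed.

Let lim q : ((fun i => riesz (mentry (z_ i)) q) @ omega --> riesz (mentry z) q)%classic.
Proof.
have LE (E : 'X_{1..N < (2 * k).+1} -> R) :
    riesz (mentry (finfun E : mvec R N (2 * k))) q = \sum_b q@_(val b) * E b.
  by rewrite -pairingE; apply: eq_bigr => b _; rewrite ffunE.
have -> : (fun i => riesz (mentry (z_ i)) q) = (fun i => \sum_b q@_(val b) * E_ i b).
  by apply/funext => i; exact: LE.
rewrite LE.
exact: (ulimf_lincomb_cvg _ _ feas_step2_fun_bounded).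
Qed.

Let lim_ge q : (forall i, 0 <= riesz (mentry (z_ i)) q) -> 0 <= riesz (mentry z) q.
Proof. by move=> h; apply: (omega_ge (@lim q)); exists 0%N => // i _; exact: h. Qed.

Let lim_eq q c : (forall i, riesz (mentry (z_ i)) q = c) -> riesz (mentry z) q = c.
Proof.
move=> h; apply: (omega_unique (@lim q)); under eq_fun do rewrite h.
exact: cvg_cst.
Qed.

Let lim_psd q : (forall i, psd (locmx q (z_ i))) -> psd (locmx q z).
Proof.
move=> h; apply/momblock_psdP => g gt; apply: lim_ge => i.
by have /momblock_psdP := h i; apply.
Qed.

(** The constraints are closed linear inequalities in finitely many entries each. *)
Lemma feas_step2_ulim : feas_step2 f k v z.
Proof.
split; split.
- apply/momblock_eq0P => g g' gt gt'; apply: lim_eq => i.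
  by have [[/momblock_eq0P h _ _] _] := EF i; exact: h.
- apply/mxblock_psdP; first exact: pX_sym.
  move=> g gt; apply: lim_ge => i; have [[_ h _] _] := EF i.
  by move/(mxblock_psdP _ _ (pX_sym R n)): h; apply.
- by apply: lim_psd => i; have [[]] := EF i.
- by apply: lim_psd => i; have [_ []] := EF i.
- by apply: lim_psd => i; have [_ []] := EF i.
- by rewrite pairingE; apply: lim_eq => i; rewrite -pairingE; have [_ []] := EF i.
- by apply: lim_psd => i; have [_ []] := EF i.
Qed.
End Limit.

(** The feasible set is bounded and closed. *)
Lemma optimizer_exists (xi : mvec R N d) k v : (0 < k)%N ->
  feas_step2 f k v <> set0 -> exists w, optimizer_step2 f xi (k := k) v w.
Proof.
move=> kp /eqP /set0P [w0 w0F].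
pose K : set ('X_{1..N < (2 * k).+1} -> R) := [set E | feas_step2 f k v (finfun E)]%classic.
have finfunK (w : mvec R N (2 * k)) : finfun (w : _ -> R) = w by apply/ffunP => b; rewrite ffunE.
have Kb E : K E -> bounded_by 1 E.
  by move=> EK; exact: (@feas_step2_fun_bounded k v (fun=> E) kp (fun=> EK) 0%N).
have Kc : uclosed K.
  by move=> E_ EK; exact: feas_step2_ulim.
have pc : ucontinuous 1 (fun E : 'X_{1..N < (2 * k).+1} -> R =>
    \sum_b (genpoly xi)@_(val b) * E b).
  by move=> E_ Eb; exact: ulimf_lincomb_cvg.
have K0 : (K !=set0)%classic by exists (w0 : _ -> R); rewrite /K /= finfunK.
have [E [EK Emin]] := min_attained K0 Kb Kc pc.
exists (finfun E); split=> // w' w'F.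
have -> : pairing (genpoly xi) (finfun E) = \sum_b (genpoly xi)@_(val b) * E b.
  by apply: eq_bigr => b _; rewrite ffunE.
by apply: Emin; rewrite /K /= finfunK.
Qed.

End StepTwo.

Section StepTwoLimit.
Variables (R : realType) (n : nat) (f : {mpoly R[sigma n]}).
Hypothesis n_gt0 : (0 < n)%N.
Local Notation N := (sigma n).
Local Notation A := {mpoly R[N]}.
Variables (fmin : R) (P : A) (us : 'I_N -> R).

Definition minimizers (v : R) : set ('I_N -> R) :=
  [set u | spectraplex u /\ f.@[u] <= v]%classic.

Lemma minimizers_closed v : uclosed (minimizers v).
Proof.
move=> u_ uK; split; first by apply: spectraplex_closed => i; case: (uK i).
have ub i := spectraplex_bounded (uK i).1.
by apply: (omega_le (meval_cvg f ub)); exists 0%N => // i _; case: (uK i).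
Qed.

(** With [v] the minimum of [f], the second program tests positivity on the set
    of minimizers of [f]. *)
Lemma step2_posset v u : posset (step2_module f v) u -> minimizers v u.
Proof.
move=> uS; split; first by apply: posset_spectraplex uS; [left|].
have [i0 _] : exists i : 'I_n, true by exists (Ordinal n_gt0).
have := gen_posset_mx uS (or_intror erefl) (fun i => (i == i0)%:R).
rewrite (bigD1 i0) //= addrC big1 => [|i ii]; last first.
  by rewrite big1 // => j _; rewrite (negPf ii) !mul0r.
rewrite (bigD1 i0) //= [X in _ + X]addrC big1 => [|i ii]; last first.
  by rewrite (negPf ii) mulr0 mul0r.
by rewrite eqxx !mul1r !add0r mxE eqxx mulr1n mevalB mevalC subr_ge0.
Qed.

Hypothesis usK : minimizers fmin us.
Hypothesis us_min : forall w, minimizers fmin w -> P.@[us] <= P.@[w].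
Hypothesis us_uniq : forall w, minimizers fmin w -> P.@[w] <= P.@[us] -> forall a, w a = us a.

(** Otherwise points nearly minimizing [P] would stay away from [us], and their
    limit would be a second minimizer. *)
Lemma penalty_bound a e : 0 < e -> exists2 C : R, 0 <= C &
  forall u, minimizers fmin u -> e / 2 <= e + C * (P.@[u] - P.@[us]) - (u a - us a) ^+ 2.
Proof.
move=> e0; apply: contrapT => no.
have ex (i : nat) : exists u, minimizers fmin u /\
    e + i%:R * (P.@[u] - P.@[us]) - (u a - us a) ^+ 2 < e / 2.
  apply: contrapT => h; apply: no; exists i%:R => // u uK.
  by rewrite leNgt; apply/negP => lt; apply: h; exists u.
have [u_ uP] := boolp.choice ex.
have ub i : bounded_by 1 (u_ i) := spectraplex_bounded (uP i).1.1.
pose u := ulimf u_.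
have uK : minimizers fmin u by apply: minimizers_closed => i; case: (uP i).
have usb := spectraplex_bounded usK.1.
have dist i : (u_ i a - us a) ^+ 2 <= 4.
  have := ub i a; have := usb a; rewrite !ler_norml => /andP[? ?] /andP[? ?]; nra.
have Pu : P.@[u] <= P.@[us].
  apply/ler_addgt0Pr => c c0; apply: (omega_le (meval_cvg P ub)).
  exists (Num.truncn (4 / c)).+1 => // i /= ic.
  have ci : 4 < i%:R * c.
    by rewrite -ltr_pdivrMr //; apply: lt_le_trans (truncnS_gt _) _; rewrite ler_nat.
  have i0 : 0 < i%:R :> R by rewrite ltr0n; apply: leq_trans ic.
  have [_ h] := uP i; have di := dist i.
  have h2 : i%:R * (P.@[u_ i] - P.@[us]) <= i%:R * c by lra.
  by rewrite ler_pM2l // in h2; lra.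
have ua := us_uniq uK Pu a.
have c1 := meval_cvg (('X_a - (us a)%:MP) ^+ 2) ub.
have := @omega_ge R (e / 2) _ _ c1.
rewrite rmorphXn /= mevalB mevalXU mevalC -/u ua subrr expr0n /= => h.
suff : e / 2 <= 0 by lra.
apply: h; exists 0%N => // i _ /=; rewrite rmorphXn /= mevalB mevalXU mevalC.
have [uiK h] := uP i; have := us_min uiK.
have : 0 <= i%:R :> R by [].
nra.
Qed.

(** By the penalty bound, a functional that is as small as [us] at [P] has second
    moments about [us] at most [e]. *)
Lemma step2_moments_close a e : 0 < e -> exists D, forall E,
  feas_upto (step2_module f fmin) D E -> riesz E P <= P.@[us] -> (E U_(a)%MM - us a) ^+ 2 <= e.
Proof.
move=> e0; have [C C0 HC] := penalty_bound a e0.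
pose G : A := e%:MP + C *: (P - (P.@[us])%:MP) - ('X_a - (us a)%:MP) ^+ 2.
have GS u : posset (step2_module f fmin) u -> e / 2 <= G.@[u].
  move=> /step2_posset uK; apply: le_trans (HC u uK) _.
  by rewrite /G mevalB mevalD mevalZ mevalB rmorphXn /= mevalB mevalXU !mevalC.
have Tq : graded_qmodule (step2_module f fmin) by exact: gen_qmodule_graded.
have e2 : 0 < e / 2 by rewrite divr_gt0.
have [D HD] := putinar Tq e2 GS.
exists (maxn D 2) => E EF EP.
have := HD E (feas_upto_le Tq (leq_maxl _ _) EF).
rewrite /G raddfB raddfD /= rieszZ raddfB /= !rieszC EF.1 !mulr1 => h.
have d1 : (msize ('X_a - (us a)%:MP : A) <= maxn D 2)%N.
  apply: leq_trans (leq_maxr _ _); apply: (@deg_leD _ _ 1); first by apply: deg_leX; rewrite mdeg1.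
  by apply: deg_leN; exact: deg_leC.
have d2 : (msize (1 : A) <= maxn D 2)%N.
  by apply: leq_trans (leq_maxr _ _); exact: (deg_le1 _ _ 1).
have := feas_CS Tq EF d1 d2; rewrite mulr1 expr1n riesz1 EF.1 mulr1.
rewrite raddfB /= rieszX rieszC EF.1 mulr1.
have : 0 <= C * (P.@[us] - riesz E P) by rewrite mulr_ge0 // subr_ge0.
lra.
Qed.

Lemma meval_neg_near (g : A) : bounded_by 1 us -> g.@[us] < 0 ->
  exists2 e, 0 < e & forall w, (forall a, (w a - us a) ^+ 2 <= e) -> g.@[w] < 0.
Proof.
move=> usb gus; apply: contrapT => no.
have ex (i : nat) : exists w, (forall a, (w a - us a) ^+ 2 <= i.+1%:R^-1) /\ 0 <= g.@[w].
  apply: contrapT => h; apply: no; exists i.+1%:R^-1; first by rewrite invr_gt0.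
  by move=> w wc; rewrite ltNge; apply/negP => gw; apply: h; exists w.
have [w_ wP] := boolp.choice ex.
have wb i : bounded_by 2 (w_ i).
  move=> a; have [/(_ a) h _] := wP i.
  have h1 : (w_ i a - us a) ^+ 2 <= 1.
    by apply: le_trans h _; rewrite invf_le1 ?ler1n.
  have := usb a; rewrite !ler_norml => /andP[? ?].
  by apply/andP; split; nra.
have wE a : ulimf w_ a = us a.
  apply/eqP; rewrite -subr_eq0 -sqrf_eq0 eq_le sqr_ge0 andbT.
  have c1 := meval_cvg (('X_a - (us a)%:MP) ^+ 2 : A) wb.
  rewrite rmorphXn /= mevalB mevalXU mevalC in c1.
  apply/ler_addgt0Pr => c c0; rewrite add0r; apply: (omega_le c1).
  have := near_infty_natSinv_lt (PosNum c0); apply: filterS => i /= lt.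
  rewrite rmorphXn /= mevalB mevalXU mevalC.
  by apply: le_trans ((wP i).1 a) (ltW lt).
have : 0 <= g.@[ulimf w_].
  by apply: (omega_ge (meval_cvg g wb)); exists 0%N => // i _; case: (wP i).
by rewrite (meval_eq _ wE) leNgt gus.
Qed.

End StepTwoLimit.

Section StepThree.
Variables (R : realType) (n d : nat) (f : {mpoly R[sigma n]}).
Hypothesis f_homog : f \is d.-homog.
Local Notation N := (sigma n).
Local Notation k0 := (uphalf d.+1).

Lemma first_moments_spectraplex k v (w : mvec R N (2 * k)) : (k0 <= k)%N ->
  feas_step2 f k v w -> spectraplex (fun a => first_moments w 0 a).
Proof.
move=> kk wF; have kD : (k0 + 0 <= k)%N by rewrite addn0.
have [w0 wP] := step2_module_feas f_homog kD wF.
have fmE a : first_moments w 0 a = riesz (mentry w) 'X_a by rewrite mxE rieszX.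
split.
  apply/psd_symXP => v'.
  have -> : (\sum_i \sum_j ((v' i * v' j)%:MP * pX R n i j)).@[fun a => first_moments w 0 a] =
     riesz (mentry w) (\sum_i \sum_j pX R n i j * ((v' i)%:MP * (v' j)%:MP)).
    rewrite !raddf_sum; apply: eq_bigr => i _; rewrite !raddf_sum; apply: eq_bigr => j _ /=.
    by rewrite -mpolyCM [in RHS]mulrC !mul_mpolyC mevalZ rieszZ [pX _ _ _ _]mxE mevalXU fmE.
  by apply: wP; apply: gen_mx; [left|move=> i; exact: deg_leC].
have := gen_feas_eq (conj w0 wP) erefl (deg_le1 _ _ 0).
rewrite mulr1 raddfB /= riesz1 w0 => /eqP; rewrite subr_eq0 => /eqP <-.
rewrite /mxtrace raddf_sum; apply: eq_bigr => i _ /=.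
by rewrite mxE fmE [in RHS]mxE.
Qed.

Lemma spectraplex_neq0 (u : 'rV[R]_N) : spectraplex (u 0) -> u <> 0.
Proof.
move=> [_ ut] u0; have : \tr (symX (u 0)) = 0 :> R.
  by rewrite /mxtrace big1 // => i _; rewrite !mxE u0 mxE.
by rewrite ut => /eqP; rewrite oner_eq0.
Qed.

Hypothesis n_gt0 : (0 < n)%N.
Variables (fmin : R) (xi : mvec R N d) (us : 'I_N -> R).
Local Notation P := (genpoly xi).
Hypothesis usK : minimizers f fmin us.
Hypothesis us_min : forall w, minimizers f fmin w -> P.@[us] <= P.@[w].
Hypothesis us_uniq : forall w, minimizers f fmin w -> P.@[w] <= P.@[us] -> forall a, w a = us a.
Hypothesis us_neg : f.@[us] < 0.

Lemma step2_eventually_negative : exists K, forall k, (K <= k)%N ->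
  forall w, optimizer_step2 f xi (k := k) fmin w -> evalp f (first_moments w) < 0.
Proof.
have usb := spectraplex_bounded usK.1.
have [e e0 He] := meval_neg_near usb us_neg.
have exD a : exists D, forall E, feas_upto (step2_module f fmin) D E ->
    riesz E P <= P.@[us] -> (E U_(a)%MM - us a) ^+ 2 <= e.
  exact: (step2_moments_close n_gt0 usK us_min us_uniq a e0).
have [D_ HD] := boolp.choice exD.
pose D := \max_a D_ a.
exists (k0 + D)%N => k kD w [wF wopt].
have kk : (k0 <= k)%N by move: kD; lia.
have EF := step2_module_feas f_homog kD wF.
have EP : riesz (mentry w) P <= P.@[us].
  have := wopt _ (point_feas_step2 n_gt0 f_homog kk usK.1 usK.2).
  rewrite !pairingE riesz_point //; apply: deg_le_mono (deg_le_genpoly _).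
  by move: kk; rewrite uphalfE; lia.
apply: He => a; rewrite mxE; apply: HD => //.
apply: feas_upto_le EF; first exact: gen_qmodule_graded.
exact: leq_bigmax.
Qed.

End StepThree.

(** * Lebesgue null sets of generic directions *)

Section NullSets.
Variables (R : realType) (I : finType) (i0 : I).
Local Notation V := {ffun I -> R}.
Local Open Scope classical_set_scope.

Definition box_vol (a b : V) : R := \prod_i (b i - a i).

Lemma box_vol_ge0 (a b : V) : (forall i, a i <= b i) -> 0 <= box_vol a b.
Proof. by move=> ab; apply: prodr_ge0 => i _; rewrite subr_ge0. Qed.

Lemma box_vol_point (a : V) : box_vol a a = 0.
Proof. by rewrite /box_vol (bigD1 i0) //= subrr mul0r. Qed.

Lemma sum_le_subset (J : eqType) (F : J -> R) (s t : seq J) :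
  (forall j, 0 <= F j) -> uniq s -> uniq t -> {subset s <= t} ->
  \sum_(j <- s) F j <= \sum_(j <- t) F j.
Proof.
move=> F0 us ut st.
have ps : perm_eq s [seq j <- t | j \in s].
  apply: uniq_perm => //; first exact: filter_uniq.
  by move=> j; rewrite mem_filter; apply/idP/andP => [js|[]//]; split=> //; exact: st.
rewrite (perm_big _ ps) /= big_filter [X in X <= _]big_mkcond /=.
by apply: ler_sum => j _; case: ifP.
Qed.

(** Boxes indexed by a countable type are listed along [pickle]; the unused
    indices get a degenerate box, which has volume zero because the index type
    [I] has the element [i0]. *)
Lemma null_of_countable_cover (A : set V) :
  (forall eps : R, 0 < eps -> exists (J : countType) (a b : J -> V),
    [/\ forall j i, a j i <= b j i,
        forall x, A x -> exists j, forall i, a j i <= x i <= b j i &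
        forall s : seq J, uniq s -> \sum_(j <- s) box_vol (a j) (b j) <= eps]) ->
  lebesgue_null A.
Proof.
move=> h eps /h[J [a [b [ab Aab vol]]]].
pose ext (c : J -> V) (m : nat) : V := oapp c [ffun=> 0] (@pickle_inv J m).
have voln m : box_vol (ext a m) (ext b m) = oapp (fun j => box_vol (a j) (b j)) 0 (@pickle_inv J m).
  by rewrite /ext; case: pickle_inv => //=; exact: box_vol_point.
exists (ext a), (ext b); split.
- by move=> m i; rewrite /ext; case: pickle_inv => //= j.
- by move=> x /Aab[j xj]; exists (pickle j); rewrite /ext pickleK_inv.
apply: lime_le.
  apply: is_cvg_nneseries => m _ _; rewrite lee_fin -/(box_vol _ _) voln.
  by case: pickle_inv => //= j; exact: box_vol_ge0.
apply: nearW => M; rewrite sumEFin lee_fin big_mkord.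
have -> : \sum_(m < M) box_vol (ext a m) (ext b m) =
    \sum_(j <- pmap (@pickle_inv J) (iota 0 M)) box_vol (a j) (b j).
  rewrite big_pmap -(big_mkord xpredT (fun m => box_vol (ext a m) (ext b m))) /index_iota subn0.
  by apply: eq_bigr => m _; rewrite voln.
by apply: vol; apply: (pmap_uniq (@pickle_invK J)); exact: iota_uniq.
Qed.

Lemma lebesgue_nullS (A B : set V) : A `<=` B -> lebesgue_null B -> lebesgue_null A.
Proof.
move=> AB Bn eps /Bn[a [b [ab Bab vol]]]; exists a, b; split=> // x Ax.
by apply: Bab; exact: AB.
Qed.

Lemma geometric_half (M : nat) : \sum_(j < M) (2^-1 : R) ^+ j.+1 <= 1.
Proof.
suff -> : \sum_(j < M) (2^-1 : R) ^+ j.+1 = 1 - 2^-1 ^+ M.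
  by rewrite lerBlDr lerDl exprn_ge0.
elim: M => [|M IH]; first by rewrite big_ord0 expr0 subrr.
by rewrite big_ord_recr /= IH exprS; field.
Qed.

Lemma null_bigcup (A : nat -> set V) : (forall k, lebesgue_null (A k)) ->
  lebesgue_null (\bigcup_k A k).
Proof.
move=> An; apply: null_of_countable_cover => eps eps0; exists (nat * nat)%type.
have ek k : 0 < eps * 2^-1 ^+ k.+1 by rewrite mulr_gt0 // exprn_gt0.
have ex k : exists ab : (nat -> V) * (nat -> V),
    [/\ forall m i, ab.1 m i <= ab.2 m i,
        forall x, A k x -> exists m, forall i, ab.1 m i <= x i <= ab.2 m i &
        (\sum_(0 <= m <oo) (box_vol (ab.1 m) (ab.2 m))%:E <= (eps * 2^-1 ^+ k.+1)%:E)%E].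
  by have [a [b [h1 h2 h3]]] := An k _ (ek k); exists (a, b); split.
have [ab abP] := boolp.choice ex.
exists (fun p => (ab p.1).1 p.2), (fun p => (ab p.1).2 p.2); split.
- by move=> [k m] i /=; case: (abP k).
- move=> x [k _ Akx]; have [_ /(_ x Akx)[m xm] _] := abP k.
  by exists (k, m).
move=> s us.
pose F (p : nat * nat) := box_vol ((ab p.1).1 p.2) ((ab p.1).2 p.2).
have F0 p : 0 <= F p by apply: box_vol_ge0 => i; case: (abP p.1).
pose M := (\max_(p <- s) maxn p.1 p.2).+1.
apply: (@le_trans _ _ (\sum_(p <- [seq (k, m) | k <- iota 0 M, m <- iota 0 M]) F p)).
  apply: sum_le_subset => //.
    by apply: allpairs_uniq; rewrite ?iota_uniq // => -[? ?] [? ?].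
  move=> [k m] sp; have : (maxn k m <= \max_(p <- s) maxn p.1 p.2)%N.
    by rewrite (big_rem _ sp) /= leq_max leqnn.
  rewrite geq_max => /andP[kM mM].
  by apply/allpairsP; exists (k, m); rewrite !mem_iota /= !add0n !ltnS.
rewrite big_allpairs /=.
have row k : \sum_(m <- iota 0 M) F (k, m) <= eps * 2^-1 ^+ k.+1.
  rewrite -lee_fin -sumEFin; have [_ _ h] := abP k; apply: le_trans h.
  have := @nneseries_lim_ge R (fun m => (F (k, m))%:E) xpredT 0 M.
  rewrite /index_iota subn0; apply=> m _ _; exact: F0.
apply: (@le_trans _ _ (\sum_(k <- iota 0 M) eps * 2^-1 ^+ k.+1)).
  by apply: ler_sum => k _; exact: row.
rewrite -mulr_sumr -[X in _ <= X]mulr1 ler_wpM2l ?(ltW eps0) //.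
have := geometric_half M.
by rewrite -(big_mkord xpredT (fun k => (2^-1 : R) ^+ k.+1)) /index_iota subn0.
Qed.

Lemma null_countable_cup (J : countType) (A : J -> set V) :
  (forall j, lebesgue_null (A j)) -> lebesgue_null [set x | exists j, A j x].
Proof.
move=> An.
have null0 : lebesgue_null (set0 : set V).
  apply: null_of_countable_cover => eps eps0; exists nat.
  exists (fun=> [ffun=> 0]), (fun=> [ffun=> 0]); split=> //.
  by move=> s _; rewrite big1 ?ltW // => j _; exact: box_vol_point.
apply: (@lebesgue_nullS _ (\bigcup_k oapp A set0 (unpickle k))).
  by move=> x [j Aj]; exists (pickle j) => //; rewrite pickleK.
by apply: null_bigcup => k; case: unpickle => //= j; exact: An.
Qed.

Definition lipschitz_graph (L : R) (A : set V) := forall x y, A x -> A y ->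
  `|x i0 - y i0| <= L * \sum_(j | j != i0) `|x j - y j|.

Lemma grid_cell (g : nat) (y : R) : (0 < g)%N -> 0 <= y <= g%:R ->
  exists c : 'I_g, c%:R <= y <= c%:R + 1.
Proof.
move=> g0 /andP[y0 yg].
have tp : (minn (Num.truncn y) g.-1 < g)%N by rewrite -(prednK g0) ltnS geq_minr.
have [c cE] : exists c : 'I_g, c = minn (Num.truncn y) g.-1 :> nat by exists (Ordinal tp).
exists c; rewrite cE; have [h1|h1] := leqP (Num.truncn y) g.-1.
  by rewrite natr1; have /andP[-> /ltW ->] := truncn_itv y0.
rewrite natr1 prednK // yg andbT.
by apply: le_trans (_ : (Num.truncn y)%:R <= y); rewrite ?ler_nat 1?ltnW //; case/andP: (truncn_itv y0).
Qed.

(** Cut the other coordinates into [g] intervals.  Over each of the [g ^ m] cells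
    the last coordinate varies in an interval of length proportional to the mesh,
    so the total volume is of order [1 / g]. *)
Lemma lipschitz_graph_bounded_null L A M : 0 <= L -> 0 < M -> lipschitz_graph L A ->
  (forall x, A x -> forall j, `|x j| <= M) -> lebesgue_null A.
Proof.
move=> L0 M0 AL AM; apply: null_of_countable_cover => eps eps0.
pose I' := {j : I | j != i0}.
pose m := #|[pred j | j != i0]|.
have mE : #|{: I'}| = m by rewrite card_sig.
pose T := 2 * L * m%:R * (2 * M) ^+ m * (2 * M).
have T0 : 0 <= T by rewrite /T !mulr_ge0 // ?exprn_ge0 // ?mulr_ge0 // ltW.
(* [T / g] is the total volume of the cover. *)
pose g := (Num.truncn (T / eps)).+1.
have g0 : (0 < g)%N by [].
have gR : 0 < g%:R :> R by rewrite ltr0n.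
pose dl := 2 * M / g%:R.
have dl0 : 0 < dl by rewrite /dl !divr_gt0 ?mulr_gt0.
pose C := {ffun I' -> 'I_g}.
pose incell (c : C) (x : V) := forall j : I', (- M + (c j)%:R * dl <= x (val j) <= - M + ((c j)%:R + 1) * dl).
pose r := L * (m%:R * dl).
have r0 : 0 <= r by rewrite /r !mulr_ge0 // ltW.
have ex (c : C) : exists y : R, forall x, A x -> incell c x -> y - r <= x i0 <= y + r.
  have [[x0 [Ax0 cx0]]|no] := pselect (exists x, A x /\ incell c x); last first.
    by exists 0 => x Ax cx; case: no; exists x.
  exists (x0 i0) => x Ax cx.
  have : `|x i0 - x0 i0| <= r.
    apply: le_trans (AL _ _ Ax Ax0) _; rewrite /r ler_wpM2l //.
    apply: (@le_trans _ _ (\sum_(j | j != i0) dl)); last first.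
      by rewrite sumr_const mulr_natl; exact: lexx.
    apply: ler_sum => j ji; pose j' : I' := exist _ j ji.
    have := cx j'; have := cx0 j'; rewrite /= ler_norml.
    by move=> /andP[? ?] /andP[? ?]; apply/andP; split; lra.
  rewrite ler_norml => /andP[? ?]; apply/andP; split; lra.
have [y yP] := boolp.choice ex.
pose lo (c : C) : V := [ffun j => if insub j is Some j' then - M + (c j')%:R * dl else y c - r].
pose hi (c : C) : V := [ffun j => if insub j is Some j' then - M + ((c j')%:R + 1) * dl else y c + r].
have lohi c j : lo c j <= hi c j.
  rewrite !ffunE; case: insubP => [j' _ _|_]; last by lra.
  by rewrite lerD2l ler_wpM2r ?(ltW dl0) // lerDl.
have vol c : box_vol (lo c) (hi c) = 2 * r * dl ^+ m.
  rewrite /box_vol (bigD1 i0) //= !ffunE insubF ?eqxx //; congr (_ * _); first by ring.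
  rewrite (eq_bigr (fun=> dl)); first by rewrite prodr_const.
  by move=> j ji; rewrite !ffunE insubT; ring.
exists C, lo, hi; split=> //.
  move=> x Ax.
  have cex (j : I') : exists c : 'I_g, (- M + c%:R * dl <= x (val j) <= - M + (c%:R + 1) * dl).
    have xy : 0 <= (x (val j) + M) / dl <= g%:R.
      have := AM x Ax (val j); rewrite ler_norml => /andP[? ?].
      rewrite divr_ge0 ?(ltW dl0) //=; last lra.
      rewrite ler_pdivrMr // /dl mulrC divfK ?gt_eqF //; lra.
    have [c /andP[c1 c2]] := grid_cell g0 xy; exists c.
    rewrite ler_pdivlMr // in c1; rewrite ler_pdivrMr // in c2.
    by apply/andP; split; lra.
  have [c cP] := boolp.choice cex.
  have xc : incell [ffun j => c j] x by move=> j; rewrite ffunE; exact: cP.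
  exists [ffun j => c j] => i; rewrite !ffunE.
  have [ii|ii] := eqVneq i i0; last by rewrite insubT /= ffunE; exact: (cP (Sub i ii)).
  by rewrite ii insubF ?eqxx //; exact: yP.
move=> s us; apply: (@le_trans _ _ (\sum_(c : C) box_vol (lo c) (hi c))).
  apply: sum_le_subset => //; first by move=> c; exact: box_vol_ge0.
    exact: index_enum_uniq.
  by move=> c _; exact: mem_index_enum.
rewrite (eq_bigr (fun=> 2 * r * dl ^+ m)) // sumr_const card_ffun card_ord mE -(mulr_natr (2 * r * dl ^+ m)).
have -> : 2 * r * dl ^+ m * (g ^ m)%:R = T / g%:R.
  rewrite natrX /r /T /dl expr_div_n; field.
  by rewrite expf_neq0 ?gt_eqF.
rewrite ler_pdivrMr // -ler_pdivrMl // mulrC ltW //.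
exact: truncnS_gt.
Qed.

Lemma lipschitz_graph_null L A : 0 <= L -> lipschitz_graph L A -> lebesgue_null A.
Proof.
move=> L0 AL.
apply: (@lebesgue_nullS _ (\bigcup_k (A `&` [set x : V | forall j, `|x j| <= k.+1%:R]))).
  move=> x Ax; exists (Num.truncn (\sum_j `|x j|)) => //; split=> // j.
  apply: ltW; apply: le_lt_trans (truncnS_gt _).
  by rewrite (bigD1 j) //= lerDl sumr_ge0.
apply: null_bigcup => k; apply: (@lipschitz_graph_bounded_null L _ k.+1%:R) => //.
  by move=> x y [Ax _] [Ay _]; exact: AL.
by move=> x [].
Qed.

End NullSets.

Section GenericMinimizer.
Variables (R : realType) (I : finType) (C : set {ffun I -> R}).
Local Notation V := {ffun I -> R}.
Local Open Scope classical_set_scope.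
Hypothesis C1 : forall c, C c -> forall i, `|c i| <= 1.

Definition linval (xi c : V) : R := \sum_i xi i * c i.
Definition argmin (xi : V) : set V := [set c | C c /\ forall c', C c' -> linval xi c <= linval xi c'].
Definition nonunique : set V :=
  [set xi | exists c c', [/\ argmin xi c, argmin xi c' & exists i, c i != c' i]].

(** Minimizers move against the direction: add the two minimality conditions. *)
Lemma argmin_monotone xi eta c c' : argmin xi c -> argmin eta c' ->
  \sum_i (xi i - eta i) * (c i - c' i) <= 0.
Proof.
move=> [Cc cmin] [Cc' cmin'].
have h1 := cmin _ Cc'; have h2 := cmin' _ Cc.
have -> : \sum_i (xi i - eta i) * (c i - c' i) =
    (linval xi c - linval xi c') + (linval eta c' - linval eta c).
  rewrite /linval -!sumrB -big_split; apply: eq_bigr => i _ /=; ring.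
lra.
Qed.

(** A fixed separation [e] of the two minimizers gives a uniform Lipschitz constant. *)
Definition gap_set (i : I) (q e : R) : set V :=
  [set xi | exists c c', [/\ argmin xi c, argmin xi c', c i <= q & q + e <= c' i]].

(** By monotonicity, comparing the upper minimizer of one direction with the lower
    minimizer of the other bounds the difference of the coordinates [i] of the two
    directions by the differences of the other coordinates. *)
Lemma gap_set_lipschitz i q e : 0 < e -> lipschitz_graph i (2 / e) (gap_set i q e).
Proof.
move=> e0.
have half x y : gap_set i q e x -> gap_set i q e y ->
    x i - y i <= 2 / e * \sum_(j | j != i) `|x j - y j|.
  move=> [_ [c [_ cx _ ci]]] [c' [_ [cy _ c'i _]]].
  have mono := argmin_monotone cx cy.
  rewrite (bigD1 i) //= in mono.
  set S := \sum_(j | j != i) `|x j - y j|.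
  have S0 : 0 <= S by apply: sumr_ge0.
  have tail : - (2 * S) <= \sum_(j | j != i) (x j - y j) * (c j - c' j).
    rewrite /S mulr_sumr -sumrN; apply: ler_sum => j _.
    have h1 := C1 cx.1 j; have h2 := C1 cy.1 j.
    have : `|(x j - y j) * (c j - c' j)| <= 2 * `|x j - y j|.
      rewrite normrM mulrC ler_wpM2r //.
      by apply: le_trans (ler_normB _ _) _; lra.
    by rewrite ler_norml => /andP[].
  have main : (x i - y i) * (c i - c' i) <= 2 * S by lra.
  have [xy|xy] := leP (x i - y i) 0.
    by apply: le_trans xy _; rewrite mulr_ge0 // divr_ge0 // ltW.
  rewrite mulrAC ler_pdivlMr //; apply: le_trans main.
  by rewrite ler_pM2l //; lra.
move=> x y Ax Ay; rewrite ler_norml; apply/andP; split; last exact: half.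
rewrite lerNl opprB; apply: le_trans (half _ _ Ay Ax) _.
by under eq_bigr do rewrite distrC.
Qed.

(** Two distinct minimizers differ in some coordinate by a gap with a rational
    lower end and a length [1 / m]: countably many Lipschitz graphs. *)
Lemma nonunique_null (i0 : I) : lebesgue_null nonunique.
Proof.
apply: (@lebesgue_nullS R I _ [set xi | exists j : I * rat * nat,
   gap_set j.1.1 (ratr j.1.2) (j.2.+1%:R^-1) xi]); last first.
  apply: (null_countable_cup i0) => j; apply: (@lipschitz_graph_null R I j.1.1 (2 / j.2.+1%:R^-1)).
    by apply: divr_ge0.
  by apply: gap_set_lipschitz; rewrite invr_gt0.
have key xi c c' i : argmin xi c -> argmin xi c' -> c i < c' i ->
    exists j : I * rat * nat, gap_set j.1.1 (ratr j.1.2) (j.2.+1%:R^-1) xi.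
  move=> ac ac' lt.
  have [q /andP[cq qc]] : exists q : rat, c i < ratr q < c' i.
    have [q] := rat_in_itvoo lt; rewrite in_itv /=; by exists q.
  have gap : 0 < c' i - ratr q by rewrite subr_gt0.
  have [m _ mlt] := near_infty_natSinv_lt (PosNum gap).
  exists (i, q, m), c, c'; split=> //=; first exact: ltW.
  have h : m.+1%:R^-1 < c' i - ratr q := mlt m (leqnn m).
  by rewrite addrC -lerBrDr ltW.
move=> xi [c [c' [ac ac' [i]]]]; rewrite neq_lt => /orP[lt|lt].
  exact: key ac ac' lt.
exact: key ac' ac lt.
Qed.

End GenericMinimizer.

(** * Executions of the algorithm *)

Section Runs.
Variables (R : realType) (n d : nat) (f : {mpoly R[sigma n]}) (xi : mvec R (sigma n) d).

Lemma always_reaches_sub (P Q : state R n -> Prop) s : (forall s, P s -> Q s) ->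
  always_reaches f xi P s -> always_reaches f xi Q s.
Proof.
move=> PQ; elim=> {s} [s Ps|s ex _ IH]; first by apply: Reached; exact: PQ.
exact: Reaches_later.
Qed.

Lemma step_inv s s' : step f xi s s' ->
  match s with
  | Step1 k => (0 <= f_mom d f k)%E /\ s' = Copositive \/ (f_mom d f k < 0)%E /\ s' = Step2 k
  | Step2 k => (exists v w, [/\ f_mom d f k = v%:E, optimizer_step2 f xi (k := k) v w & s' = Step3 k w])
      \/ exists v, [/\ f_mom d f k = v%:E, feas_step2 f k v = set0 & s' = Step1 k.+1]
  | Step3 k w => evalp f (first_moments w) < 0 /\ s' = NotCopositive (first_moments w)
      \/ 0 <= evalp f (first_moments w) /\ s' = Step1 k.+1
  | _ => False
  end.
Proof.
case=> {s s'} [k h|k h|k v w h1 h2|k v h1 h2|k w h|k w h]; [by left|by right| | |by left|by right].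
  by left; exists v, w.
by right; exists v.
Qed.

Variable P : state R n -> Prop.
Hypothesis n_gt0 : (0 < n)%N.
Hypothesis f_homog : f \is d.-homog.
Local Notation k0 := (uphalf d.+1).
Variable u0 : 'I_(sigma n) -> R.
Hypothesis u0K : spectraplex u0.
Hypothesis u0min : forall w, spectraplex w -> f.@[u0] <= f.@[w].
Hypothesis P_cop : forall k, (k0 <= k)%N -> (0 <= f_mom d f k)%E -> P Copositive.
Hypothesis P_not : forall k v (w : mvec R (sigma n) (2 * k)), (k0 <= k)%N -> feas_step2 f k v w ->
  evalp f (first_moments w) < 0 -> P (NotCopositive (first_moments w)).

(** One round of the loop.  It is never blocked, as the value of the relaxation is
    finite and the second program attains its optimum; it ends with an output or
    in the next round. *)
Lemma reaches_step k : (k0 <= k)%N ->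
  (forall v (w : mvec R (sigma n) (2 * k)), f_mom d f k = v%:E ->
     optimizer_step2 f xi v w -> 0 <= evalp f (first_moments w) ->
     always_reaches f xi P (Step1 k.+1)) ->
  (forall v, f_mom d f k = v%:E -> v < 0 -> feas_step2 f k v = set0 ->
     always_reaches f xi P (Step1 k.+1)) ->
  always_reaches f xi P (Step1 k).
Proof.
move=> kk next_opt next_inf.
have [v vE] := f_mom_fin f_homog n_gt0 kk u0K u0min.
have [fm|fm] := leP 0%E (f_mom d f k).
  apply: Reaches_later; first by exists Copositive; exact: Step1_stop.
  move=> s' /step_inv[[_ ->]|[lt _]]; first by apply: Reached; exact: P_cop fm.
  by move: lt; rewrite ltNge fm.
apply: Reaches_later; first by exists (Step2 k); exact: Step1_go.
move=> s' /step_inv[[ge _]|[_ ->]]; first by move: fm; rewrite ltNge ge.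
have v0 : v < 0 by rewrite -lte_fin -vE.
have k_gt0 : (0 < k)%N by move: kk; rewrite uphalfE; lia.
apply: Reaches_later.
  have [empty|nonempty] := pselect (feas_step2 f k v = set0).
    by exists (Step1 k.+1); exact: Step2_infeasible vE empty.
  have [w wopt] := optimizer_exists xi k_gt0 nonempty.
  by exists (Step3 k w); exact: Step2_feasible vE wopt.
move=> {}s' /step_inv[[v' [w [v'E wopt ->]]]|[v' [v'E empty ->]]]; last first.
  by apply: (next_inf _ v'E _ empty); rewrite -lte_fin -v'E.
have [fw|fw] := ltP (evalp f (first_moments w)) 0.
  apply: Reaches_later; first by exists (NotCopositive (first_moments w)); exact: Step3_stop.
  move=> {}s' /step_inv[[_ ->]|[ge _]]; first by apply: Reached; exact: P_not wopt.1 fw.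
  by move: fw; rewrite ltNge ge.
apply: Reaches_later; first by exists (Step1 k.+1); exact: Step3_go.
move=> {}s' /step_inv[[lt _]|[_ ->]]; first by move: fw; rewrite leNgt lt.
exact: next_opt v'E wopt fw.
Qed.

Lemma reaches_from_start K : (k0 <= K)%N -> always_reaches f xi P (Step1 K) ->
  always_reaches f xi P (init_state R n d).
Proof.
move=> kK; rewrite /init_state -(subnKC kK); elim: (K - k0)%N => [|j IH]; first by rewrite addn0.
rewrite addnS => h; apply: IH; apply: reaches_step => //; exact: leq_addr.
Qed.

End Runs.

Section Homogeneity.
Variables (R : realType) (N d : nat) (f : {mpoly R[N]}).
Hypothesis f_homog : f \is d.-homog.

Lemma meval_scale c (u : 'I_N -> R) : f.@[fun a => c * u a] = c ^+ d * f.@[u].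
Proof.
move/dhomogP: f_homog => hf; rewrite !mevalE mulr_sumr big_seq [RHS]big_seq.
apply: eq_bigr => m /hf /= <-; rewrite mulrCA; congr (_ * _).
rewrite mdegE -prodrXr -big_split; apply: eq_bigr => i _ /=.
by rewrite exprMn.
Qed.
End Homogeneity.

Theorem theorem4p3 (R : realType) (n d : nat) (f : {mpoly R[sigma n]})
    (n_gt0 : (0 < n)%N) (f_homog : f \is d.-homog) :
  exists Omega : set (mvec R (sigma n) d),
    lebesgue_null Omega /\
    forall xi : mvec R (sigma n) d, ~ Omega xi ->
      [/\ always_reaches f xi (@is_output R n) (init_state R n d),
          copositive f ->
            (exists K : nat, forall k : nat, (K <= k)%N -> (0 <= f_mom d f k)%E) /\
            always_reaches f xi (fun s => s = Copositive) (init_state R n d) &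
          ~ copositive f ->
            always_reaches f xi
              (fun s => exists u : 'rV[R]_(sigma n),
                 [/\ s = NotCopositive u, u <> 0, psd (symX (u 0)) &
                     evalp f u < 0])
              (init_state R n d)].
Proof.
pose N := sigma n.
have [u0 [u0K _ u0min']] := @spectraplex_min R n (fun=> False) f
  (let: ex_intro u uK := spectraplex_ne R n_gt0 in
   ex_intro2 _ _ u uK (fun g (h : False) => match h with end)).
have u0min w : spectraplex w -> f.@[u0] <= f.@[w] by move=> wK; apply: u0min'.
pose fmin := f.@[u0].
have [K kK Klow] := f_mom_lower f_homog u0min.
(* The monomial vectors of the minimizers of [f]; a direction is generic when it
   has a single minimizer among them. *)
pose C : set {ffun 'X_{1..N < d.+1} -> R} :=
  [set c | exists2 u, minimizers f fmin u & c = point_moments d u]%classic.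
have C1 c : C c -> forall i, `|c i| <= 1.
  move=> [u [uK _] ->] i; rewrite ffunE mevalX normr_prod.
  apply: prodr_ile1 => a _; rewrite normrX exprn_ge0 //=.
  by apply: exprn_ile1 => //; exact: spectraplex_bounded.
exists (nonunique C); split.
  exact: (nonunique_null C1 bm0).
move=> xi xiC.
have fm w : evalp f w = f.@[fun a => w 0 a] by [].
have cop_run : copositive f ->
    (exists K : nat, forall k : nat, (K <= k)%N -> (0 <= f_mom d f k)%E) /\
    always_reaches f xi (fun s => s = Copositive) (init_state R n d).
  move=> cop.
  have copK u : spectraplex u -> 0 <= f.@[u].
    move=> [up _]; have := cop (\row_a u a); rewrite fm.
    have E a : (\row_a u a) 0 a = u a by rewrite mxE.
    rewrite (meval_eq _ E); apply.
    suff -> : (\row_a u a) 0 = u by [].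
    by apply/funext.
  have fge k : (K <= k)%N -> (0 <= f_mom d f k)%E.
    by move=> /Klow; apply: le_trans; rewrite lee_fin; exact: copK.
  split; first by exists K.
  have Pn k v (w : mvec R N (2 * k)) : (uphalf d.+1 <= k)%N -> feas_step2 f k v w ->
      evalp f (first_moments w) < 0 -> NotCopositive (first_moments w) = Copositive.
    move=> kk wF; rewrite ltNge fm copK //.
    exact: (first_moments_spectraplex f_homog kk wF).
  apply: (reaches_from_start n_gt0 f_homog u0K u0min (fun _ _ _ => erefl) Pn kK).
  apply: Reaches_later; first by exists Copositive; apply: Step1_stop; exact: fge.
  move=> s' /step_inv[[_ ->]|[lt _]]; first by apply: Reached.
  by move: lt; rewrite ltNge fge.
have noncop_run : ~ copositive f -> always_reaches f xi
    (fun s => exists u : 'rV[R]_(sigma n),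
       [/\ s = NotCopositive u, u <> 0, psd (symX (u 0)) & evalp f u < 0])
    (init_state R n d).
  move=> ncop.
  have fneg : fmin < 0.
    rewrite ltNge; apply/negP => f0; apply: ncop => u up; rewrite fm.
    have [t [w [t0 wK uE]]] : exists t w, [/\ 0 <= t, spectraplex w & forall a, u 0 a = t * w a].
      have ent (a : 'I_N) : u 0 a = symX (u 0) (pidx a).1 (pidx a).2 by rewrite mxE pidxK.
      have [tr0|tr0] := eqVneq (\tr (symX (u 0))) 0.
        exists 0, u0; split=> // a; rewrite mul0r ent.
        by rewrite (psd_tr0 up tr0) mxE.
      have trp : 0 < \tr (symX (u 0)).
        by rewrite lt0r tr0 /=; apply: sumr_ge0 => i _; exact: psd_diag.
      have [w wK wE] := spectraplex_normalize up trp.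
      exists (\tr (symX (u 0))), w; split=> //; first exact: ltW.
      move=> a; have -> : w a = symX w (pidx a).1 (pidx a).2 by rewrite mxE pidxK.
      by rewrite wE ent [in RHS]mxE mulVKf.
    rewrite (meval_eq _ uE) (meval_scale f_homog) mulr_ge0 ?exprn_ge0 //.
    by apply: le_trans f0 _; exact: u0min.
  have Pn k v (w : mvec R N (2 * k)) : (uphalf d.+1 <= k)%N -> feas_step2 f k v w ->
      evalp f (first_moments w) < 0 -> exists u : 'rV[R]_(sigma n),
       [/\ NotCopositive (first_moments w) = NotCopositive u, u <> 0, psd (symX (u 0)) & evalp f u < 0].
    move=> kk wF fw; exists (first_moments w).
    have wK := first_moments_spectraplex f_homog kk wF.
    by split=> //; [exact: spectraplex_neq0|case: wK].
  have Pc k : (uphalf d.+1 <= k)%N -> (0 <= f_mom d f k)%E ->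
     exists u : 'rV[R]_(sigma n),
       [/\ Copositive = NotCopositive u, u <> 0, psd (symX (u 0)) & evalp f u < 0].
    move=> kk f0; have := le_trans f0 (f_mom_upper f_homog n_gt0 kk u0K u0min).
    by rewrite lee_fin leNgt fneg.
  have [K2 HK2] : exists K2, forall k, (K2 <= k)%N -> (uphalf d.+1 <= k)%N ->
      forall w, optimizer_step2 f xi (k := k) fmin w -> evalp f (first_moments w) < 0.
    (* In degree 0 the monomials do not separate points, but [f] is constant. *)
    have [d0|d_gt0] := posnP d.
      exists 0%N => k _ _ w _; rewrite fm.
      have h u : f.@[u] = f.@[fun a => 0 * u a] by rewrite (meval_scale f_homog) d0 expr0 mul1r.
      rewrite h (meval_eq (v2 := fun a => 0 * u0 a)) -?h // => a.
      by rewrite !mul0r.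
    (* The point [us] to which the second program converges: the minimizer of the
       generic direction over the minimizers of [f]. *)
    pose gs (g : {mpoly R[N]}) := g = fmin%:MP - f.
    have gsP u : (forall g, gs g -> 0 <= g.@[u]) <-> f.@[u] <= fmin.
      split=> [h|h g ->]; last by rewrite mevalB mevalC subr_ge0.
      by have := h _ erefl; rewrite mevalB mevalC subr_ge0.
    have [us [us1 /gsP us2 usmin']] := spectraplex_min (genpoly xi)
      (ex_intro2 _ _ u0 u0K ((gsP u0).2 (lexx _))).
    have usmin w : minimizers f fmin w -> (genpoly xi).@[us] <= (genpoly xi).@[w].
      by move=> [wK /gsP wf]; exact: usmin'.
    have valE u : (genpoly xi).@[u] = linval xi (point_moments d u).
      rewrite /genpoly raddf_sum; apply: eq_bigr => m _ /=.
      by rewrite mevalZ ffunE.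
    have arg u : minimizers f fmin u -> (genpoly xi).@[u] <= (genpoly xi).@[us] ->
        argmin C xi (point_moments d u).
      move=> uK uus; split; first by exists u.
      move=> _ [w wK ->]; rewrite -!valE; apply: le_trans uus _; exact: usmin.
    have usuniq w : minimizers f fmin w -> (genpoly xi).@[w] <= (genpoly xi).@[us] ->
        forall a, w a = us a.
      move=> wK wus a; apply/eqP/negPn/negP => ne; apply: xiC.
      exists (point_moments d w), (point_moments d us); split.
      - exact: arg.
      - by apply: arg.
      have dU : (mdeg (U_(a)%MM : 'X_{1..N}) < d.+1)%N by rewrite mdeg1 ltnS.
      by exists (BMultinom dU); rewrite !ffunE !mevalXU.
    have usneg : f.@[us] < 0 by apply: le_lt_trans us2 fneg.
    have [K2 HK2] := step2_eventually_negative f_homog n_gt0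
      (conj us1 us2 : minimizers f fmin us) usmin usuniq usneg.
    by exists K2 => k kK2 _; exact: HK2.
  pose K' := maxn K K2.
  have kK' : (uphalf d.+1 <= K')%N by rewrite (leq_trans kK) // leq_maxl.
  apply: (reaches_from_start n_gt0 f_homog u0K u0min Pc Pn kK').
  have fE : f_mom d f K' = fmin%:E.
    apply/eqP; rewrite eq_le (f_mom_upper f_homog n_gt0 kK' u0K u0min) /=.
    by apply: Klow; exact: leq_maxl.
  apply: (reaches_step n_gt0 f_homog u0K u0min Pc Pn kK').
    move=> v w; rewrite fE => -[<-] wopt; rewrite leNgt.
    by rewrite (HK2 K' (leq_maxr _ _) kK' w wopt).
  move=> v; rewrite fE => -[<-] _ empty; exfalso.
  have : feas_step2 f K' fmin (point_moments (2 * K') u0).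
    exact: (point_feas_step2 n_gt0 f_homog kK' u0K (lexx _)).
  by rewrite empty.
split=> //.
have [cop|ncop] := pselect (copositive f).
  by apply: always_reaches_sub (cop_run cop).2 => s ->.
by apply: always_reaches_sub (noncop_run ncop) => s [u [-> _ _ _]].
Qed.
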